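(* Let $p$ be a prime, $F=\mathbb Q_p$, $O=\mathbb Z_p$, and $(V,Q)$ a non-degenerate quadratic space over $F$ of dimension $n$, Witt index $\ell\geqslant1$, anisotropic kernel dimension $n_0=n-2\ell$, with bilinear form $\beta$. Assume $f=2$. Let $L$ be a maximal lattice, $A=\frac{n_0}{2}-1$ and $B=-\partial+\frac{n_0}{2}$. Then, as identities of formal power series in $T$, $$\boldsymbol\zeta^{(0)}_{\beta,L}(T^2)=\prod_{r=0}^{\ell}\big(1-p^{2(A+\ell-\frac{r-1}{2})r}T^2\big)^{-1}W^{(0)}_{\ell,A,B}(p,T),\qquad \boldsymbol\zeta^{(1)}_{\beta,L}(T^2)\,T=\prod_{r=0}^{\ell}\big(1-p^{2(A+\ell-\frac{r-1}{2})r}T^2\big)^{-1}W^{(1)}_{\ell,A,B}(p,T),$$ and $$\zeta_{\beta,L}(s)=\prod_{r=0}^{\ell}\big(1-p^{2(A+\ell-\frac{r-1}{2})r}p^{-ns}\big)^{-1}W^{\rm total}_{\ell,A,B}(p,p^{-s/2}).$$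
   Context: Setting: $Q(v)=\frac12\beta(v,v)$; $G$ is the Zariski identity component of $\mathrm{GO}(V,Q)=\{g\in\mathrm{GL}(V)\mid Q(gv)=\mu(g)Q(v)\}$ and $f$ is defined by $f\mathbb Z=\mathrm{ord}_p\mu(G)$. Lattices are finitely generated $O$-submodules of rank $n$; $\mu(L)$ is the fractional ideal generated by $Q(v)$, $v\in L$; maximal lattices are those maximal for inclusion among lattices of the same norm. A maximal lattice admits a Witt decomposition $L=\sum_{j=1}^\ell(Ov_j+\mu(L)v_j^* )+L_0$ with $\beta(v_i,v_j)=\beta(v_i^*,v_j^* )=0$, $\beta(v_i,v_j^* )=\delta_{ij}$, $W$ the (anisotropic) orthogonal complement of the $v_j,v_j^*$, and $L_0=\{w\in W\mid Q(w)\in\mu(L)\}$; with $L_0^{[+1]}=\{w\in W\mid Q(w)\in p\mu(L)\}$, $\partial=\dim_{\mathbb F_p}L_0/L_0^{[+1]}$ (independent of choices). For $m\ge0$, $\mathfrak L^{\max}_{\beta,L}(p^m)=\{\Lambda\text{ maximal}\mid\Lambda\subset L,\ \mu(\Lambda)=p^m\mu(L)\}$; $\boldsymbol\zeta^{(0)}_{\beta,L}(T)=\sum_m\#\mathfrak L^{\max}_{\beta,L}(p^{2m})T^m$, $\boldsymbol\zeta^{(1)}_{\beta,L}(T)=\sum_m\#\mathfrak L^{\max}_{\beta,L}(p^{2m+1})T^m$, and $\zeta_{\beta,L}(s)=\sum_{\Lambda\text{ maximal},\Lambda\subset L}[L:\Lambda]^{-s}$. Polynomials: $[m,k]=\{x\in\mathbb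 Z\mid m\le x\le k\}$. $\varphi_i(q)=\prod_{j=1}^i(q^j-1)$; for $I=\{i_1<\dots<i_r\}\subset[1,\ell-1]$, $i_0=0,i_{r+1}=\ell$, $\varphi_{(I)}(q)=\varphi_\ell(q)/\prod_{\nu=0}^r\varphi_{i_{\nu+1}-i_\nu}(q)$; for $K\subset[1,\ell-1]$, $w_{\ell,K}(q)=\sum_{I\subset K}(-1)^{\#(K\setminus I)}\varphi_{(I)}(q)$. For $J\subset[0,\ell-1]$: $a_\ell(J)=\sum_{i\in J}\big(\frac{\ell(\ell+1)}2-\frac{i(i+1)}2\big)$, $b_\ell(J)=\sum_{i\in J}(\ell-1-i)$, and for $J=\{j_1<\dots<j_t\}$, $\langle J\rangle=\sum_{\nu=1}^t(-1)^\nu(j_\nu-\ell)$. Put $\mathcal U_{\ell,J}(X,u,T)=u^{b_\ell(J)}X^{a_\ell(J)}\sum_{I_0\subset J\cap[1,\ell-1],\,I_1\subset[1,\ell-1]\setminus J}w_{\ell,I_0\cup I_1}(X^{-1})\big(X^{a_\ell(I_1)}u^{b_\ell(I_1)}T^{\#I_1}\big)^2$. For $B\in\frac12\mathbb Z$, $U^{\rm even}_{\ell,B}(X,u,T)$ (resp. $U^{\rm odd}_{\ell,B}$) $=\sum X^{B\langle J\rangle}\mathcal U_{\ell,J}(X,u,T)T^{\#J}$ over $J\subset[0,\ell-1]$ with $\#J$ even (resp. odd). Then $W^{(0)}_{\ell,A,B}(X,T)=U^{\rm even}_{\ell,B}(X,X^A,X^AT)+U^{\rm odd}_{\ell,B}(X,X^A,X^AT)\,T$,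 $W^{(1)}_{\ell,A,B}(X,T)=U^{\rm even}_{\ell,-B}(X,X^A,X^AT)\,T+U^{\rm odd}_{\ell,-B}(X,X^A,X^AT)$, and with $n=2(\ell+A+1)$, $W^{\rm total}_{\ell,A,B}(X,Y)=W^{(0)}_{\ell,A,B}(X,Y^n)+W^{(1)}_{\ell,A,B}(X,Y^n)Y^{-2B}$. *)

(* Defs.v *)
From HB Require Import structures.
From mathcomp Require Import all_boot all_order all_algebra.
From mathcomp Require Import finmap fraction sesquilinear.
From mathcomp Require Import complex.
From mathcomp Require Import all_classical all_reals.
From mathcomp Require Import topology normedtype exp trigo.
From mathcomp Require Import summability.

Set Implicit Arguments.
Unset Strict Implicit.
Unset Printing Implicit Defensive.

Import Order.TTheory GRing.Theory Num.Theory.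
Import numFieldNormedType.Exports.

Local Open Scope classical_set_scope.
Local Open Scope ring_scope.

(* The number of elements of a finite set (0 if A is infinite). *)
Definition ncard (T : choiceType) (A : set T) : nat := #|` fset_set A|%fset.

(** * The ring Z_p and the field Q_p *)

(* Z_p is the inverse limit of the Z/p^n: x n is the representative in
   [0, p^n[ of x modulo p^n. *)
Record padic_int (p : nat) (p_pr : prime p) := PadicInt {
  padic_seq :> nat -> int;
  padic_seqP : forall n, padic_seq n = (padic_seq n.+1 %% (p ^ n)%N)%Z }.

Section PadicInt.
Variables (p : nat) (p_pr : prime p).
Local Notation Zp := (padic_int p_pr).
Local Notation pn n := ((p ^ n)%N%:Z).

HB.instance Definition _ := gen_eqMixin Zp.
HB.instance Definition _ := gen_choiceMixin Zp.

Lemma padic_int_eq (x y : Zp) : (forall n, x n = y n) -> x = y.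
Proof.
case: x y => [x xP] [y yP] /= /funext exy; case: y / exy yP => yP.
by congr PadicInt; apply: Prop_irrelevance.
Qed.

Lemma padic_modS (m : int) n : ((m %% pn n.+1)%Z %% pn n)%Z = (m %% pn n)%Z.
Proof.
have E (q r : int) : ((q * pn n.+1 + r) %% pn n)%Z = (r %% pn n)%Z.
  by rewrite expnS PoszM mulrA modzMDl.
by rewrite [in RHS](divz_eq m (pn n.+1)) E.
Qed.

Lemma padic_mod (x : Zp) n : (x n %% pn n)%Z = x n.
Proof. by rewrite padic_seqP modz_mod. Qed.

Fact padic_of_int_subproof (u : nat -> int) :
    (forall n, u n.+1 = u n %[mod pn n])%Z ->
  forall n, (u n %% pn n = (u n.+1 %% pn n.+1)%Z %% pn n)%Z.
Proof. by move=> uP n; rewrite padic_modS uP. Qed.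

Definition padic_of_seq u uP : Zp := PadicInt p_pr (@padic_of_int_subproof u uP).

Lemma padic_seqS (x : Zp) n : (x n.+1 = x n %[mod pn n])%Z.
Proof. by rewrite -padic_seqP padic_mod. Qed.

Definition padic_const (m : int) : Zp := @padic_of_seq (fun=> m) (fun=> erefl).

Fact padic_add_subproof (x y : Zp) n : (x n.+1 + y n.+1 = x n + y n %[mod pn n])%Z.
Proof. by rewrite -modzDm !padic_seqS modzDm. Qed.
Definition padic_add x y := padic_of_seq (padic_add_subproof x y).

Fact padic_opp_subproof (x : Zp) n : (- x n.+1 = - x n %[mod pn n])%Z.
Proof. by rewrite -modzNm padic_seqS modzNm. Qed.
Definition padic_opp x := padic_of_seq (padic_opp_subproof x).

Fact padic_mul_subproof (x y : Zp) n : (x n.+1 * y n.+1 = x n * y n %[mod pn n])%Z.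
Proof. by rewrite -modzMm !padic_seqS modzMm. Qed.
Definition padic_mul x y := padic_of_seq (padic_mul_subproof x y).

Fact padic_addA : associative padic_add.
Proof.
by move=> x y z; apply: padic_int_eq => n /=; rewrite modzDml modzDmr addrA.
Qed.
Fact padic_addC : commutative padic_add.
Proof. by move=> x y; apply: padic_int_eq => n /=; rewrite addrC. Qed.
Fact padic_add0 : left_id (padic_const 0) padic_add.
Proof.
by move=> x; apply: padic_int_eq => n /=; rewrite modzDml add0r padic_mod.
Qed.
Fact padic_addN : left_inverse (padic_const 0) padic_opp padic_add.
Proof. by move=> x; apply: padic_int_eq => n /=; rewrite modzDml addNr. Qed.
HB.instance Definition _ :=
  GRing.isZmodule.Build Zp padic_addA padic_addC padic_add0 padic_addN.

Fact padic_mulA : associative padic_mul.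
Proof.
by move=> x y z; apply: padic_int_eq => n /=; rewrite modzMml modzMmr mulrA.
Qed.
Fact padic_mulC : commutative padic_mul.
Proof. by move=> x y; apply: padic_int_eq => n /=; rewrite mulrC. Qed.
Fact padic_mul1 : left_id (padic_const 1) padic_mul.
Proof.
by move=> x; apply: padic_int_eq => n /=; rewrite modzMml mul1r padic_mod.
Qed.
Fact padic_mulD : left_distributive padic_mul padic_add.
Proof.
by move=> x y z; apply: padic_int_eq => n /=; rewrite modzMml modzDm mulrDl.
Qed.
Fact padic_1neq0 : padic_const 1 != padic_const 0.
Proof.
apply/eqP => /(congr1 (fun x : Zp => x 1%N)) /=.
by rewrite expn1 mod0z modz_small // ltz_nat prime_gt1.
Qed.
HB.instance Definition _ := GRing.Zmodule_isComNzRing.Build Zp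
  padic_mulA padic_mulC padic_mul1 padic_mulD padic_1neq0.

Definition padic_unit : pred Zp := fun x => `[< exists y : Zp, y * x = 1 >].
Definition padic_inv (x : Zp) : Zp := xget x [set y | y * x = 1].

Fact padic_mulV : {in padic_unit, left_inverse 1 padic_inv *%R}.
Proof. by move=> x /asboolP[y yx1]; rewrite /padic_inv; case: xgetP => [z _ //|/(_ y)]. Qed.
Fact padic_unitPl (x y : Zp) : y * x = 1 -> padic_unit x.
Proof. by move=> yx1; apply/asboolP; exists y. Qed.
Fact padic_inv_out : {in [predC padic_unit], padic_inv =1 id}.
Proof.
move=> x /negP xNu; rewrite /padic_inv; case: xgetP => // y _ yx1.
by case: xNu; apply: padic_unitPl yx1.
Qed.
HB.instance Definition _ := GRing.ComNzRing_hasMulInverse.Build Zp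
  padic_mulV padic_unitPl padic_inv_out.

Lemma padic_dvd (x : Zp) m n : (m <= n)%N -> (pn m %| x n)%Z = (pn m %| x m)%Z.
Proof.
elim: n => [|n IHn]; first by rewrite leqn0 => /eqP->.
rewrite leq_eqVlt => /predU1P[->//|]; rewrite ltnS => le_mn.
rewrite -IHn // [x n]padic_seqP.
have dmn : (pn m %| pn n)%Z by rewrite dvdzE /= dvdn_exp2l.
by rewrite [in LHS](divz_eq (x n.+1) (pn n)) rpredDl ?dvdz_mull.
Qed.

Lemma padic_eq0 (x : Zp) : (forall n, (pn n %| x n)%Z) -> x = 0.
Proof.
move=> xP; apply: padic_int_eq => n /=.
by rewrite mod0z -padic_mod; apply/dvdz_mod0P.
Qed.

Fact padic_integral (x y : Zp) : x * y = 0 -> (x == 0) || (y == 0).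
Proof.
move=> xy0; apply/negPn; rewrite negb_or; apply/negP => /andP[/eqP x0 /eqP y0].
have ex (z : Zp) : z <> 0 -> exists n, ~~ (pn n %| z n)%Z.
  move=> z0; apply: contrapT => zn; apply: z0; apply: padic_eq0 => n.
  by apply/negPn/negP => zn'; apply: zn; exists n.
have [[a xa] [b yb]] := (ex x x0, ex y y0).
have := congr1 (fun x : Zp => x (a + b)%N) xy0; rewrite /= mod0z.
move/dvdz_mod0P; rewrite dvdzE abszM /=.
move: xa yb; rewrite -(padic_dvd x (leq_addr b a)) -(padic_dvd y (leq_addl a b)).
rewrite !dvdzE /=; move: `|x _|%N `|y _|%N => c d xa yb.
have [c0 d0] : (0 < c)%N /\ (0 < d)%N.
  by split; [move: xa; case: (c) | move: yb; case: (d)] => //; rewrite dvdn0.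
move: xa yb; rewrite !pfactor_dvdn ?muln_gt0 ?c0 // lognM // -!ltnNge => xa yb.
by rewrite leqNgt (leq_trans _ (leq_add xa yb)) // addSn ltnS leq_add2l leqnSn.
Qed.
HB.instance Definition _ := GRing.ComUnitRing_isIntegral.Build Zp padic_integral.

End PadicInt.

Notation padic p_pr := {fraction (padic_int p_pr)}.

Section PadicField.
Variables (p : nat) (p_pr : prime p).
Local Notation O := (padic_int p_pr).
Local Notation F := (padic p_pr).

Definition padic_integers : set F := range (@tofrac O).

(* ord_p x = k for nonzero x *)
Definition padic_ord (x : F) (k : int) : Prop :=
  exists2 u : O, u \is a GRing.unit & x = (p%:R : F) ^ k * tofrac u.

End PadicField.

(** * The Zariski topology *)

Inductive polynomial_fun (F : fieldType) (W : vectType F) : (W -> F) -> Prop :=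
| polynomial_cst c : polynomial_fun (fun=> c)
| polynomial_lin (f : 'Hom(W, F^o)) : polynomial_fun f
| polynomial_add f g : polynomial_fun f -> polynomial_fun g ->
    polynomial_fun (fun x => f x + g x)
| polynomial_mul f g : polynomial_fun f -> polynomial_fun g ->
    polynomial_fun (fun x => f x * g x).

Definition zariski (F : fieldType) (W : vectType F) : Type := W.
HB.instance Definition _ (F : fieldType) (W : vectType F) :=
  Choice.copy (zariski W) W.
HB.instance Definition _ (F : fieldType) (W : vectType F) :=
  @isSubBaseTopological.Build (zariski W) (set (zariski W))
    [set A | exists2 f : W -> F, polynomial_fun f & A = [set x | f x != 0]] id.

(** * Quadratic spaces over a field *)

Section QuadraticSpace.
Variables (F : fieldType) (V : vectType F) (beta : {symmetric V}).

Definition quad (v : V) : F := beta v v / 2%:R.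

Definition witt_index : nat :=
  (\max_(k < (\dim {:V}).+1 |
      `[< exists2 U : {vspace V}, \dim U = k &
                                  {in U, forall v, quad v = 0%R} >]) k)%N.

Definition similitude (g : 'End(V)) (m : F) : Prop :=
  forall v, quad (g v) = m * quad v.

Definition GO : set 'End(V) :=
  [set g | lker g == 0%VS /\ exists m, similitude g m].

Definition GO0 : set 'End(V) :=
  connected_component (GO : set (zariski 'End(V))) (\1%VF : 'End(V)).

End QuadraticSpace.

(** * Lattices in a quadratic space over Q_p *)

Section Lattices.
Variables (p : nat) (p_pr : prime p).
Local Notation O := (padic_int p_pr).
Local Notation F := (padic p_pr).
Variables (V : vectType F) (beta : {symmetric V}).
Local Notation Q := (quad beta).
Local Notation ell := (witt_index beta).

(* ord_p mu(G) = f Z, where G is the identity component of GO(V, Q) *)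
Definition similitude_index (f : nat) : Prop :=
  [set k : int | exists g m, [/\ GO0 beta g, similitude beta g m & padic_ord m k]]
  = [set f%:Z * k | k in [set: int]].

Definition Ospan (W : lmodType F) (A : set W) : set W :=
  [set x | exists (k : nat) (c : 'I_k -> O) (e : 'I_k -> W),
    (forall i, A (e i)) /\ x = \sum_i tofrac (c i) *: e i].

Definition lattice (L : set V) : Prop :=
  exists2 e : seq V, L = Ospan [set` e] & <<e>>%VS = fullv.

Definition lattice_norm (L : set V) : set F := Ospan (W := F^o) (Q @` L).

Definition scaled_norm (m : nat) (L : set V) : set F :=
  [set p%:R ^+ m * x | x in lattice_norm L].

Definition maximal_lattice (L : set V) : Prop :=
  lattice L /\
  forall M, lattice M -> L `<=` M -> lattice_norm M = lattice_norm L -> M = L.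

Section WittDecomposition.
Variables (L : set V) (v v' : 'I_ell -> V).

Definition witt_complement : set V :=
  [set w | forall j, beta w (v j) = 0 /\ beta w (v' j) = 0].

Definition witt_L0 : set V :=
  [set w | witt_complement w /\ lattice_norm L (Q w)].

Definition witt_L0p1 : set V :=
  [set w | witt_complement w /\ scaled_norm 1 L (Q w)].

Definition witt_decomposition : Prop :=
  [/\ forall i j, beta (v i) (v j) = 0 /\ beta (v' i) (v' j) = 0,
      forall i j, beta (v i) (v' j) = (i == j)%:R,
      forall w, witt_complement w -> Q w = 0 -> w = 0 &
      L = [set x | exists (a b : 'I_ell -> F) (w : V),
             [/\ forall j, padic_integers (a j), forall j, lattice_norm L (b j),
                 witt_L0 w & x = \sum_j (a j *: v j + b j *: v' j) + w]]].

End WittDecomposition.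

(* M / N is an F_p-vector space of dimension d: some e_1, ..., e_d in M induce
   an F_p-basis of M / N, F_p acting through representatives in {0, .., p - 1}. *)
Definition Fp_quotient_dim (M N : set V) (d : nat) : Prop :=
  exists e : 'I_d -> V, (forall i, M (e i)) /\
    forall x, M x ->
      exists! c : {ffun 'I_d -> 'I_p}, N (x - \sum_i (c i : nat)%:R *: e i).

(* The invariant written \partial in the literature: the common value of
   dim L_0 / L_0^[+1] over all Witt decompositions of L. *)
Definition witt_partial (L : set V) : nat :=
  xget 0%N [set d | exists v v', witt_decomposition L v v' /\
                     Fp_quotient_dim (witt_L0 L v v') (witt_L0p1 L v v') d].

Definition maximal_sublattices (L : set V) : set (set V) :=
  [set M | maximal_lattice M /\ M `<=` L].

Definition maximal_sublattices_norm (L : set V) (m : nat) : set (set V) :=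
  [set M | maximal_sublattices L M /\ lattice_norm M = scaled_norm m L].

Definition lattice_index (L M : set V) : nat :=
  ncard [set [set x + y | y in M] | x in L].

End Lattices.

(** * Formal power series, as sequences of coefficients *)

Section FormalSeries.
Variable K : fieldType.
Implicit Types a b : nat -> K.

Definition fps_poly (q : {poly K}) : nat -> K := fun n => q`_n.

Definition fps_mul a b : nat -> K :=
  fun n => \sum_(i < n.+1) a i * b (n - i)%N.

(* Coefficients of degree at most n of the inverse of a, when a 0 != 0. *)
Fixpoint fps_inv_seq a (n : nat) : seq K :=
  if n is m.+1 then
    let s := fps_inv_seq a m in
    rcons s (- (a 0%N)^-1 * \sum_(i < m.+1) a (m.+1 - i)%N * s`_i)
  else [:: (a 0%N)^-1].

Definition fps_inv a : nat -> K := fun n => (fps_inv_seq a n)`_n.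

(* a(T^2) *)
Definition fps_compX2 a : nat -> K := fun n => if odd n then 0 else a n./2.

Definition fps_prod (m : nat) (a_ : 'I_m -> nat -> K) : nat -> K :=
  \big[fps_mul/fps_poly 1]_(r < m) a_ r.

End FormalSeries.

Section Zeta.
Variables (p : nat) (p_pr : prime p) (V : vectType (padic p_pr)).
Variables (beta : {symmetric V}) (L : set V) (K : fieldType).

Definition zeta0 : nat -> K :=
  fun m => (ncard (maximal_sublattices_norm beta L m.*2))%:R.

Definition zeta1 : nat -> K :=
  fun m => (ncard (maximal_sublattices_norm beta L m.*2.+1))%:R.

End Zeta.

(** * The polynomials W *)

(* Subsets of [0, l - 1] are encoded as {set 'I_l}. The exponents of X are half
   integers: everything is expressed through a square root h of X, and
   hpow h r stands for X^r, where r : rat is a half integer. Polynomials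
   in T are elements of {poly K}. *)
Section WPolynomials.
Variables (K : fieldType) (l : nat).
Implicit Types (q X u h : K) (I J : {set 'I_l}).

Definition hpow h (r : rat) : K := h ^ numq (2%:R * r).

Definition phi (i : nat) q : K := \prod_(1 <= j < i.+1) (q ^+ j - 1).

Definition elements J : seq nat := [seq val i | i <- enum J].

Definition phi_set I q : K :=
  phi l q /
    \prod_(d <- pairmap (fun i j => j - i)%N 0%N (rcons (elements I) l)) phi d q.

Definition wpoly (H : {set 'I_l}) q : K :=
  \sum_(I : {set 'I_l} | I \subset H) (-1) ^+ #|H :\: I| * phi_set I q.

Definition aexp J : nat := (\sum_(i in J) ((l * l.+1)./2 - (i * i.+1)./2))%N.
Definition bexp J : nat := (\sum_(i in J) (l.-1 - i))%N.

Definition bracket J : int :=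
  \sum_(nu < #|J|) (-1) ^+ nu.+1 * ((nth 0%N (elements J) nu)%:Z - l%:Z).

Definition posI : {set 'I_l} := [set i : 'I_l | (0 < i)%N]%SET.

Definition Upoly J X u : {poly K} :=
  (u ^+ bexp J * X ^+ aexp J) *:
    \sum_(I0 : {set 'I_l} | I0 \subset J :&: posI)
    \sum_(I1 : {set 'I_l} | I1 \subset posI :\: J)
      wpoly (I0 :|: I1) X^-1 *:
        ((X ^+ aexp I1 * u ^+ bexp I1) *: 'X^#|I1|) ^+ 2.

Definition Uparity (b : bool) (B : rat) h u : {poly K} :=
  \sum_(J : {set 'I_l} | odd #|J| == b)
    hpow h (B * (bracket J)%:~R) *: Upoly J (h ^+ 2) u * 'X^#|J|.

Definition Ueven := Uparity false.
Definition Uodd := Uparity true.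

Definition W0 (A B : rat) h : {poly K} :=
  let u := hpow h A in
  (Ueven B h u \Po (u *: 'X)) + (Uodd B h u \Po (u *: 'X)) * 'X.

Definition W1 (A B : rat) h : {poly K} :=
  let u := hpow h A in
  (Ueven (- B) h u \Po (u *: 'X)) * 'X + (Uodd (- B) h u \Po (u *: 'X)).

Definition Wtotal (A B : rat) h (Y : K) : K :=
  let n := numq (2%:R * (l%:R + A + 1)) in
  (W0 A B h).[Y ^ n] + (W1 A B h).[Y ^ n] * Y ^ numq (- 2%:R * B).

(* 2 (A + l - (r - 1) / 2) r *)
Definition cexp (A : rat) (r : nat) : rat :=
  2%:R * (A + l%:R - (r%:R - 1) / 2%:R) * r%:R.

End WPolynomials.

(* a^s for a > 0 *)
Definition cpow (R : realType) (a : R) (s : R[i]) : R[i] :=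
  let t := complex.Im s * ln a in
  ((a `^ complex.Re s)%:C * (cos t +i* sin t))%C.

(* Main.v *)
(* Fix a Witt decomposition of L with isotropic basis v_1, ..., v_l, and let
   p^k O be the norm of L. A maximal sublattice M of norm p^(k+m) O meets the
   span of the v_i in a lattice of some elementary divisor type
   a_1 <= ... <= a_l <= m. The lattices of type a in O^l are counted in
   GL_l(Z/p^(m+1)); those M with a given intersection are parametrized by the
   hyperbolic partners of its basis, and their number is a product of indices
   of the layers {w in W | Q w in p^j O} of the anisotropic kernel W and of
   powers p^(a_j). With d_i = a_i - a_(i-1), the number of M of norm p^(k+m) O
   becomes a sum over d_0 + ... + d_l = m of
     prod_i x_i^(d_i) * X^(+-B<J>) * varphi_(I)(1/p),
   where J = {i | d_i odd}, I = {i > 0 | d_i > 0} and the x_i^2 are the numbers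
   p^(2 (A + l - (r-1)/2) r). Expanding varphi_(I) as the sum of the w_K, K in
   I, turns this into the coefficient of T^m in the asserted rational function.
   The index of M in L only depends on m, so the Dirichlet series is the even
   power series plus p^(sB) times the odd one, evaluated at p^(-ns/2). *)

Require Import Defs.
From HB Require Import structures.
From mathcomp Require Import all_boot all_order fingroup perm all_algebra.
From mathcomp Require Import finmap fraction sesquilinear complex.
From mathcomp Require Import all_classical all_reals.
From mathcomp Require Import topology normedtype sequences exp trigo summability.
From mathcomp Require Import ring lra zify.

Set Implicit Arguments.
Unset Strict Implicit.
Unset Printing Implicit Defensive.

Import Order.TTheory GRing.Theory Num.Theory.
Import numFieldNormedType.Exports.

Local Open Scope classical_set_scope.
Local Open Scope ring_scope.

(** * Z_p and its fractional ideals *)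

(** The prime 2 is allowed, and this shapes the arguments: Q cannot be traded for beta / 2 over O.
    Integrality of beta on the anisotropic kernel W rests on Hensel's lemma, and wherever isotropy
    is imposed, the diagonal coefficient is read from Q while the others are charged to one side of
    the diagonal. W being anisotropic, the vectors w of W with Q w in p^j O form a lattice, so a
    maximal lattice is described by a hyperbolic system alone, and only the choice of the system has
    to be counted. B comes from the layers. Multiplication by p carries a layer two steps down with
    index p^n0, so the one-step exponents alternate between d and n0 - d, where d is the invariant
    \partial. A run of a steps has exponent n0 a / 2 when a is even, and is off by B or -B when a is
    odd. The sign depends on the first layer of the run, hence on the parity of m: this is why W^(0)
    contains B and W^(1) contains -B. The number of odd a_i is <J>. *)

Section PadicIntegers.
Variables (p : nat) (p_pr : prime p).
Local Notation O := (padic_int p_pr).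
Local Notation pn n := ((p ^ n)%N%:Z).

Lemma padicD (x y : O) n : (x + y) n = ((x n + y n) %% pn n)%Z. Proof. by []. Qed.
Lemma padicN (x : O) n : (- x) n = ((- x n) %% pn n)%Z. Proof. by []. Qed.
Lemma padicM (x y : O) n : (x * y) n = ((x n * y n) %% pn n)%Z. Proof. by []. Qed.
Lemma padic0 n : (0 : O) n = 0. Proof. exact: (mod0z (pn n)). Qed.
Lemma padic1 n : (1 : O) n = (1 %% pn n)%Z. Proof. by []. Qed.

Lemma padic_nat (k n : nat) : (k%:R : O) n = (k%:Z %% pn n)%Z.
Proof.
elim: k => [|k IHk]; first by rewrite mod0z; apply: mod0z.
by rewrite -natr1 padicD IHk padic1 modzDm -addn1 PoszD.
Qed.

Lemma padic_natX (k n : nat) : (p%:R ^+ k : O) n = (pn k %% pn n)%Z.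
Proof. by rewrite -natrX padic_nat. Qed.

Lemma padic_le (x : O) m n : (m <= n)%N -> (x n = x m %[mod pn m])%Z.
Proof.
move=> /subnKC <-; elim: (n - m)%N => [|d IHd]; first by rewrite addn0.
rewrite addnS -IHd; have := padic_seqS x (m + d).
move=> /eqP; rewrite eqz_mod_dvd => xd; apply/eqP; rewrite eqz_mod_dvd.
by apply: dvdz_trans xd; rewrite dvdzE /= dvdn_exp2l ?leq_addr.
Qed.

(** Dividing by p^k costs k digits of precision: the n-th residue of the quotient is read from
    [x (n + k)]. *)
Fact padic_div_subproof (x : O) k : (pn k %| x k)%Z ->
  forall n, ((x (n.+1 + k)%N %/ pn k)%Z = (x (n + k)%N %/ pn k)%Z %[mod pn n])%Z.
Proof.
move=> xk n; have dk i : (pn k %| x (i + k)%N)%Z by rewrite padic_dvd ?leq_addl.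
have k0 : pn k != 0 by rewrite eqz_nat expn_eq0 -leqn0 leqNgt prime_gt0.
apply/eqP; rewrite eqz_mod_dvd -(dvdz_mul2r (p := pn k)) // mulrBl !divzK //.
have := padic_seqS x (n + k); rewrite -addSn => /eqP; rewrite eqz_mod_dvd.
by rewrite expnD PoszM.
Qed.

Lemma padic_dvdP (x : O) k : (pn k %| x k)%Z <-> exists y : O, x = p%:R ^+ k * y.
Proof.
split=> [xk|[y ->]]; last first.
  by rewrite padicM padic_natX modzMml; apply/dvdz_mod0P; rewrite modz_mod modzMr.
exists (@padic_of_seq p p_pr _ (padic_div_subproof xk)); apply: padic_int_eq => n.
rewrite padicM padic_natX /= modzMml modzMmr.
rewrite mulrC divzK ?padic_dvd ?leq_addl //.
by rewrite (padic_le x (leq_addr k n)) padic_mod.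
Qed.

Definition pdvd (k : nat) (x : O) : Prop := exists y : O, x = p%:R ^+ k * y.

Lemma pdvd_eq0 (x : O) : (forall k, pdvd k x) -> x = 0.
Proof. by move=> xk; apply: padic_eq0 => k; apply/padic_dvdP; apply: xk. Qed.

Lemma pdvd0 k : pdvd k 0. Proof. by exists 0; rewrite mulr0. Qed.
Lemma pdvd0n x : pdvd 0 x. Proof. by exists x; rewrite mul1r. Qed.
Lemma pdvdD k x y : pdvd k x -> pdvd k y -> pdvd k (x + y).
Proof. by move=> [x' ->] [y' ->]; exists (x' + y'); rewrite mulrDr. Qed.
Lemma pdvdN k x : pdvd k x -> pdvd k (- x).
Proof. by move=> [x' ->]; exists (- x'); rewrite mulrN. Qed.
Lemma pdvdB k x y : pdvd k x -> pdvd k y -> pdvd k (x - y).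
Proof. by move=> xk yk; apply: pdvdD => //; apply: pdvdN. Qed.
Lemma pdvdMl k x y : pdvd k x -> pdvd k (x * y).
Proof. by move=> [x' ->]; exists (x' * y); rewrite mulrA. Qed.
Lemma pdvdMr k x y : pdvd k y -> pdvd k (x * y).
Proof. by rewrite mulrC; apply: pdvdMl. Qed.
Lemma pdvdM i j x y : pdvd i x -> pdvd j y -> pdvd (i + j) (x * y).
Proof. by move=> [x' ->] [y' ->]; exists (x' * y'); rewrite exprD mulrACA. Qed.
Lemma pdvdW i j x : (i <= j)%N -> pdvd j x -> pdvd i x.
Proof.
by move=> /subnKC <- [y ->]; exists (p%:R ^+ (j - i) * y); rewrite exprD mulrA.
Qed.
Lemma pdvd_sum k (I : finType) (P : pred I) (f : I -> O) :
  (forall i, P i -> pdvd k (f i)) -> pdvd k (\sum_(i | P i) f i).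
Proof. by move=> fk; elim/big_ind: _ => //; [apply: pdvd0|apply: pdvdD]. Qed.

Lemma padic_natn0 n : (0 < n)%N -> (n%:R : O) != 0.
Proof.
move=> n0; apply/eqP => /(congr1 (fun x : O => x n)); rewrite padic_nat.
rewrite padic0 modz_small; last by rewrite ltz_nat ltn_expl ?prime_gt1.
by move=> n0'; lia.
Qed.

Lemma padic_p_neq0 : (p%:R : O) != 0.
Proof. exact/padic_natn0/prime_gt0. Qed.

Lemma pdvd_pMl i j x : pdvd (i + j) (p%:R ^+ i * x) <-> pdvd j x.
Proof.
split=> [[y]|[y ->]]; last by exists y; rewrite exprD mulrA.
rewrite exprD -mulrA => /mulfI-> //; first by exists y.
by rewrite expf_neq0 ?padic_p_neq0.
Qed.

(** Completeness of Z_p. The diagonal [s n n] is coherent because [s n.+1] and [s n] agree modulo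
    p^n. *)
Lemma pdvd_limit (s : nat -> O) : (forall n, pdvd n (s n.+1 - s n)) ->
  exists x : O, forall n, pdvd n (x - s n).
Proof.
move=> sP; pose u n := s n n.
have uP n : (u n.+1 = u n %[mod pn n])%Z.
  rewrite /u padic_seqS; have /padic_dvdP := sP n.
  rewrite padicD padicN modzDmr => /dvdz_mod0P; rewrite modz_mod => /dvdz_mod0P.
  by rewrite -eqz_mod_dvd => /eqP.
exists (@padic_of_seq p p_pr u uP) => n; apply/padic_dvdP.
rewrite padicD padicN /= modzDmr modzDml /u subrr mod0z; exact: dvdz0.
Qed.

(** The map s -> 1 + eps s^2 is a contraction since p divides eps. With the equation in this form
    nothing is divided by 2, and p = 2 is covered. *)
Lemma hensel_quadratic (eps : O) : pdvd 1 eps ->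
  exists s : O, eps * s ^+ 2 - s + 1 = 0.
Proof.
move=> eps1; pose s n := iter n (fun s => 1 + eps * s ^+ 2) (1 : O).
have sS n : s n.+1 = 1 + eps * s n ^+ 2 by [].
have key (a b : O) :
    1 + eps * a ^+ 2 - (1 + eps * b ^+ 2) = eps * ((a - b) * (a + b)) by ring.
have sP n : pdvd n (s n.+1 - s n).
  elim: n => [|n IHn]; first exact: pdvd0n.
  rewrite (_ : _ - _ = eps * ((s n.+1 - s n) * (s n.+1 + s n))).
    by rewrite -(add1n n); apply: pdvdM => //; apply: pdvdMl.
  exact: key.
have [x xP] := pdvd_limit sP; exists x; apply: pdvd_eq0 => n.
rewrite (_ : _ + _ = eps * ((x - s n) * (x + s n)) - (x - s n) + (s n.+1 - s n)).
  by apply: pdvdD => //; apply: pdvdB => //; apply/pdvdMr/pdvdMl.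
by rewrite sS; ring.
Qed.

Lemma padic_unitP (x : O) : x \is a GRing.unit <-> ~ pdvd 1 x.
Proof.
split=> [xu [y xy]|x1].
  have : pdvd 1 (1 : O) by rewrite -(divrr xu) xy; apply: pdvdMl; apply: pdvdMl; exists 1; rewrite mulr1.
  move/padic_dvdP; rewrite padic1 expn1.
  move=> /dvdz_mod0P; rewrite modz_mod modz_small ?ltz_nat ?prime_gt1 //.
have cop n : coprimez (x n) (pn n).
  rewrite coprimezE /= ; case: n => [|n]; first by rewrite expn0 coprimen1.
  rewrite coprimeXr // coprime_sym prime_coprime //.
  apply/negP => /= px; apply: x1; apply/padic_dvdP.
  by rewrite -(padic_dvd x (ltn0Sn n)) dvdzE expn1.
pose y n : int := (egcdz (x n) (pn n)).1.
have yP n : (y n * x n = 1 %[mod pn n])%Z.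
  rewrite /y; case: egcdzP => a b /= E _; move: E.
  move/eqP: (cop n) => -> /= E; rewrite -E.
  by rewrite -modzDmr modzMl addr0.
(* Both y n.+1 and y n invert x n modulo p^n; uniqueness of inverses makes the Bezout coefficients
   coherent. *)
have yS n : (y n.+1 = y n %[mod pn n])%Z.
  have h1 : (y n.+1 * x n = 1 %[mod pn n])%Z.
    have := yP n.+1 => /eqP; rewrite eqz_mod_dvd => h.
    have {}h : (y n.+1 * x n.+1 = 1 %[mod pn n])%Z.
      apply/eqP; rewrite eqz_mod_dvd; apply: dvdz_trans h.
      by rewrite dvdzE /= dvdn_exp2l.
    by rewrite -h -[RHS]modzMmr padic_seqS modzMmr.
  rewrite -[y n.+1]mulr1 -[LHS]modzMmr -(yP n) modzMmr mulrCA.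
  by rewrite -[LHS]modzMmr h1 modzMmr mulr1.
apply/asboolP; exists (@padic_of_seq p p_pr y yS); apply: padic_int_eq => n.
by rewrite padicM [padic_of_seq _ _ _]/= modzMml yP.
Qed.

Lemma padic_factor (x : O) : x != 0 ->
  exists k (u : O), u \is a GRing.unit /\ x = p%:R ^+ k * u.
Proof.
move=> x0; have ex : exists k, ~~ `[< pdvd k x >].
  apply: contrapT => h; move/eqP: x0; apply; apply: pdvd_eq0 => k.
  by apply: contrapT => hk; apply: h; exists k; apply/asboolPn.
have [k /asboolPn kx kmin] := ex_minnP ex.
case: k kx kmin => [|k] kx kmin; first by case: kx; apply: pdvd0n.
have [y xy] : pdvd k x.
  by apply: contrapT => /asboolPn /kmin; rewrite ltnn.
exists k, y; split=> //; apply/padic_unitP => y1; apply: kx.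
by rewrite xy -addn1; apply/pdvd_pMl.
Qed.

End PadicIntegers.

Section PadicNumbers.
Variables (p : nat) (p_pr : prime p).
Local Notation O := (padic_int p_pr).
Local Notation F := (padic p_pr).
Local Notation pi := (p%:R : F).

Lemma tofrac_nat n : tofrac (n%:R : O) = n%:R :> F.
Proof. exact: rmorph_nat. Qed.

Lemma padic_natf_neq0 n : (0 < n)%N -> (n%:R : F) != 0.
Proof. by move=> n0; rewrite -tofrac_nat tofrac_eq0 padic_natn0. Qed.

Lemma padic_two_neq0 : (2%:R : F) != 0. Proof. exact: padic_natf_neq0. Qed.

Lemma padic_pf_neq0 : pi != 0. Proof. exact/padic_natf_neq0/prime_gt0. Qed.
Hint Resolve padic_pf_neq0 : core.

Lemma expz_p_neq0 (z : int) : pi ^ z != 0.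
Proof. by rewrite expfz_neq0. Qed.

Lemma expz_pD (i j : int) : pi ^ (i + j) = pi ^ i * pi ^ j.
Proof. exact: expfzDr. Qed.

(** The fractional ideal p^z O. Valuations mostly enter as membership in it, so that 0 needs no
    valuation and exponents are shifted by [pideal_scale]. *)
Definition pideal (z : int) : set F := [set x | exists u : O, x = pi ^ z * tofrac u].

Lemma pideal0 z : pideal z 0. Proof. by exists 0; rewrite tofrac0 mulr0. Qed.
Lemma pidealD z x y : pideal z x -> pideal z y -> pideal z (x + y).
Proof. by move=> [u ->] [v ->]; exists (u + v); rewrite tofracD mulrDr. Qed.
Lemma pidealN z x : pideal z x -> pideal z (- x).
Proof. by move=> [u ->]; exists (- u); rewrite tofracN mulrN. Qed.
Lemma pidealB z x y : pideal z x -> pideal z y -> pideal z (x - y).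
Proof. by move=> xz yz; apply: pidealD => //; apply: pidealN. Qed.
Lemma pideal_sum z (I : finType) (P : pred I) (f : I -> F) :
  (forall i, P i -> pideal z (f i)) -> pideal z (\sum_(i | P i) f i).
Proof. by move=> fz; elim/big_ind: _ => //; [apply: pideal0|apply: pidealD]. Qed.
Lemma pidealM i j x y : pideal i x -> pideal j y -> pideal (i + j) (x * y).
Proof.
by move=> [u ->] [v ->]; exists (u * v); rewrite tofracM expfzDr // mulrACA.
Qed.
Lemma pideal_frac (u : O) : pideal 0 (tofrac u).
Proof. by exists u; rewrite mul1r. Qed.
Lemma pideal0P x : pideal 0 x <-> exists u : O, x = tofrac u.
Proof. by split=> [[u ->]|[u ->]]; [exists u; rewrite mul1r|apply: pideal_frac]. Qed.
Lemma pidealMl z x y : pideal 0 x -> pideal z y -> pideal z (x * y).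
Proof. by move=> x0 yz; rewrite -[z]add0r; apply: pidealM. Qed.
Lemma pideal_expz z : pideal z (pi ^ z).
Proof. by exists 1; rewrite tofrac1 mulr1. Qed.

Lemma pideal_scale i j x : pideal (i + j) (pi ^ i * x) <-> pideal j x.
Proof.
split=> [|xj]; last by apply: pidealM => //; apply: pideal_expz.
move=> [u]; rewrite expfzDr // -mulrA => /mulfI -> //; first by exists u.
exact: expz_p_neq0.
Qed.

Lemma pidealW i j x : i <= j -> pideal j x -> pideal i x.
Proof.
rewrite -subr_ge0 => ij [u ->]; exists (p%:R ^+ `|j - i|%N * u).
rewrite tofracM tofracXn tofrac_nat mulrA; congr (_ * _).
by rewrite exprnP gez0_abs // -expfzDr // subrKC.
Qed.

Lemma pideal_dvd k (x : O) : pideal k%:Z (tofrac x) <-> pdvd k x.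
Proof.
split=> [[u]|[y ->]]; last by exists y; rewrite tofracM tofracXn tofrac_nat.
rewrite -exprnP -tofrac_nat -tofracXn -tofracM => /eqP; rewrite tofrac_eq => /eqP ->.
by exists u.
Qed.

Lemma padic_fracP (x : F) : exists a b : O, b != 0 /\ x = tofrac a / tofrac b.
Proof.
have ex : exists a b : O, b != 0 /\ x * tofrac b = tofrac a.
  elim/quotW: x => r; exists \n_r, \d_r; split; first exact: denom_ratioP.
  rewrite /tofrac; unlock FracField.tofrac; rewrite -[LHS]FracField.pi_mul.
  apply/eqmodP; rewrite /= FracField.equivfE /FracField.mulf.
  by rewrite !numden_Ratio ?(oner_eq0, mulf_neq0, denom_ratioP) // !mulr1 mulrC.
have [a [b [b0 xb]]] := ex; exists a, b; split=> //.
by rewrite -xb mulfK // tofrac_eq0.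
Qed.

Lemma padic_ord_ex (x : F) : x != 0 -> exists z, padic_ord x z.
Proof.
move=> x0; have [a [b [b0 xE]]] := padic_fracP x.
have a0 : a != 0 by apply: contraNneq x0 => a0; rewrite xE a0 tofrac0 mul0r.
have [i [u [uu aE]]] := padic_factor a0; have [j [v [vu bE]]] := padic_factor b0.
exists (i%:Z - j%:Z), (u / v); first by rewrite unitrM uu unitrV.
rewrite xE aE bE !tofracM !tofracXn !tofrac_nat expfzDr // -exprnP.
rewrite -invr_expz -exprnP invfM mulrACA; congr (_ * (_ * _)).
by symmetry; apply: rmorphV.
Qed.

Lemma pideal_ex (x : F) : exists z, pideal z x.
Proof.
have [->|/padic_ord_ex [z [u _ ->]]] := eqVneq x 0; first by exists 0; apply: pideal0.
by exists z, u.
Qed.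

Lemma pideal_ord x z i : padic_ord x z -> pideal i x <-> i <= z.
Proof.
move=> [u uu ->]; split=> [|iz]; last by apply: (pidealW iz); exists u.
rewrite leNgt => xi; apply/negP => zi; move/padic_unitP: uu; apply.
apply/pideal_dvd/(pideal_scale z); apply: pidealW xi.
by rewrite lezD1.
Qed.

Lemma pideal_expzE i z : pideal i (pi ^ z) <-> i <= z.
Proof. by apply: pideal_ord; exists 1; rewrite ?unitr1 // tofrac1 mulr1. Qed.

Lemma padic_ord_dvd x z y : padic_ord x z -> pideal z y -> pideal 0 (y / x).
Proof.
move=> [u uu ->] [v ->]; exists (v / u); rewrite mul1r invfM mulrACA.
rewrite divff ?expz_p_neq0 // mul1r; apply: (canLR (mulfK _)).
  by rewrite tofrac_eq0; apply: contraTneq uu => ->; rewrite unitr0.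
by rewrite -tofracM mulrVK.
Qed.

Lemma pideal_eq0 (x : F) : (forall n : nat, pideal n x) -> x = 0.
Proof.
move=> xn; apply/eqP; apply: contraT => /padic_ord_ex [z xz].
have := xn (`|z|.+1)%N => /(pideal_ord _ xz); lia.
Qed.

End PadicNumbers.
#[global] Hint Resolve padic_pf_neq0 expz_p_neq0 padic_two_neq0 : core.

(** * Indices of subgroups *)

Section FiniteCardinal.

(** Finiteness is carried along with every count, as [ncard] is 0 on infinite sets. *)
Lemma ncard_inj (T : finType) (U : choiceType) (f : T -> U) (A : set U) :
  injective f -> A = range f -> finite_set A /\ ncard A = #|T|.
Proof.
move=> finj AE; have AF : A = [set` [fset f t | t in T]%fset].
  rewrite AE; apply/seteqP; split=> x /=.
    by move=> [t _ <-]; apply/imfsetP; exists t.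
  by move=> /imfsetP[t _ ->]; exists t.
split; first by rewrite AF; apply: finite_fset.
by rewrite /ncard AF set_fsetK card_imfset //= -cardE.
Qed.

Lemma ncard_fibers (U : choiceType) (T : finType) (f : U -> T) (A : set U)
    (n : T -> nat) :
    (forall t, finite_set (A `&` [set x | f x = t]) /\
               ncard (A `&` [set x | f x = t]) = n t) ->
  finite_set A /\ ncard A = (\sum_t n t)%N.
Proof.
move=> fib; have Afin : finite_set A.
  have -> : A = \bigcup_(t in [set: T]) (A `&` [set x | f x = t]).
    by apply/seteqP; split=> [x Ax|x [t _ []]//]; exists (f x).
  by apply: bigcup_finite => [|t _]; [apply: finite_finset|case: (fib t)].
split=> //; rewrite /ncard -sum1_size /=.
transitivity (\sum_(t : T) \sum_(x <- fset_set A | f x == t) 1)%N.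
  by rewrite (partition_big f xpredT).
apply: eq_bigr => t _; case: (fib t) => _ <-; rewrite /ncard.
rewrite -big_filter sum1_size; apply: perm_size; apply: uniq_perm.
- by rewrite filter_uniq ?fset_uniq.
- exact: fset_uniq.
move=> x; rewrite mem_filter in_fset_set ?inE.
  rewrite in_fset_set; last by case: (fib t).
  apply/andP/idP => [[/eqP fx]|]; first by rewrite !inE.
  by rewrite !inE => -[Ax /= /eqP].
by [].
Qed.

End FiniteCardinal.

Section Index.

Definition subgroup (G : zmodType) (A : set G) : Prop :=
  A 0 /\ forall x y, A x -> A y -> A (x - y).

(** The index is given by a transversal and not by a number of cosets: the representatives later
    serve as parameters of the counted lattices. *)
Definition has_index (G : zmodType) (A B : set G) (n : nat) : Prop :=
  exists r : 'I_n -> G, (forall i, A (r i)) /\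
    forall x, A x -> exists! i, B (x - r i).

Implicit Types G H : zmodType.

Lemma subgroupN G (A : set G) x : subgroup A -> A x -> A (- x).
Proof. by move=> [A0 AB] Ax; rewrite -[- x]add0r; apply: AB. Qed.
Lemma subgroupB G (A : set G) x y : subgroup A -> A x -> A y -> A (x - y).
Proof. by move=> [_]; apply. Qed.
Lemma subgroupD G (A : set G) x y : subgroup A -> A x -> A y -> A (x + y).
Proof. by move=> sA Ax Ay; rewrite -[y]opprK; apply: subgroupB => //; apply: subgroupN. Qed.

Lemma has_index_fin G (A B : set G) (T : finType) (r : T -> G) :
  (forall t, A (r t)) -> (forall x, A x -> exists! t, B (x - r t)) ->
  has_index A B #|T|.
Proof.
move=> Ar rP; exists (r \o enum_val); split=> [i|x Ax]; first exact: Ar.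
have [t [tx tU]] := rP x Ax; exists (enum_rank t); split=> [|i].
  by rewrite /= enum_rankK.
by move=> /tU ->; rewrite enum_valK.
Qed.

Lemma has_index_inj G (A B : set G) n n' :
  subgroup B -> has_index A B n -> has_index A B n' -> (n <= n')%N.
Proof.
move=> sB [r [Ar rP]] [r' [_ rP']].
have /(_ _)/cid f i := rP' _ (Ar i).
pose g i := projT1 (cid (rP' _ (Ar i))).
have gP i : B (r i - r' (g i)) by rewrite /g; case: cid => j [].
have ginj : injective g.
  move=> i j gij; have [k [_ kU]] := rP _ (Ar i).
  rewrite -(kU i) ?subrr; last by case: sB.
  apply: kU; rewrite (_ : _ - _ = (r i - r' (g i)) - (r j - r' (g j))).
    by apply: subgroupB.
  by rewrite gij opprB addrA subrK.
by have := leq_card g ginj; rewrite !card_ord.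
Qed.

Lemma has_index_uniq G (A B : set G) n n' :
  subgroup B -> has_index A B n -> has_index A B n' -> n = n'.
Proof.
move=> sB An An'; apply/eqP; rewrite eqn_leq.
by rewrite (has_index_inj sB An An') (has_index_inj sB An' An).
Qed.

Lemma has_index_trans G (A B C : set G) n m :
  subgroup A -> subgroup B -> subgroup C -> B `<=` A -> C `<=` B ->
  has_index A B n -> has_index B C m -> has_index A C (n * m).
Proof.
move=> sA sB sC BA CB [r [Ar rP]] [q [Bq qP]].
rewrite -[n]card_ord -[m]card_ord -card_prod.
apply: (has_index_fin (r := fun t => r t.1 + q t.2)) => [t|x Ax].
  by apply: subgroupD => //; apply: BA.
have [i [ix iU]] := rP x Ax; have [j [jx jU]] := qP _ ix.
exists (i, j); split=> [|[i' j'] /= h]; first by rewrite /= opprD addrA.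
have h' : B (x - r i').
  rewrite (_ : x - r i' = (x - (r i' + q j')) + q j').
    by apply: subgroupD => //; apply: CB.
  by rewrite opprD addrA subrK.
have ii' := iU _ h'; rewrite -{}ii' in h *; congr (_, _).
by apply: jU; rewrite -addrA -opprD.
Qed.

(** Supplies only the existence of the index; its value is then forced by multiplicativity. *)
Lemma has_index_sub G (A B C : set G) n :
  subgroup B -> B `<=` A -> C `<=` B ->
  has_index A C n -> exists m, has_index B C m.
Proof.
move=> sB BA CB [r [Ar rP]]; pose T := {i : 'I_n | `[< B (r i) >]}.
exists #|{: T}|; apply: (has_index_fin (r := fun t : T => r (val t))) => [t|x Bx].
  by have /asboolP := valP t.
have [i [ix iU]] := rP x (BA _ Bx).
have Bri : `[< B (r i) >].
  apply/asboolP; rewrite -(subKr x (r i)).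
  by apply: subgroupB => //; apply: CB.
exists (exist _ i Bri); split=> // j /iU ij; exact: val_inj.
Qed.

Lemma has_index_ffun G (I : finType) (A B : I -> set G) (n : I -> nat) :
  (forall i, has_index (A i) (B i) (n i)) ->
  has_index [set f : {ffun I -> G} | forall i, A i (f i)]
            [set f | forall i, B i (f i)] (\prod_i n i).
Proof.
move=> AB; pose r i := projT1 (cid (AB i)).
have rP i : (forall j, A i (r i j)) /\ forall x, A i x -> exists! j, B i (x - r i j).
  by rewrite /r; case: cid.
have <- : #|{dffun forall i : I, 'I_(n i)}| = (\prod_i n i)%N.
  by rewrite card_dep_ffun foldrE big_map big_enum; apply: eq_bigr => i _; rewrite card_ord.
apply: (has_index_fin (r := fun t : {dffun forall i : I, 'I_(n i)} =>
   [ffun i => r i (t i)])) => [t i|f fA]; first by rewrite ffunE; case: (rP i).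
have ex i := (rP i).2 _ (fA i).
exists [ffun i => projT1 (cid (ex i))]; split=> [i|t tP].
  by rewrite !ffunE; case: cid => j [].
apply/ffunP => i; rewrite ffunE; case: cid => j [_ jU] /=.
by apply: jU; have := tP i; rewrite !ffunE.
Qed.

Lemma has_index_exact G H (f : G -> H) (A B : set G) n m :
  {morph f : x y / x - y} -> subgroup A -> subgroup B -> B `<=` A ->
  has_index (f @` A) (f @` B) n ->
  has_index [set x | A x /\ f x = 0] [set x | B x /\ f x = 0] m ->
  has_index A B (n * m).
Proof.
move=> fB sA sB BA [r [Ar rP]] [q [Kq qP]].
have fD x y : f (x + y) = f x + f y by rewrite -{2}(addrK y x) fB subrK.
pose r' i := projT1 (cid2 (Ar i)).
have r'P i : A (r' i) /\ f (r' i) = r i by rewrite /r'; case: cid2.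
rewrite -[n]card_ord -[m]card_ord -card_prod.
apply: (has_index_fin (r := fun t => r' t.1 + q t.2)) => [t|x Ax].
  by apply: subgroupD => //; [case: (r'P t.1)|case: (Kq t.2)].
have [i [[b Bb bE] iU]] := rP (f x) (imageP _ Ax).
have kx : A (x - r' i - b) /\ f (x - r' i - b) = 0.
  split; last by rewrite !fB (r'P i).2 bE subrr.
  by apply: (subgroupB sA); [apply: (subgroupB sA) => //; case: (r'P i)|apply: BA].
have [j [jx jU]] := qP _ kx; exists (i, j); split=> [|[i' j'] /= h].
  rewrite /= (_ : _ - _ = (x - r' i - b - q j) + b).
    by apply: subgroupD => //; case: jx.
  by rewrite opprD addrA [_ - b - q j]addrAC subrK.
have ii' : i = i'.
  apply: iU; exists (x - (r' i' + q j')) => //.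
  by rewrite fB fD (r'P i').2 (Kq j').2 addr0.
rewrite -{}ii' in h *; congr (_, _); apply: jU; split.
  rewrite (_ : _ - _ = (x - (r' i + q j')) - b); first by apply: subgroupB.
  by rewrite opprD addrA; apply: addrAC.
by rewrite fB kx.2 (Kq j').2 subrr.
Qed.

Lemma has_index_image G H (f : G -> H) (A B : set G) n :
  {morph f : x y / x - y} -> injective f -> has_index A B n -> has_index (f @` A) (f @` B) n.
Proof.
move=> fB finj [r [Ar rP]]; exists (f \o r); split=> [i|_ [x Ax <-]].
  by exists (r i).
have [i [ix iU]] := rP x Ax; exists i; split=> [|j [y By]].
  by exists (x - r i) => //; rewrite fB.
by rewrite -fB => /finj yE; apply: iU; rewrite -yE.
Qed.

Lemma ncard_cosets G (A B : set G) n : subgroup B -> has_index A B n ->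
  ncard [set [set x + y | y in B] | x in A] = n.
Proof.
move=> sB [r [Ar rP]]; rewrite -[RHS]card_ord.
have [] // := @ncard_inj _ _ (fun i => [set r i + y | y in B])
  [set [set x + y | y in B] | x in A] => [i j ij|].
  have [k [_ kU]] := rP _ (Ar i); rewrite -(kU i) ?subrr; last by case: sB.
  apply: kU; have : [set r i + y | y in B] (r i).
    by exists 0; rewrite ?addr0 //; case: sB.
  by rewrite ij => -[y By <-]; rewrite addrC addKr.
apply/seteqP; split=> [_ [x Ax <-]|_ [i _ <-]]; last by exists (r i).
have [i [ix _]] := rP x Ax; exists i => //; apply/seteqP; split=> [_ [y By <-]|_ [y By <-]].
  exists (y - (x - r i)); first by apply: subgroupB.
  by rewrite opprB addrCA subrKC addrC.
exists (y + (x - r i)); first exact: subgroupD.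
by rewrite addrCA subrKC addrC.
Qed.

End Index.

Section PadicIndex.
Variables (p : nat) (p_pr : prime p).
Local Notation pn n := ((p ^ n)%N%:Z).
Local Notation O := (padic_int p_pr).
Local Notation F := (padic p_pr).

Lemma padic_digit (u : O) c : exists! j : 'I_(p ^ c), pdvd c (u - (j : nat)%:R).
Proof.
have pc0 : (0 < p ^ c)%N by rewrite expn_gt0 prime_gt0.
have dP (k : nat) : pdvd c (u - k%:R) <-> (u c = k %[mod (p ^ c)%N%:Z])%Z.
  have -> : pdvd c (u - k%:R) <-> (pn c %| u c - k%:Z)%Z.
    rewrite -[X in _ <-> X]/(is_true (pn c %| u c - k%:Z)%Z) /pdvd -padic_dvdP.
    rewrite padicD padicN modzDmr padic_nat -modzDmr modzNm modzDmr.
    split=> /dvdz_mod0P; first by rewrite modz_mod => /dvdz_mod0P.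
    by move=> h; apply/dvdz_mod0P; rewrite modz_mod.
  by rewrite -eqz_mod_dvd; split=> /eqP.
have u0 : 0 <= u c by rewrite -padic_mod modz_ge0 // eqz_nat -lt0n.
have uc : (`|u c| < p ^ c)%N.
  by rewrite -ltz_nat gez0_abs // -padic_mod ltz_pmod.
exists (Ordinal uc); split=> [|j /dP]; first by apply/dP; rewrite /= gez0_abs.
rewrite padic_mod modz_small ?ltz_nat ?ltn_ord //.
by move=> uj; apply: val_inj; rewrite /= uj.
Qed.

Lemma has_index_pideal z c : has_index (@pideal p p_pr z) (pideal (z + c%:Z)) (p ^ c).
Proof.
exists (fun j => p%:R ^ z * (j : nat)%:R); split=> [j|_ [u ->]].
  by exists j%:R; rewrite tofrac_nat.
have [j [jP jU]] := padic_digit u c; have E (k : nat) :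
    p%:R ^ z * tofrac u - p%:R ^ z * k%:R = p%:R ^ z * tofrac (u - k%:R) :> F.
  by rewrite tofracB tofrac_nat mulrBr.
exists j; split=> [|k]; rewrite E; first by apply/pideal_scale/pideal_dvd.
by move/pideal_scale/pideal_dvd/jU.
Qed.

End PadicIndex.

(** * Elementary divisors over Z_p *)

Section Smith.
Variables (p : nat) (p_pr : prime p).
Local Notation O := (padic_int p_pr).

(** Once the unit entry is swapped to the front, y and the last d unit vectors form a triangular
    matrix with unit diagonal. *)
Lemma unit_row_complete d (y : 'rV[O]_(1 + d)) j : y 0 j \is a GRing.unit ->
  exists2 E : 'M[O]_(1 + d), E \in unitmx & row (lshift d 0) E = y.
Proof.
move=> yj; pose y' := xcol (lshift d 0) j y.
pose E1 : 'M[O]_(1 + d) := block_mx (lsubmx y') (rsubmx y') 0 1%:M.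
have E1u : E1 \in unitmx.
  rewrite unitmxE det_ublock det1 mulr1 det_mx11 !mxE.
  by rewrite tpermL.
exists (E1 *m tperm_mx (lshift d 0) j); first by rewrite unitmx_mul E1u unitmx_perm.
rewrite row_mul (_ : row _ E1 = y').
  by rewrite -xcolE; apply/rowP => k; rewrite !mxE tpermK.
rewrite -[RHS]hsubmxK /E1 block_mxEv rowKu.
by apply/rowP => i; rewrite mxE.
Qed.

Definition Osubmod d (M : set 'rV[O]_d) : Prop :=
  [/\ M 0, (forall x y, M x -> M y -> M (x + y)) & forall c x, M x -> M (c *: x)].

Lemma pdvd_mulmx d k (x : 'rV[O]_d) (E : 'M[O]_d) :
  (forall i, pdvd k (x 0 i)) -> forall i, pdvd k ((x *m E) 0 i).
Proof. by move=> xk i; rewrite mxE; apply: pdvd_sum => j _; apply: pdvdMl. Qed.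

(** Only a change of coordinates E of the ambient O^d appears: M is a set, and a basis of it
    consists of the rows of E multiplied by the p^(a_i). *)
Definition smith_form d m (M : set 'rV[O]_d) : Prop :=
  exists E : 'M[O]_d, exists a : 'I_d -> nat,
    [/\ E \in unitmx, {homo a : i j / (i <= j)%N}, forall i, (a i <= m)%N &
        forall x, M (x *m E) <-> forall i, pdvd (a i) (x 0 i)].

(** A vector of M with an entry of least valuation al is p^al times a vector y with a unit entry.
    With y as first basis vector, M is the direct sum of p^al O y and a submodule M' of the
    complementary O^d. *)
Lemma smith_form_step d m :
  (forall M : set 'rV[O]_d, Osubmod M -> (forall x, M (p%:R ^+ m *: x)) ->
    smith_form m M) ->
  forall M : set 'rV[O]_(1 + d), Osubmod M -> (forall x, M (p%:R ^+ m *: x)) ->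
    smith_form m M.
Proof.
move=> IHd M [M0 MD MZ] Mm.
have MN : forall x, M x -> M (- x) by move=> x Mx; rewrite -scaleN1r; apply: MZ.
(* [P k] says that some vector of M has an entry of valuation at most k; the least such k is the
   first elementary divisor al. *)
pose P k := `[< exists2 x, M x & exists j, ~ pdvd k.+1 (x 0 j) >].
have exP : exists k, P k.
  exists m; apply/asboolP; exists (p%:R ^+ m *: const_mx 1); first exact: Mm.
  exists (lshift d 0); rewrite !mxE -addn1 => /pdvd_pMl; apply/padic_unitP; exact: unitr1.
have [al /asboolP [x Mx [j xj]] almin] := ex_minnP exP.
have Mal y : M y -> forall i, pdvd al (y 0 i).
  case: (al) almin => [|k] kmin My i; first exact: pdvd0n.
  apply: contrapT => yi; have /kmin : P k by apply/asboolP; exists y => //; exists i.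
  by rewrite ltnn.
have alm : (al <= m)%N.
  by apply: almin; apply/asboolP; exists (p%:R ^+ m *: const_mx 1) => //;
     exists (lshift d 0); rewrite !mxE -addn1 => /pdvd_pMl; apply/padic_unitP; exact: unitr1.
have /(_ _)/cid ex i := Mal x Mx i; pose y : 'rV[O]_(1 + d) := \row_i projT1 (ex i).
have xE : x = p%:R ^+ al *: y by apply/rowP => i; rewrite !mxE; case: (ex i).
have yj : y 0 j \is a GRing.unit.
  by apply/padic_unitP => yj; apply: xj; rewrite xE mxE -addn1; apply/pdvd_pMl.
have [E0 E0u E0y] := unit_row_complete yj.
pose M' : set 'rV[O]_d := [set z | M ((row_mx (0 : 'rV_1) z : 'rV_(1 + d)) *m E0)].
have M'S : Osubmod M'.
  split=> [|z z'|c z]; rewrite /M' /=.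
  - by rewrite row_mx0 mul0mx.
  - by move=> h h'; rewrite -[0]addr0 -add_row_mx mulmxDl; apply: MD.
  - by move=> h; rewrite -[0](scaler0 _ c) -scale_row_mx -scalemxAl; apply: MZ.
have M'm z : M' (p%:R ^+ m *: z).
  by rewrite /M' /= -[0](scaler0 _ (p%:R ^+ m)) -scale_row_mx -scalemxAl; apply: Mm.
have [E' [a' [E'u a'h a'm M'E]]] := IHd M' M'S M'm.
(* All entries of all vectors of M are divisible by p^al, so the elementary divisors of M' are at
   least al and the sequence stays sorted. *)
have al_a' i : (al <= a' i)%N.
  have /M'E /Mal : forall k, pdvd (a' k) ((p%:R ^+ a' i *: delta_mx 0 i : 'rV[O]_d) 0 k).
    move=> k; rewrite !mxE eqxx /=; case: eqVneq => [->|_]; last by rewrite mulr0; apply: pdvd0.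
    by exists 1.
  move=> /(pdvd_mulmx (invmx E0)); rewrite mulmxK // => h.
  have {}h : forall k, pdvd al (((p%:R ^+ a' i *: delta_mx 0 i : 'rV[O]_d) *m E') 0 k).
    by move=> k; have := h (rshift 1 k); rewrite row_mxEr.
  have := pdvd_mulmx (invmx E') h; rewrite mulmxK // => /(_ i).
  rewrite !mxE !eqxx mulr1 leqNgt => h2; apply/negP => lt.
  have := pdvdW lt h2; rewrite -[_ ^+ _]mulr1 -addn1 => /pdvd_pMl.
  by apply/padic_unitP; exact: unitr1.
pose E : 'M[O]_(1 + d) := block_mx 1%:M 0 0 E' *m E0.
exists E, (fun i => if fintype.split i is inr k then a' k else al); split.
- by rewrite unitmx_mul E0u unitmxE det_ublock det1 mul1r -unitmxE E'u.
- move=> i k; case: splitP => i' ->; case: splitP => k' -> //=.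
    by rewrite ord1 leqn0 => /eqP.
  by rewrite leq_add2l; apply: a'h.
- by move=> i; case: fintype.split.
move=> z; pose z0 : 'rV[O]_1 := lsubmx z.
pose z1 : 'rV[O]_d := rsubmx z.
have zE : z *m E = z0 0 0 *: y + row_mx (0 : 'rV_1) (z1 *m E') *m E0.
  rewrite -[z]hsubmxK -/z0 -/z1 /E mulmxA mul_row_block !mulmx0 mulmx1.
  rewrite addr0 add0r -[z0 in LHS]addr0 -[z1 *m E' in LHS]add0r -add_row_mx mulmxDl.
  congr (_ + _); rewrite -E0y; 
  apply/rowP => k; rewrite mxE big_split_ord /= big_ord1 big1 ?addr0.
    by rewrite row_mxEl !mxE.
  by move=> q _; rewrite row_mxEr mxE mul0r.
have zi i : z 0 i = if fintype.split i is inr k then z1 0 k else z0 0 0.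
  by case: splitP => k ik; rewrite !mxE; congr (z _ _); apply: val_inj; rewrite //= ?ord1 // ik ord1.
rewrite zE; split.
  move=> Mz.
  have h0 : pdvd al (z0 0 0).
    have /= := Mal _ Mz; rewrite -zE => /(pdvd_mulmx (invmx E0)).
    rewrite /E mulmxA mulmxK // => /(_ (lshift d 0)).
    rewrite -[z]hsubmxK mul_row_block mulmx0 mulmx1 addr0.
    by rewrite row_mxEl.
  have h1 : M' (z1 *m E').
    have [q qE] := h0; rewrite /M' /=.
    rewrite -[X in M X](addKr (z0 0 0 *: y)); apply: MD => //.
    by rewrite qE mulrC -scalerA -xE; apply/MN/MZ.
  by move: h1 => /M'E h1 i; rewrite zi; case: fintype.split.
move=> h; apply: MD.
  have := h (lshift d 0); rewrite zi; case: splitP => // k _ [q ->].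
  by rewrite mulrC -scalerA -xE; apply: MZ.
by apply/M'E => k; have := h (rshift 1 k); rewrite zi (unsplitK (inr k)).
Qed.

Lemma smith_normal_form d m (M : set 'rV[O]_d) :
  Osubmod M -> (forall x, M (p%:R ^+ m *: x)) -> smith_form m M.
Proof.
elim: d M => [|d IHd] M MS Mm; last exact: (smith_form_step IHd).
exists 1%:M, (fun=> 0%N); split=> //; first exact: unitmx1.
case: MS => M0 _ _ x; split=> [_ []//|_].
by rewrite (_ : _ *m _ = 0) //; apply/rowP => -[].
Qed.

End Smith.

(** * Lattices *)

Lemma uniform_bound (I : finType) (P : I -> int -> Prop) :
  (forall i s t, s <= t -> P i s -> P i t) -> (forall i, exists s, P i s) ->
  exists s, forall i, P i s.
Proof.
move=> Pup Pex; pose s i := projT1 (cid (Pex i)).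
have sP i : P i (s i) by rewrite /s; case: cid.
exists (\sum_i `|s i|%N%:Z) => i; apply: Pup (sP i).
rewrite (bigD1 i) //= -[s i]addr0 lerD //; first by lia.
by apply: sumr_ge0.
Qed.

Lemma uniform_bound_down (I : finType) (P : I -> int -> Prop) :
  (forall i s t, s <= t -> P i t -> P i s) -> (forall i, exists s, P i s) ->
  exists s, forall i, P i s.
Proof.
move=> Pdn Pex; have [||s sP] := @uniform_bound I (fun i s => P i (- s)).
- by move=> i s t st; apply: Pdn; lia.
- by move=> i; have [s Ps] := Pex i; exists (- s); rewrite opprK.
by exists (- s).
Qed.

Section LinearCombinations.
Variables (p : nat) (p_pr : prime p).
Local Notation O := (padic_int p_pr).
Local Notation F := (padic p_pr).
Local Notation pi := (p%:R : F).
Variable U : lmodType F.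
Implicit Types (N : set U).

Definition lcomb d (f : 'I_d -> U) (c : 'rV[F]_d) : U := \sum_i c 0 i *: f i.

Lemma lcombD d (f : 'I_d -> U) c c' : lcomb f (c + c') = lcomb f c + lcomb f c'.
Proof. by rewrite -big_split; apply: eq_bigr => i _; rewrite mxE scalerDl. Qed.
Lemma lcombZ d (f : 'I_d -> U) a c : lcomb f (a *: c) = a *: lcomb f c.
Proof. by rewrite scaler_sumr; apply: eq_bigr => i _; rewrite mxE scalerA. Qed.
Lemma lcomb0 d (f : 'I_d -> U) : lcomb f 0 = 0.
Proof. by rewrite /lcomb big1 // => i _; rewrite mxE scale0r. Qed.
Lemma lcombN d (f : 'I_d -> U) c : lcomb f (- c) = - lcomb f c.
Proof. by rewrite -[- c]scaleN1r lcombZ scaleN1r. Qed.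
Lemma lcomb_delta d (f : 'I_d -> U) i : lcomb f (delta_mx 0 i) = f i.
Proof.
rewrite /lcomb (bigD1 i) //= mxE !eqxx scale1r big1 ?addr0 // => j ji.
by rewrite mxE eqxx (negbTE ji) scale0r.
Qed.
Lemma lcomb_mul d (f : 'I_d -> U) (G : 'M[F]_d) c :
  lcomb (fun i => lcomb f (row i G)) c = lcomb f (c *m G).
Proof.
rewrite /lcomb; under eq_bigr do rewrite scaler_sumr.
rewrite exchange_big; apply: eq_bigr => j _; rewrite mxE scaler_suml.
by apply: eq_bigr => i _; rewrite !mxE scalerA.
Qed.

Definition submod N : Prop :=
  [/\ N 0, (forall x y, N x -> N y -> N (x + y)) &
      forall (c : O) x, N x -> N (tofrac c *: x)].

Lemma submodZ N c x : submod N -> pideal 0 c -> N x -> N (c *: x).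
Proof. by move=> [_ _ NZ] /pideal0P[u ->]; apply: NZ. Qed.
Lemma submodD N x y : submod N -> N x -> N y -> N (x + y).
Proof. by move=> [_ ND _]; apply: ND. Qed.
Lemma submodN N x : submod N -> N x -> N (- x).
Proof.
move=> NS Nx; rewrite -scaleN1r; apply: submodZ => //.
by apply/pideal0P; exists (-1); rewrite tofracN tofrac1.
Qed.
Lemma submod_sub N x y : submod N -> N x -> N y -> N (x - y).
Proof. by move=> NS Nx Ny; apply: submodD => //; apply: submodN. Qed.
Lemma submod_subgroup N : submod N -> subgroup N.
Proof. by move=> NS; split=> [|x y]; [case: NS|apply: submod_sub]. Qed.
Lemma submod_sum N (I : finType) (P : pred I) (f : I -> U) :
  submod N -> (forall i, P i -> N (f i)) -> N (\sum_(i | P i) f i).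
Proof.
by move=> NS Nf; elim/big_ind: _ => //; [case: NS|move=> x y; apply: submodD].
Qed.
Lemma submod_lcomb N d (f : 'I_d -> U) (c : 'rV[F]_d) : submod N ->
  (forall i, N (f i)) -> (forall i, pideal 0 (c 0 i)) -> N (lcomb f c).
Proof. by move=> NS Nf cO; apply: submod_sum => // i _; apply: submodZ. Qed.
Lemma submod_scaleW N s t x : submod N -> s <= t -> N (pi ^ s *: x) -> N (pi ^ t *: x).
Proof.
move=> NS st Nx; rewrite -(subrK s t) expz_pD -scalerA; apply: submodZ => //.
by apply: (@pidealW p p_pr 0 (t - s)); [lia|apply: pideal_expz].
Qed.

(** The two bounds place N between the multiples by p^s and p^b of the lattice on the f_i. Scaling
    by p^(-b) leads to the Smith form, and G is E with its rows multiplied by p^(b + a_i). *)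
Lemma submod_basis d (f : 'I_d -> U) N : submod N ->
  (forall x, N x -> exists c, x = lcomb f c) ->
  (forall i, exists s, N (pi ^ s *: f i)) ->
  (forall i, exists b, forall c : 'rV[F]_d, N (lcomb f c) -> pideal b (c 0 i)) ->
  exists2 G : 'M[F]_d, G \in unitmx &
    forall c : 'rV[F]_d, N (lcomb f (c *m G)) <-> forall i, pideal 0 (c 0 i).
Proof.
move=> NS Nf absf bndf.
have [s sP] : exists s, forall i, N (pi ^ s *: f i).
  by apply: uniform_bound => // i s t st; apply: submod_scaleW.
have [b bP] : exists b, forall i (c : 'rV[F]_d), N (lcomb f c) -> pideal b (c 0 i).
  apply: (@uniform_bound_down _ (fun i b => forall c : 'rV[F]_d, N (lcomb f c) -> pideal b (c 0 i))) => //.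
  by move=> i x y xy h c Nc; apply: pidealW (h c Nc).
pose M : set 'rV[O]_d := [set x | N (pi ^ b *: lcomb f (map_mx (@tofrac O) x))].
have MS : Osubmod M.
  split=> [|x y|c x]; rewrite /M /=.
  - by rewrite map_mx0 lcomb0 scaler0; case: NS.
  - by move=> Nx Ny; rewrite map_mxD lcombD scalerDr; apply: submodD.
  - by move=> Nx; rewrite map_mxZ lcombZ scalerA mulrC -scalerA; case: NS => _ _; apply.
pose m := `|s - b|%N.
have Mm x : M (p%:R ^+ m *: x).
  rewrite /M /= map_mxZ lcombZ rmorphXn rmorph_nat scalerA exprnP -expz_pD.
  rewrite /lcomb scaler_sumr; apply: submod_sum => // i _.
  rewrite scalerA mulrC -scalerA; apply: submodZ => //.
    by rewrite mxE; apply: pideal_frac.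
  by apply: submod_scaleW (sP i) => //; rewrite /m; lia.
have [E [a [Eu _ _ EP]]] := smith_normal_form MS Mm.
pose E' := map_mx (@tofrac O) E; pose D : 'M[F]_d := diag_mx (\row_i pi ^ (b + (a i)%:Z)).
have EI : E' *m map_mx (@tofrac O) (invmx E) = 1%:M.
  by rewrite -map_mxM mulmxV // map_mx1.
have E'u : E' \in unitmx := (mulmx1_unit EI).1.
have Du : D \in unitmx.
  rewrite unitmxE det_diag unitfE; apply/prodf_neq0 => i _.
  by rewrite mxE expz_p_neq0.
exists (D *m E'); first by rewrite unitmx_mul Du E'u.
move=> c; rewrite mulmxA; split=> [Nc|cO].
- have bc j : pideal b ((c *m D *m E') 0 j) := bP j _ Nc.
  have /(_ _)/cid ex j := bc j; pose x : 'rV[O]_d := \row_j projT1 (ex j).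
  have xE : c *m D *m E' = pi ^ b *: map_mx (@tofrac O) x.
    by apply/rowP => j; rewrite [RHS]mxE [X in _ * X]mxE [x _ _]mxE; case: (ex j).
  have Mx : M (x *m invmx E *m E) by rewrite mulmxKV // /M /= -lcombZ -xE.
  move: Mx => /EP Mx i; have := Mx i => -[q qE].
  have : (c *m D) 0 i = pi ^ b * tofrac ((x *m invmx E) 0 i).
    by rewrite -[c *m D]mulmx1 -EI mulmxA xE -scalemxAl -map_mxM mxE [X in _ * X]mxE.
  rewrite qE mul_mx_diag !mxE tofracM tofracXn tofrac_nat exprnP mulrA -expz_pD => cq.
  by apply/pideal0P; exists q; apply: (mulIf (expz_p_neq0 p_pr (b + a i))); rewrite cq mulrC.
have /(_ _)/cid ex i := (pideal0P _).1 (cO i).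
pose z : 'rV[O]_d := \row_i (p%:R ^+ a i * projT1 (ex i)).
have /EP : forall i, pdvd (a i) (z 0 i).
  by move=> i; rewrite mxE; exists (projT1 (ex i)).
rewrite /M /= -lcombZ map_mxM scalemxAl (_ : _ *: _ = c *m D) //.
apply/rowP => i; rewrite mul_mx_diag !mxE rmorphM rmorphXn rmorph_nat.
case: (ex i) => u /= ->; rewrite expz_pD -exprnP.
by rewrite [RHS]mulrC mulrA.
Qed.

End LinearCombinations.

Section LatticeBasics.
Variables (p : nat) (p_pr : prime p).
Local Notation O := (padic_int p_pr).
Local Notation F := (padic p_pr).
Local Notation pi := (p%:R : F).

Lemma Ospan_submod (U : lmodType F) (A : set U) : submod (Ospan A).
Proof.
split.
- by exists 0%N, (fun=> 0), (fun=> 0); split=> [[]//|]; rewrite big_ord0.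
- move=> x y [k [c [e [Ae ->]]]] [k' [c' [e' [Ae' ->]]]].
  exists (k + k')%N, (fun i => match fintype.split i with inl j => c j | inr j => c' j end),
    (fun i => match fintype.split i with inl j => e j | inr j => e' j end).
  split=> [i|]; first by case: fintype.split.
  rewrite big_split_ord /=; congr (_ + _); apply: eq_bigr => i _.
    by rewrite (unsplitK (inl i)).
  by rewrite (unsplitK (inr i)).
- move=> a x [k [c [e [Ae ->]]]]; exists k, (fun i => a * c i), e; split=> //.
  by rewrite scaler_sumr; apply: eq_bigr => i _; rewrite tofracM scalerA.
Qed.

Lemma sub_Ospan (U : lmodType F) (A : set U) : A `<=` Ospan A.
Proof.
move=> x Ax; exists 1%N, (fun=> 1), (fun=> x); split=> //.
by rewrite big_ord1 tofrac1 scale1r.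
Qed.

Lemma Ospan_sub (U : lmodType F) (A N : set U) : submod N -> A `<=` N -> Ospan A `<=` N.
Proof.
move=> NS AN _ [k [c [e [Ae ->]]]]; apply: submod_sum => // i _.
by apply: submodZ => //; [apply: pideal_frac|apply: AN].
Qed.

Lemma pideal_submod z : @submod p p_pr F^o (pideal z).
Proof.
split=> [|x y|c x]; [exact: pideal0|exact: pidealD|].
by move=> xz; apply: (@pidealMl _ _ z) => //; apply: pideal_frac.
Qed.

Variables (V : vectType F).

Lemma lattice_submod (L : set V) : lattice L -> submod L.
Proof. by move=> [e -> _]; apply: Ospan_submod. Qed.

Lemma lattice_absorbing (L : set V) : lattice L -> forall z, exists s, L (pi ^ s *: z).
Proof.
move=> [e LE eV] z; have LS : submod L by rewrite LE; apply: Ospan_submod.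
have zE := coord_span (X := in_tuple e) (v := z); rewrite /= eV memvf in zE.
have {}zE := zE isT.
have [s sP] : exists s, forall i, pideal 0 (pi ^ s * coord (in_tuple e) i z).
  apply: uniform_bound => [i s t st h|i].
    rewrite -(subrK s t) expz_pD -mulrA; apply: pidealMl => //.
    by apply: (@pidealW p p_pr 0 (t - s)); [lia|apply: pideal_expz].
  have [b bP] := pideal_ex (coord (in_tuple e) i z); exists (- b).
  by rewrite -(addNr b); apply/pideal_scale.
exists s; rewrite zE scaler_sumr; apply: submod_sum => // i _.
rewrite scalerA; apply: submodZ => //; rewrite LE; apply: sub_Ospan.
by rewrite /= mem_nth.
Qed.

Lemma lattice_bounded (L : set V) (phi : V -> F) : lattice L ->
  (forall x y, phi (x + y) = phi x + phi y) ->
  (forall c x, phi (c *: x) = c * phi x) -> exists b, forall x, L x -> pideal b (phi x).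
Proof.
move=> [e -> _] phiD phiZ.
have [b bP] : exists b, forall i : 'I_(size e), pideal b (phi e`_i).
  apply: (@uniform_bound_down 'I_(size e) (fun i b => pideal b (phi e`_i))) => [i s t|i].
    exact: pidealW.
  exact: pideal_ex.
exists b; apply: Ospan_sub => [|x].
  have phi0 : phi 0 = 0 by rewrite -(scale0r 0) phiZ mul0r.
  split=> [|x y|c x] /=; first by rewrite phi0; apply: pideal0.
    by rewrite phiD; apply: pidealD.
  by rewrite phiZ => xb; apply: pidealMl => //; apply: pideal_frac.
by move=> /(nthP 0)[i ie <-]; apply: (bP (Ordinal ie)).
Qed.

Lemma lattice_of_basis d (e : 'I_d -> V) (N : set V) : submod N ->
  (forall z, exists c, z = lcomb e c) ->
  (forall c : 'rV[F]_d, N (lcomb e c) <-> forall i, pideal 0 (c 0 i)) -> lattice N.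
Proof.
move=> NS eV eN; exists [seq e i | i <- enum 'I_d].
  apply/seteqP; split=> [x Nx|].
    have [c xE] := eV x; rewrite xE in Nx *; move/eN: Nx => cO.
    apply: submod_lcomb => //; first exact: Ospan_submod.
    by move=> i; apply: sub_Ospan; rewrite /= map_f ?mem_enum.
  apply: Ospan_sub => // x /= /mapP[i _ ->].
  rewrite -(lcomb_delta e i); apply/eN => j; rewrite mxE eqxx /=; apply/pideal0P.
  by exists ((j == i)%:R); rewrite tofrac_nat.
apply/vspaceP => z; rewrite memvf; have [c ->] := eV z.
by apply: memv_suml => i _; apply/memvZ/memv_span/map_f; rewrite mem_enum.
Qed.

Lemma lattice_adjoin (L : set V) x : lattice L ->
  exists M, [/\ lattice M, L `<=` M, M x &
    forall N, submod N -> L `<=` N -> N x -> M `<=` N].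
Proof.
move=> [e LE eV]; exists (Ospan [set` x :: e]); split.
- exists (x :: e) => //; apply/vspaceP => z; rewrite memvf.
  have : z \in <<e>>%VS by rewrite eV memvf.
  by apply/subvP/sub_span => y ye; rewrite inE ye orbT.
- rewrite LE; apply: Ospan_sub; first exact: Ospan_submod.
  by move=> y ye; apply: sub_Ospan; rewrite /= inE ye orbT.
- by apply: sub_Ospan; rewrite /= inE eqxx.
move=> N NS LN Nx; apply: Ospan_sub => // y /=; rewrite inE => /orP[/eqP->//|ye].
by apply: LN; rewrite LE; apply: sub_Ospan.
Qed.

End LatticeBasics.

(** * Hyperbolic systems and maximal lattices *)

(** With eps = a c / b^2, the substitution t = -(c / b) s carries the equation of [hensel_quadratic]
    to a t^2 + b t + c = 0. *)
Fact quadratic_root_subst (K : fieldType) (a b c s : K) : b != 0 ->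
  c * (a * c / b ^+ 2 * s ^+ 2 - s + 1) =
  (- (c / b) * s) ^+ 2 * a + (- (c / b) * s) * b + c.
Proof. by move=> b0; field. Qed.

(** For y = -t x and a = Q x this is the ratio Q x Q y / beta(x, y)^2: it equals 1/4 for all
    proportional vectors. *)
Fact discriminant_ratio (K : fieldType) (a t : K) : - t * (a * 2%:R) != 0 ->
  a * ((- t) ^+ 2 * a) / (- t * (a * 2%:R)) ^+ 2 = (2%:R * 2%:R)^-1.
Proof.
rewrite !mulf_eq0 !negb_or oppr_eq0 => /and3P[t0 a0 two0].
field; rewrite oppr_eq0 two0 a0 t0 !andbT.
by rewrite (_ : 4%:R = 2%:R * 2%:R) ?mulf_neq0 // -natrM.
Qed.

Section BilinearForm.
Variables (p : nat) (p_pr : prime p).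
Local Notation O := (padic_int p_pr).
Local Notation F := (padic p_pr).
Local Notation pi := (p%:R : F).
Variables (V : vectType F) (beta : {symmetric V}).
Local Notation Q := (quad beta).

Lemma betaC x y : beta x y = beta y x.
Proof. by rewrite hermC expr0 mul1r. Qed.
Lemma betaDl x y z : beta (x + y) z = beta x z + beta y z.
Proof. exact: linearDl. Qed.
Lemma betaZl a x z : beta (a *: x) z = a * beta x z.
Proof. exact: linearZl_LR. Qed.
Lemma betaDr x y z : beta z (x + y) = beta z x + beta z y.
Proof. by rewrite betaC betaDl !(betaC z). Qed.
Lemma betaZr a x z : beta z (a *: x) = a * beta z x.
Proof. by rewrite betaC betaZl (betaC z). Qed.
Lemma beta0l z : beta 0 z = 0. Proof. by rewrite -(scale0r 0) betaZl mul0r. Qed.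
Lemma beta0r z : beta z 0 = 0. Proof. by rewrite betaC beta0l. Qed.
Lemma betaNl x z : beta (- x) z = - beta x z.
Proof. by rewrite -scaleN1r betaZl mulN1r. Qed.
Lemma betaNr x z : beta z (- x) = - beta z x.
Proof. by rewrite betaC betaNl betaC. Qed.
Lemma betaBl x y z : beta (x - y) z = beta x z - beta y z.
Proof. by rewrite betaDl betaNl. Qed.
Lemma betaBr x y z : beta z (x - y) = beta z x - beta z y.
Proof. by rewrite betaDr betaNr. Qed.
Lemma beta_suml (I : finType) (f : I -> V) z : beta (\sum_i f i) z = \sum_i beta (f i) z.
Proof. by elim/big_ind2: _ => [|x a y b <- <-|//]; rewrite ?beta0l ?betaDl. Qed.
Lemma beta_sumr (I : finType) (f : I -> V) z : beta z (\sum_i f i) = \sum_i beta z (f i).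
Proof. by rewrite betaC beta_suml; apply: eq_bigr => i _; rewrite betaC. Qed.
Lemma beta_lcombl d (f : 'I_d -> V) c z : beta (lcomb f c) z = \sum_i c 0 i * beta (f i) z.
Proof. by rewrite beta_suml; apply: eq_bigr => i _; rewrite betaZl. Qed.
Lemma beta_lcombr d (f : 'I_d -> V) c z : beta z (lcomb f c) = \sum_i c 0 i * beta z (f i).
Proof. by rewrite beta_sumr; apply: eq_bigr => i _; rewrite betaZr. Qed.

Lemma beta_quad x : beta x x = Q x * 2%:R.
Proof. by rewrite /quad mulfVK ?padic_two_neq0. Qed.
Lemma quadD x y : Q (x + y) = Q x + beta x y + Q y.
Proof.
apply: (mulIf (padic_two_neq0 p_pr)); rewrite -beta_quad !mulrDl -!beta_quad.
by rewrite betaDl !betaDr (betaC y x) mulr_natr mulr2n !addrA.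
Qed.
Lemma beta_polar x y : beta x y = Q (x + y) - Q x - Q y.
Proof. by rewrite quadD addrAC addrK addrAC subrr add0r. Qed.
Lemma quadZ a x : Q (a *: x) = a ^+ 2 * Q x.
Proof. by rewrite /quad betaZl betaZr !mulrA. Qed.
Lemma quad_beta0 x : beta x x = 0 -> Q x = 0.
Proof. by rewrite /quad => ->; rewrite mul0r. Qed.
Lemma quadpZ (z : int) x : Q (pi ^ z *: x) = pi ^ (z + z) * Q x.
Proof. by rewrite quadZ expr2 expz_pD. Qed.

Lemma witt_index_ex : exists2 U : {vspace V}, \dim U = witt_index beta &
  {in U, forall v, Q v = 0}.
Proof.
pose P := [pred k : 'I_(\dim {:V}).+1 |
  `[< exists2 U : {vspace V}, \dim U = k & {in U, forall v, Q v = 0} >]].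
have : (0 < #|P|)%N.
  apply/card_gt0P; exists ord0; apply/asboolP; exists 0%VS; first exact: dimv0.
  by move=> v; rewrite memv0 => /eqP->; rewrite /quad beta0l mul0r.
move=> /(eq_bigmax_cond (fun k : 'I__ => k : nat))[k /asboolP[U dU U0] kE].
by exists U => //; rewrite dU -kE.
Qed.

Lemma witt_index_max (U : {vspace V}) :
  {in U, forall v, Q v = 0} -> (\dim U <= witt_index beta)%N.
Proof.
move=> U0; have dU : (\dim U < (\dim {:V}).+1)%N by rewrite ltnS dimvS // subvf.
rewrite /witt_index; apply: (@leq_bigmax_cond _ _ (fun k : 'I__ => k : nat) (Ordinal dU)).
by apply/asboolP; exists U.
Qed.

Section Aniso.
Variable S : set V.
Hypothesis SZ : forall c x y, S x -> S y -> S (c *: x + y).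
Hypothesis San : forall x, S x -> Q x = 0 -> x = 0.

(* If beta(x,y)^2 were too large compared with Q(x)Q(y), Hensel's lemma would
   give an isotropic vector in the span of x and y. *)
Lemma aniso_beta x y (i j z : int) : S x -> S y ->
  pideal i (Q x) -> pideal j (Q y) -> 2%:Z * z <= i + j + 1 -> pideal z (beta x y).
Proof.
move=> Sx Sy xi yj zij; apply: contrapT => bz.
have b0 : beta x y != 0 by apply/eqP => b0; apply: bz; rewrite b0; apply: pideal0.
have [w bw] := padic_ord_ex b0.
have wz : w + 1 <= z.
  by rewrite lezD1 ltNge; apply/negP => /(pideal_ord _ bw).
have bw2 : padic_ord (beta x y ^+ 2) (w + w).
  move: bw => [u uu ->]; exists (u ^+ 2); first by rewrite unitrX.
  by rewrite exprMn expr2 -expz_pD tofracXn.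
(* Here the [+ 1] of the bound is spent: beta(x, y) has valuation w < z, whence 2 w + 1 <= i + j. *)
have e1 : pideal 1 (Q x * Q y / beta x y ^+ 2).
  have h : pideal (w + w) (pi ^ (-1) * (Q x * Q y)).
    have -> : w + w = - 1 + (w + w + 1) by lia.
    by apply/pideal_scale; apply: pidealW (pidealM xi yj); lia.
  have := padic_ord_dvd bw2 h => /(pideal_scale 1).
  by rewrite addr0 !mulrA -expz_pD subrr mul1r.
have /pideal0P[e eE] : pideal 0 (Q x * Q y / beta x y ^+ 2) by apply: pidealW e1.
have /hensel_quadratic[s sP] : pdvd 1 e by apply/pideal_dvd; rewrite -eE.
pose t := - (Q y / beta x y) * tofrac s.
have t0 : Q (t *: x + y) = 0.
  rewrite quadD quadZ betaZl.
  have <- : Q y * tofrac (e * s ^+ 2 - s + 1) = t ^+ 2 * Q x + t * beta x y + Q y.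
    rewrite tofracD tofracB tofracM tofracXn tofrac1 -eE /t.
    exact: quadratic_root_subst.
  by rewrite sP tofrac0 mulr0.
(* The isotropic vector t x + y must vanish, so x and y are proportional and the ratio is 1/4;
   multiplied by 4, it would put 1 in p O. *)
have yE : y = (- t) *: x by apply/eqP; rewrite scaleNr -addr_eq0 addrC; apply/eqP/San => //; apply: SZ.
have E4 : Q x * Q y / beta x y ^+ 2 = (2%:R * 2%:R : F)^-1.
  by move: b0; rewrite yE quadZ betaZr beta_quad; apply: discriminant_ratio.
have : pideal 1 (2%:R * 2%:R * (2%:R * 2%:R : F)^-1).
  rewrite -E4; apply: pidealMl => //; apply/pideal0P; exists (2%:R * 2%:R).
  by rewrite tofracM tofrac_nat.
by rewrite divff ?mulf_neq0 ?padic_two_neq0 // -(expr0z pi) => /pideal_expzE.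
Qed.

End Aniso.

Hypothesis nondeg : nondegenerate beta.

Lemma nondeg0 x : (forall y, beta x y = 0) -> x = 0.
Proof.
move=> x0; apply/eqP; rewrite -memv0; move/eqP: nondeg => <-.
by apply/mem_orthovP => y _; apply: x0.
Qed.

(** A vector in the kernel of the Gram matrix of a basis would give an element of the radical, so
    the matrix can be inverted. *)
Lemma riesz (phi : V -> F) : (forall x y, phi (x + y) = phi x + phi y) ->
  (forall c x, phi (c *: x) = c * phi x) -> exists g, forall x, phi x = beta x g.
Proof.
move=> phiD phiZ; pose n := \dim {:V}; pose b := vbasis {:V}.
have bV z : exists c, z = lcomb (fun i : 'I_n => b`_i) c.
  exists (\row_i coord b i z); rewrite {1}(coord_vbasis (memvf z)).
  by apply: eq_bigr => i _; rewrite mxE.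
have phi_lc c : phi (lcomb (fun i : 'I_n => b`_i) c) = \sum_i c 0 i * phi b`_i.
  rewrite /lcomb; have phi0 : phi 0 = 0 by rewrite -(scale0r 0) phiZ mul0r.
  by elim/big_ind2: _ => [|x y x' y' <- <-|i _] //; rewrite ?phiD ?phiZ.
pose G : 'M[F]_n := \matrix_(i, j) beta b`_i b`_j.
have Gu : G \in unitmx.
  rewrite -row_free_unit -kermx_eq0; apply/rowV0P => u /sub_kermxP uG.
  have : lcomb (fun i : 'I_n => b`_i) u = 0.
    apply: nondeg0 => y; have [c ->] := bV y; rewrite beta_lcombr big1 // => j _.
    rewrite beta_lcombl; have := congr1 (fun m : 'rV_n => m 0 j) uG; rewrite !mxE.
    by under eq_bigr do rewrite mxE; move=> ->; rewrite mulr0.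
  move=> u0; apply/rowP => i; have /freeP fb := basis_free (vbasisP {:V}).
  by rewrite mxE; exact: (fb (fun i => u 0 i) u0 i).
pose c : 'rV[F]_n := (\row_i phi b`_i) *m invmx G.
exists (lcomb (fun i : 'I_n => b`_i) c) => x; have [a ->] := bV x.
rewrite phi_lc beta_lcombl; apply: eq_bigr => i _; congr (_ * _).
rewrite beta_lcombr; have : (c *m G) 0 i = phi b`_i by rewrite mulmxKV // mxE.
by rewrite mxE => <-; apply: eq_bigr => j _; rewrite [G j i]mxE betaC.
Qed.

Lemma dual_family d (f : 'I_d -> V) : (forall c, lcomb f c = 0 -> c = 0) ->
  exists g : 'I_d -> V, forall i j, beta (f i) (g j) = (i == j)%:R.
Proof.
move=> finj; pose X := [tuple f i | i < d].
have XE (i : 'I_d) : X`_i = f i by rewrite -tnth_nth tnth_mktuple.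
have Xf : free X.
  apply/freeP => k k0 i; have := finj (\row_i k i).
  suff -> : lcomb f (\row_i k i) = 0 by move=> /(_ erefl)/rowP/(_ i); rewrite !mxE.
  by rewrite -[RHS]k0; apply: eq_bigr => j _; rewrite mxE XE.
have ex j : exists g, forall x, coord X j x = beta x g.
  by apply: riesz => *; rewrite ?linearD ?linearZ.
exists (fun j => projT1 (cid (ex j))) => i j.
by case: cid => g gP /=; rewrite -gP -XE coord_free.
Qed.


End BilinearForm.

Section Hyperbolic.
Variables (p : nat) (p_pr : prime p).
Local Notation O := (padic_int p_pr).
Local Notation F := (padic p_pr).
Local Notation pi := (p%:R : F).
Variables (V : vectType F) (beta : {symmetric V}).
Local Notation Q := (quad beta).
Local Notation l := (witt_index beta).

(** The partners pair to p^k and not to 1: both families then lie in a lattice of norm p^k O and are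
    combined with coefficients in O, where a Witt decomposition has coefficients in mu(L). *)
Definition hyperbolic (k : int) (x y : 'I_l -> V) : Prop :=
  [/\ forall i j, beta (x i) (x j) = 0, forall i j, beta (y i) (y j) = 0 &
      forall i j, beta (x i) (y j) = pi ^ k * (i == j)%:R].

(* The lattice sum_i (O x_i + O y_i) + {w in W | Q w in p^k O}, W being the
   orthogonal complement of the x_i and y_i. *)
Definition hlattice (k : int) (x y : 'I_l -> V) : set V :=
  [set z | pideal k (Q z) /\
           forall i, pideal k (beta z (x i)) /\ pideal k (beta z (y i))].

Section System.
Variables (k : int) (x y : 'I_l -> V).
Hypothesis hxy : hyperbolic k x y.
Local Notation W := (witt_complement x y).

Let xx i j : beta (x i) (x j) = 0. Proof. by case: hxy. Qed.
Let yy i j : beta (y i) (y j) = 0. Proof. by case: hxy. Qed.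
Let xy i j : beta (x i) (y j) = pi ^ k * (i == j)%:R. Proof. by case: hxy. Qed.

(** Coordinates are crossed: the coefficient of z along x_i is read from beta(z, y_i), and
    conversely. *)
Definition hcoef (z : V) (u : 'I_l -> V) : 'rV[F]_l := \row_i (pi ^ (- k) * beta z (u i)).
Definition hproj (z : V) : V := z - (lcomb x (hcoef z y) + lcomb y (hcoef z x)).

Lemma beta_x_lcomb_y c i : beta (x i) (lcomb y c) = pi ^ k * c 0 i.
Proof.
rewrite beta_lcombr (bigD1 i) //= xy eqxx mulr1 big1 ?addr0 1?mulrC // => j ji.
by rewrite xy eq_sym (negbTE ji) !mulr0.
Qed.
Lemma beta_y_lcomb_x c i : beta (y i) (lcomb x c) = pi ^ k * c 0 i.
Proof.
rewrite beta_lcombr (bigD1 i) //= betaC xy eqxx mulr1 big1 ?addr0 1?mulrC // => j ji.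
by rewrite betaC xy (negbTE ji) !mulr0.
Qed.
Lemma beta_x_lcomb_x c i : beta (x i) (lcomb x c) = 0.
Proof. by rewrite beta_lcombr big1 // => j _; rewrite xx mulr0. Qed.
Lemma beta_y_lcomb_y c i : beta (y i) (lcomb y c) = 0.
Proof. by rewrite beta_lcombr big1 // => j _; rewrite yy mulr0. Qed.

Lemma hcoefE z u i : pi ^ k * hcoef z u 0 i = beta z (u i).
Proof. by rewrite mxE mulrA -expz_pD subrr mul1r. Qed.

Lemma hproj_complement z : W (hproj z).
Proof.
move=> i; split; rewrite betaBl betaDl ![beta (lcomb _ _) _]betaC.
  by rewrite beta_x_lcomb_x beta_x_lcomb_y hcoefE add0r subrr.
by rewrite beta_y_lcomb_x beta_y_lcomb_y hcoefE addr0 subrr.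
Qed.

Lemma hproj_decomp z : z = lcomb x (hcoef z y) + lcomb y (hcoef z x) + hproj z.
Proof. by rewrite addrC subrK. Qed.

Lemma complement_lcomb w c c' : W w -> beta w (lcomb x c + lcomb y c') = 0.
Proof.
move=> Ww; rewrite betaDr !beta_lcombr !big1 ?addr0 // => i _;
by case: (Ww i) => h1 h2; rewrite ?h1 ?h2 mulr0.
Qed.

Lemma complementZ c w w' : W w -> W w' -> W (c *: w + w').
Proof.
move=> Ww Ww' i; case: (Ww i) (Ww' i) => h1 h2 [h3 h4].
by rewrite !betaDl !betaZl h1 h2 h3 h4 mulr0 addr0.
Qed.

Lemma beta_hproj (z z' : V) : beta z z' =
  pi ^ (- k) * \sum_i (beta z (x i) * beta z' (y i) + beta z (y i) * beta z' (x i))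
  + beta (hproj z) (hproj z').
Proof.
rewrite {1}(hproj_decomp z) {1}(hproj_decomp z') betaDl betaDr [beta (hproj z) (_ + hproj z')]betaDr.
rewrite (complement_lcomb _ _ (hproj_complement z)) add0r.
rewrite [beta (_ + _) (hproj z')]betaC (complement_lcomb _ _ (hproj_complement z')) addr0.
congr (_ + _); rewrite betaDl !beta_lcombl big_distrr -big_split.
apply: eq_bigr => i _ /=; rewrite !betaDr beta_x_lcomb_x beta_x_lcomb_y add0r.
by rewrite beta_y_lcomb_x beta_y_lcomb_y addr0 !hcoefE !mxE mulrDr !mulrA addrC.
Qed.

Lemma quad_hproj z :
  Q z = pi ^ (- k) * \sum_i (beta z (x i) * beta z (y i)) + Q (hproj z).
Proof.
apply: (mulIf (padic_two_neq0 p_pr)); rewrite -beta_quad mulrDl -beta_quad.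
rewrite beta_hproj; congr (_ + _); rewrite -mulrA mulr_suml; congr (_ * _).
by apply: eq_bigr => i _; rewrite [X in _ + X]mulrC mulr_natr mulr2n.
Qed.

Lemma hsum_pideal z z' (a b : V -> 'I_l -> F) :
  (forall i, pideal k (a z i)) -> (forall i, pideal k (b z' i)) ->
  pideal k (pi ^ (- k) * \sum_i (a z i * b z' i)).
Proof.
move=> az bz; rewrite -{1}(addKr k k); apply/pideal_scale.
by apply: pideal_sum => i _; apply: pidealM.
Qed.

Lemma hlatticeP z : hlattice k x y z <->
  (forall i, pideal k (beta z (x i)) /\ pideal k (beta z (y i))) /\ pideal k (Q (hproj z)).
Proof.
have key : (forall i, pideal k (beta z (x i)) /\ pideal k (beta z (y i))) ->
    pideal k (pi ^ (- k) * \sum_i (beta z (x i) * beta z (y i))).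
  move=> h; apply: (@hsum_pideal z z (fun z i => beta z (x i)) (fun z i => beta z (y i))) => i;
  by case: (h i).
split=> [[Qz h]|[h Qz]]; split=> //.
  rewrite (_ : Q (hproj z) = Q z - pi ^ (- k) * \sum_i (beta z (x i) * beta z (y i))).
    by apply: pidealB => //; apply: key.
  by rewrite [Q z]quad_hproj addrC addKr.
by rewrite quad_hproj; apply: pidealD => //; apply: key.
Qed.

Lemma hyperbolic_lcomb_inj c : lcomb x c = 0 -> c = 0.
Proof.
move=> c0; apply/rowP => i; rewrite mxE; apply: (mulfI (expz_p_neq0 p_pr k)).
by rewrite -beta_y_lcomb_x c0 beta0r mulr0.
Qed.

(** A nonzero isotropic w in W would span, with the x_i, a totally isotropic space of dimension l +
    1. *)
Lemma hyperbolic_aniso w : W w -> Q w = 0 -> w = 0.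
Proof.
move=> Ww Qw; apply/eqP; apply: contraT => w0.
pose X := [tuple x i | i < l].
have XE (i : 'I_l) : X`_i = x i by rewrite -tnth_nth tnth_mktuple.
have Xlc u : u \in <<X>>%VS -> exists c, u = lcomb x c.
  move=> uX; exists (\row_i coord X i u); rewrite {1}(coord_span uX).
  by apply: eq_bigr => i _; rewrite mxE XE.
have Xf : free X.
  apply/freeP => a a0 i; have := @hyperbolic_lcomb_inj (\row_i a i).
  suff -> : lcomb x (\row_i a i) = 0 by move=> /(_ erefl)/rowP/(_ i); rewrite !mxE.
  by rewrite -[RHS]a0; apply: eq_bigr => j _; rewrite mxE XE.
have wX : w \notin <<X>>%VS.
  apply/negP => /Xlc[c wE]; move/eqP: w0; apply; rewrite wE.
  suff -> : c = 0 by rewrite lcomb0.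
  apply/rowP => i; rewrite mxE; apply: (mulfI (expz_p_neq0 p_pr k)).
  by rewrite -beta_y_lcomb_x -wE betaC (Ww i).2 mulr0.
have := @witt_index_max p p_pr V beta <<w :: X>>%VS.
have /eqP -> : free (w :: X) by rewrite free_cons wX.
rewrite (_ : size (w :: X) = l.+1) ?ltnn => [h|]; last by rewrite /= size_map size_enum_ord.
apply: h => u.
rewrite span_cons => /memv_addP[u1 /vlineP[a ->] [u2 /Xlc[c ->] ->]].
rewrite quadD quadZ Qw mulr0 add0r betaZl -[lcomb x c]addr0 -(lcomb0 y).
rewrite complement_lcomb // mulr0 add0r lcomb0 addr0; apply: quad_beta0.
by rewrite beta_lcombl big1 // => i _; rewrite beta_x_lcomb_x mulr0.
Qed.

Lemma complement_beta w w' (i j z : int) : W w -> W w' ->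
  pideal i (Q w) -> pideal j (Q w') -> 2%:Z * z <= i + j + 1 -> pideal z (beta w w').
Proof.
move=> Ww Ww' wi wj zij.
exact: (aniso_beta complementZ hyperbolic_aniso Ww Ww' wi wj zij).
Qed.

(** Polarization cannot be used here: it requires closure under addition, which is itself deduced
    from this bound. On W the bound comes from anisotropy, through [complement_beta]. *)
Lemma hlattice_integral z z' : hlattice k x y z -> hlattice k x y z' ->
  pideal k (beta z z').
Proof.
move=> /hlatticeP[z1 z2] /hlatticeP[z1' z2']; rewrite beta_hproj; apply: pidealD.
  rewrite big_split mulrDr; apply: pidealD.
    by apply: (@hsum_pideal z z' (fun z i => beta z (x i)) (fun z i => beta z (y i))) => i;
      [case: (z1 i)|case: (z1' i)].
  by apply: (@hsum_pideal z z' (fun z i => beta z (y i)) (fun z i => beta z (x i))) => i;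
    [case: (z1 i)|case: (z1' i)].
apply: (complement_beta (i := k) (j := k)) => //; try exact: hproj_complement.
lia.
Qed.

Lemma hlattice_submod : submod (hlattice k x y).
Proof.
split=> [|z z' hz hz'|c z [Qz h]].
- split=> [|i]; first by rewrite quad_beta0 ?beta0l //; apply: pideal0.
  by rewrite !beta0l; split; apply: pideal0.
- have b := hlattice_integral hz hz'; case: hz hz' => [Qz h] [Qz' h'].
  split=> [|i]; first by rewrite quadD; do 2?apply: pidealD.
  by rewrite !betaDl; case: (h i) (h' i) => [? ?] [? ?]; split; apply: pidealD.
split=> [|i].
  by rewrite quadZ; apply: pidealMl => //; rewrite -tofracXn; apply: pideal_frac.
by rewrite !betaZl; case: (h i) => [? ?]; split; apply: pidealMl => //; apply: pideal_frac.
Qed.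

Lemma hlattice_absorbing z : exists s, hlattice k x y (pi ^ s *: z).
Proof.
have [a aP] := pideal_ex (Q z).
have [b bP] : exists b, forall i, pideal b (beta z (x i)) /\ pideal b (beta z (y i)).
  apply: (@uniform_bound_down _ (fun i b => pideal b (beta z (x i)) /\ pideal b (beta z (y i)))).
    by move=> i s t st [? ?]; split; apply: (pidealW st).
  move=> i; have [b bP] := pideal_ex (beta z (x i)); have [c cP] := pideal_ex (beta z (y i)).
  by exists (Num.min b c); split; [apply: pidealW bP|apply: pidealW cP]; lia.
pose s : int := (`|k| + `|a| + `|b|)%N; exists s; split.
  by rewrite quadpZ; apply: (@pidealW _ _ _ (s + s + a)); [lia|apply/pideal_scale].
move=> i; rewrite !betaZl; split; apply: (@pidealW _ _ _ (s + b)); try lia;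
by apply/pideal_scale; case: (bP i).
Qed.

Lemma hlattice_mem i : hlattice k x y (x i) /\ hlattice k x y (y i).
Proof.
split; (split; first by rewrite quad_beta0 //; apply: pideal0) => j.
  rewrite xx xy; split; first exact: pideal0.
  rewrite -[X in pideal X]addr0; apply/pideal_scale/pideal0P.
  by exists ((i == j)%:R); rewrite tofrac_nat.
rewrite yy betaC xy; split; last exact: pideal0.
rewrite -[X in pideal X]addr0; apply/pideal_scale/pideal0P.
by exists ((j == i)%:R); rewrite tofrac_nat.
Qed.

Hypothesis nondeg : nondegenerate beta.
Hypothesis l_gt0 : (0 < l)%N.

Lemma hlattice_lattice : lattice (hlattice k x y).
Proof.
pose n := \dim {:V}; pose f := fun i : 'I_n => (vbasis {:V})`_i.
have fV z : exists c, z = lcomb f c.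
  exists (\row_i coord (vbasis {:V}) i z); rewrite {1}(coord_vbasis (memvf z)).
  by apply: eq_bigr => i _; rewrite mxE.
have finj c : lcomb f c = 0 -> c = 0.
  move=> c0; apply/rowP => i; have /freeP fb := basis_free (vbasisP {:V}).
  by rewrite mxE; exact: (fb (fun i => c 0 i) c0 i).
have [g gP] := dual_family nondeg finj.
have [|i|i|G Gu GP] := @submod_basis p p_pr V n f _ hlattice_submod.
- by move=> z _; apply: fV.
- exact: hlattice_absorbing.
- have [s sP] := hlattice_absorbing (g i); exists (k - s) => c hc.
  have := hlattice_integral hc sP; rewrite betaZr beta_lcombl.
  rewrite (bigD1 i) //= gP eqxx mulr1 big1 ?addr0 => [|j ji].
    by rewrite -{1}(subrKC s k) => /pideal_scale.
  by rewrite gP (negbTE ji) mulr0.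
apply: (@lattice_of_basis _ _ _ n (fun i => lcomb f (row i G))).
- exact: hlattice_submod.
- move=> z; have [c ->] := fV z; exists (c *m invmx G).
  by rewrite lcomb_mul mulmxKV.
- by move=> c; rewrite lcomb_mul; apply: GP.
Qed.

Lemma hlattice_norm : lattice_norm beta (hlattice k x y) = pideal k.
Proof.
apply/seteqP; split.
  by apply: (@Ospan_sub p p_pr F^o _ _ (pideal_submod p_pr k)) => _ [z [Qz _] <-].
(* Q (x_i + y_i) = p^k, so a single hyperbolic plane generates the whole norm. *)
pose i := Ordinal l_gt0; move=> _ [u ->].
have -> : pi ^ k * tofrac u = tofrac u *: (Q (x i + y i) : F^o).
  by rewrite quadD !quad_beta0 // add0r addr0 xy eqxx mulr1 mulrC.
apply: submodZ; [exact: Ospan_submod|exact: pideal_frac|].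
apply: sub_Ospan; exists (x i + y i) => //.
by apply: submodD; [apply: hlattice_submod|case: (hlattice_mem i)..].
Qed.

(** Immediate because [hlattice] is defined by conditions and not by generators: by polarization, a
    lattice of the same norm containing the x_i and y_i pairs with them into p^k O. *)
Lemma hlattice_maximal : maximal_lattice beta (hlattice k x y).
Proof.
split=> [|M Mlat sub Mnorm]; first exact: hlattice_lattice.
apply/seteqP; split=> // z Mz; rewrite hlattice_norm in Mnorm.
have MQ u : M u -> pideal k (Q u).
  by move=> Mu; rewrite -Mnorm; apply: (@sub_Ospan _ _ F^o); exists u.
have Mb u v : M u -> M v -> pideal k (beta u v).
  move=> Mu Mv; rewrite beta_polar.
  by apply: pidealB; [apply: pidealB|]; apply: MQ => //; apply: submodD => //; apply: lattice_submod.
split; first exact: MQ.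
by move=> i; split; apply: Mb => //; apply: sub; case: (hlattice_mem i).
Qed.

End System.
End Hyperbolic.

(** * Structure of maximal lattices *)

Section MaximalLattices.
Variables (p : nat) (p_pr : prime p).
Local Notation O := (padic_int p_pr).
Local Notation F := (padic p_pr).
Local Notation pi := (p%:R : F).
Variables (V : vectType F) (beta : {symmetric V}).
Local Notation Q := (quad beta).
Local Notation l := (witt_index beta).
Hypothesis nondeg : nondegenerate beta.
Hypothesis l_gt0 : (0 < l)%N.

Lemma lattice_beta_bounded (L : set V) : lattice L ->
  exists b, forall x y, L x -> L y -> pideal b (beta x y).
Proof.
move=> Llat; have [e LE _] := Llat.
have [b bP] : exists b, forall i : 'I_(size e), forall x, L x -> pideal b (beta x e`_i).
  apply: (@uniform_bound_down 'I_(size e)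
    (fun i b => forall x, L x -> pideal b (beta x e`_i))) => [i s t st h x Lx|i].
    exact: pidealW (h x Lx).
  by apply: (lattice_bounded Llat) => *; rewrite ?betaDl ?betaZl.
exists b => x y Lx; rewrite LE; move: y.
apply: (@Ospan_sub p p_pr V _ [set y | pideal b (beta x y)]).
  split=> [|u v|c u] /=; first by rewrite beta0r; apply: pideal0.
    by rewrite betaDr; apply: pidealD.
  by rewrite betaZr => h; apply: pidealMl => //; apply: pideal_frac.
by move=> _ /(nthP 0)[i ie <-]; apply: (bP (Ordinal ie)).
Qed.

Lemma lattice_anisotropic_vector (L : set V) : lattice L -> exists2 x, L x & Q x != 0.
Proof.
move=> Llat; have [U dU U0] := witt_index_ex beta.
have [u [uU u0]] : exists u, u \in U /\ u != 0.
  exists (vpick U); rewrite memv_pick vpick0 -dimv_eq0 dU; split=> //.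
  by rewrite -lt0n.
have [y uy] : exists y, beta u y != 0.
  apply: contrapT => h; move/eqP: u0; apply; apply: (nondeg0 nondeg) => y.
  by apply: contrapT => /eqP uy; apply: h; exists y.
have [s us] := lattice_absorbing Llat u; have [t yt] := lattice_absorbing Llat y.
apply: contrapT => h.
have Q0 z : L z -> Q z = 0.
  by move=> Lz; apply: contrapT => /eqP Qz; apply: h; exists z.
move/eqP: uy; apply.
have : beta (pi ^ s *: u) (pi ^ t *: y) = 0.
  rewrite beta_polar !Q0 ?subr0 //.
  by apply: submodD => //; apply: lattice_submod.
rewrite betaZl betaZr => /eqP; rewrite !mulf_eq0.
by rewrite !(negbTE (expz_p_neq0 _ _)) /= => /eqP.
Qed.

Lemma lattice_norm_ex (L : set V) : lattice L -> exists k, lattice_norm beta L = pideal k.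
Proof.
move=> Llat; have [b bP] := lattice_beta_bounded Llat.
(* [quad] divides by 2, which lowers the exponent when p = 2; [b2] accounts for it. *)
have [b2 b2P] := pideal_ex ((2%:R : F)^-1).
have QP x : L x -> pideal (b + b2) (Q x).
  by move=> Lx; rewrite /quad; apply: pidealM => //; apply: bP.
pose P j := `[< exists2 x, L x & padic_ord (Q x) (b + b2 + j%:Z) >].
have exP : exists j, P j.
  have [x Lx /padic_ord_ex[z xz]] := lattice_anisotropic_vector Llat.
  have /(pideal_ord _ xz) bz := QP x Lx.
  exists (absz (z - (b + b2))%R); apply/asboolP; exists x => //.
  by rewrite gez0_abs ?subr_ge0 // subrKC.
have [j /asboolP[x Lx xj] jmin] := ex_minnP exP.
exists (b + b2 + j%:Z); apply/seteqP; split.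
  apply: (@Ospan_sub p p_pr F^o _ _ (pideal_submod p_pr _)) => _ [y Ly <-].
  have [->|/padic_ord_ex[z yz]] := eqVneq (Q y) 0; first exact: pideal0.
  have /(pideal_ord _ yz) bz := QP y Ly; apply/(pideal_ord _ yz).
  have : (j <= absz (z - (b + b2))%R)%N.
    apply: jmin; apply/asboolP; exists y => //.
    by rewrite gez0_abs ?subr_ge0 // subrKC.
  lia.
move: xj => [u uu xE] _ [v ->].
have -> : pi ^ (b + b2 + j%:Z) * tofrac v = tofrac (v / u) *: (Q x : F^o).
  rewrite xE /GRing.scale /= mulrCA -tofracM mulrVK //.
apply: submodZ; [exact: Ospan_submod|exact: pideal_frac|].
by apply: (@sub_Ospan _ _ F^o); exists x.
Qed.

Section Norm.
Variables (L : set V) (k : int).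
Hypotheses (Lmax : maximal_lattice beta L) (Lnorm : lattice_norm beta L = pideal k).

Lemma maximal_submod : submod L.
Proof. by apply: lattice_submod; case: Lmax. Qed.

Lemma norm_quad x : L x -> pideal k (Q x).
Proof. by move=> Lx; rewrite -Lnorm; apply: (@sub_Ospan _ _ F^o); exists x. Qed.

Lemma norm_beta x y : L x -> L y -> pideal k (beta x y).
Proof.
move=> Lx Ly; rewrite beta_polar; apply: pidealB; last exact: norm_quad.
by apply: pidealB; apply: norm_quad => //; apply: submodD => //; apply: maximal_submod.
Qed.

(** Under these conditions Q(y + c x) = Q y + c beta(y, x) + c^2 Q x stays in p^k O, so adjoining x
    to L leaves the norm unchanged. *)
Lemma maximal_mem x : pideal k (Q x) -> (forall y, L y -> pideal k (beta y x)) -> L x.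
Proof.
move=> Qx bx; have [Llat Lm] := Lmax; have [M [Mlat LM Mx Mmin]] := lattice_adjoin x Llat.
rewrite -(Lm M) //; apply/seteqP; split; last first.
  apply: (@Ospan_sub p p_pr F^o); first exact: Ospan_submod.
  by move=> _ [y Ly <-]; apply: (@sub_Ospan _ _ F^o); exists y => //; apply: LM.
rewrite Lnorm; apply: (@Ospan_sub p p_pr F^o _ _ (pideal_submod p_pr _)) => _ [z Mz <-].
have [LS0 LSD LSZ] := maximal_submod.
have : [set z | exists2 y, L y & exists c : O, z = y + tofrac c *: x] z.
  apply: Mmin Mz => [|y Ly|].
  - split=> [|_ _ [y Ly [c ->]] [y' Ly' [c' ->]]|c _ [y Ly [c' ->]]] /=.
    + by exists 0 => //; exists 0; rewrite tofrac0 scale0r addr0.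
    + exists (y + y'); first exact: LSD.
      by exists (c + c'); rewrite tofracD scalerDl addrACA.
    + exists (tofrac c *: y); first exact: LSZ.
      by exists (c * c'); rewrite scalerDr scalerA tofracM.
  - by exists y => //; exists 0; rewrite tofrac0 scale0r addr0.
  - by exists 0 => //; exists 1; rewrite tofrac1 scale1r add0r.
move=> [y Ly [c ->]]; rewrite quadD betaZr quadZ.
apply: pidealD; first apply: pidealD; first exact: norm_quad.
  by apply: pidealMl (bx y Ly); apply: pideal_frac.
by apply: pidealMl Qx; rewrite -tofracXn; apply: pideal_frac.
Qed.

Section IsotropicBasis.
Variable x : 'I_l -> V.
Hypothesis xx : forall i j, beta (x i) (x j) = 0.
Hypothesis xL : forall c : 'rV[F]_l, L (lcomb x c) <-> forall i, pideal 0 (c 0 i).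

Let Lx i : L (x i).
Proof.
rewrite -(lcomb_delta x i); apply/xL => j; rewrite mxE eqxx /=; apply/pideal0P.
by exists ((j == i)%:R); rewrite tofrac_nat.
Qed.

Let xinj (c : 'rV[F]_l) : lcomb x c = 0 -> c = 0.
Proof.
move=> c0; apply/rowP => i; rewrite mxE; apply: pideal_eq0 => n.
have : L (lcomb x (pi ^ (- n%:Z) *: c)) by rewrite lcombZ c0 scaler0; case: maximal_submod.
move=> /xL/(_ i); rewrite mxE => /(pideal_scale n); rewrite addr0.
by rewrite mulrA -expz_pD subrr mul1r.
Qed.

Let N : set 'rV[O]_l :=
  [set c | exists2 z, L z & forall i, beta (x i) z = pi ^ k * tofrac (c 0 i)].

(* A nontrivial elementary divisor of the pairing of L with L cap X would give
   a vector of X \ L that can be adjoined to L without changing its norm. *)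
Let N_full c : N c.
Proof.
have [LS0 LSD LSZ] := maximal_submod; have [Llat _] := Lmax.
have NS : Osubmod N.
  split=> [|c1 c2 [z Lz zE] [z' Lz' z'E]|a c1 [z Lz zE]].
  - by exists 0 => // i; rewrite mxE beta0r tofrac0 mulr0.
  - by exists (z + z') => [|i]; [apply: LSD|rewrite mxE betaDr zE z'E tofracD mulrDr].
  - by exists (tofrac a *: z) => [|i]; [apply: LSZ|rewrite mxE betaZr zE tofracM mulrCA].
have [g gP] := dual_family nondeg xinj.
have [s sP] : exists s, forall i, L (pi ^ s *: g i).
  apply: uniform_bound => [i s t st|i]; last exact: lattice_absorbing.
  exact: submod_scaleW maximal_submod st.
pose m := `|s - k|%N.
have Nm c' : N (p%:R ^+ m *: c').
  exists (lcomb (fun i => pi ^ (k + m%:Z) *: g i) (map_mx (@tofrac O) c')).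
    apply: submod_lcomb => [|i|i]; first exact: maximal_submod.
      by apply: submod_scaleW (sP i); [apply: maximal_submod|rewrite /m; lia].
    by rewrite mxE; apply: pideal_frac.
  move=> i; rewrite beta_lcombr (bigD1 i) //= betaZr gP eqxx mulr1 big1 => [|j ji].
    by rewrite addr0 !mxE expz_pD tofracM tofracXn tofrac_nat -exprnP mulrC mulrA.
  by rewrite betaZr gP eq_sym (negbTE ji) !mulr0.
have [E [a [Eu _ _ EP]]] := smith_normal_form NS Nm.
suff a0 i : a i = 0%N.
  by rewrite -(mulmxKV Eu c); apply/EP => i; rewrite a0; apply: pdvd0n.
apply/eqP; rewrite -leqn0 leqNgt; apply/negP => ai.
(* The i-th column of E^(-1), divided by p. The corresponding combination of the x_j pairs with y in
   L to p^(k - 1) times the i-th coordinate of n E^(-1), which is divisible by p because a_i > 0. *)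
pose b : 'rV[F]_l := \row_j (pi ^ (-1) * tofrac (invmx E j i)).
have : L (lcomb x b).
  apply: maximal_mem => [|y Ly].
    rewrite quad_beta0; first exact: pideal0.
    by rewrite beta_lcombl big1 // => j _; rewrite beta_lcombr big1 ?mulr0 // => j' _; rewrite xx mulr0.
  have /(_ _)/cid ex j := norm_beta (Lx j) Ly.
  pose n : 'rV[O]_l := \row_j projT1 (ex j).
  have nE j : beta (x j) y = pi ^ k * tofrac (n 0 j) by rewrite mxE; case: (ex j).
  have Nn : N n by exists y.
  have := Nn; rewrite -{1}(mulmxKV Eu n) => /EP/(_ i)/(pdvdW ai)/pideal_dvd h.
  have -> : beta y (lcomb x b) = pi ^ (-1) * (pi ^ k * tofrac ((n *m invmx E) 0 i)).
    rewrite betaC beta_lcombl [(n *m _) _ _]mxE raddf_sum !mulr_sumr; apply: eq_bigr => j _.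
    by rewrite mxE nE /= tofracM; move: (tofrac _) (tofrac _) (pi ^ _) (pi ^ _) => A B C D;
       rewrite [A * B]mulrC -!mulrA; congr (_ * _); rewrite mulrCA.
  rewrite -[k in pideal k](addKr 1 k); apply/pideal_scale.
  by rewrite addrC; apply/pideal_scale.
move=> /xL bO.
(* The combination being in L, the i-th column of E^(-1) is divisible by p, against E E^(-1) = 1. *)
have h j : pdvd 1 (invmx E j i).
  apply/pideal_dvd; have := bO j; rewrite mxE => /(pideal_scale 1).
  by rewrite addr0 mulrA -expz_pD subrr mul1r.
have : pdvd 1 (1 : O).
  have <- : (E *m invmx E) i i = 1 by rewrite mulmxV // mxE eqxx.
  by rewrite mxE; apply: pdvd_sum => j _; apply: pdvdMr.
by apply/padic_unitP; apply: unitr1.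
Qed.

Lemma maximal_hyperbolic : exists y, hyperbolic k x y /\ L = hlattice k x y.
Proof.
have ex i : exists2 z, L z & forall j, beta (x j) z = pi ^ k * (j == i)%:R.
  have [z Lz zE] := N_full (delta_mx 0 i); exists z => // j.
  by rewrite zE mxE eqxx /= tofrac_nat.
pose z i := projT1 (cid2 (ex i)).
have Lz i : L (z i) by rewrite /z; case: cid2.
have xz j i : beta (x j) (z i) = pi ^ k * (j == i)%:R by rewrite /z; case: cid2.
(* The products beta(z_i, z_j) are removed by subtracting combinations of the x_j. For i <> j all of
   it is charged to the larger index, and on the diagonal Q(z_i) is used: nothing is halved, and the
   coefficients are integral for p = 2 as well. *)
pose t (i j : 'I_l) : F := pi ^ (- k) *
  (if i == j then Q (z i) else if (j < i)%N then beta (z i) (z j) else 0).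
pose y i := z i - lcomb x (\row_j t i j).
have xlc j c : beta (x j) (lcomb x c) = 0.
  by rewrite beta_lcombr big1 // => j' _; rewrite xx mulr0.
have zlc i c : beta (z i) (lcomb x c) = pi ^ k * c 0 i.
  rewrite beta_lcombr (bigD1 i) //= betaC xz eqxx mulr1 big1 ?addr0 1?mulrC // => j ji.
  by rewrite betaC xz (negbTE ji) !mulr0.
have lclc c c' : beta (lcomb x c) (lcomb x c') = 0.
  by rewrite beta_lcombl big1 // => j _; rewrite xlc mulr0.
have tE i j : pi ^ k * t i j =
    if i == j then Q (z i) else if (j < i)%N then beta (z i) (z j) else 0.
  by rewrite /t mulrA -expz_pD subrr mul1r.
have yy i j : beta (y i) (y j) = 0.
  rewrite betaBl !betaBr lclc subr0 zlc [beta (lcomb _ _) _]betaC zlc !mxE !tE.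
  rewrite eq_sym; have [->|ij] := eqVneq i j; first by rewrite beta_quad mulr_natr mulr2n addrK subrr.
  case: (ltngtP i j) => [|_|/val_inj ijE]; last by rewrite ijE eqxx in ij.
    by rewrite betaC subrr subr0.
  by rewrite subr0 subrr.
have hxy : hyperbolic k x y.
  by split=> // i j; rewrite betaBr xlc subr0.
exists y; split=> //; have [_ Lm] := Lmax.
have tO i j : pideal 0 (t i j).
  rewrite -(addNr k); apply/pideal_scale.
  case: eqP => _; first exact: norm_quad.
  by case: ifP => _; [apply: norm_beta|apply: pideal0].
have Ly i : L (y i).
  apply: submod_sub => //; first exact: maximal_submod.
  by apply/xL => j; rewrite mxE.
rewrite (Lm (hlattice k x y)) //; first exact: hlattice_lattice.
  move=> w Lw; split=> [|i]; first exact: norm_quad.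
  by split; apply: norm_beta.
by rewrite Lnorm hlattice_norm.
Qed.

End IsotropicBasis.
End Norm.

(** The x_i form a basis of the intersection of L with a totally isotropic space U of dimension l,
    which is absorbing and bounded in U. *)
Lemma isotropic_basis_ex (L : set V) : lattice L -> exists x : 'I_l -> V,
  (forall i j, beta (x i) (x j) = 0) /\
  forall c : 'rV[F]_l, L (lcomb x c) <-> forall i, pideal 0 (c 0 i).
Proof.
move=> Llat; have [U dU U0] := witt_index_ex beta.
have [X XU] : exists X : l.-tuple V, basis_of U X.
  by rewrite -dU; exists (vbasis U); apply: vbasisP.
pose f := fun i : 'I_l => X`_i.
have fU c : lcomb f c \in U.
  apply: memv_suml => i _; apply: memvZ; apply: (basis_mem XU).
  by apply: mem_nth; rewrite size_tuple.
have Uf u : u \in U -> exists c, u = lcomb f c.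
  move=> uU; exists (\row_i coord X i u).
  rewrite {1}(coord_basis XU uU); by apply: eq_bigr => i _; rewrite mxE.
have finj c : lcomb f c = 0 -> c = 0.
  move=> c0; apply/rowP => i; have /freeP fb := basis_free XU.
  by rewrite mxE; exact: (fb (fun i => c 0 i) c0 i).
have [g gP] := dual_family nondeg finj.
have LS := lattice_submod Llat.
have [||i|i|G Gu GP] := @submod_basis p p_pr V l f [set z | L z /\ z \in U].
- split=> [|u v [Lu Uu] [Lv Uv]|c u [Lu Uu]] /=.
  + by split; [case: LS|apply: mem0v].
  + by split; [apply: submodD|apply: memvD].
  + by split; [apply: submodZ => //; apply: pideal_frac|apply: memvZ].
- by move=> u [_ /Uf].
- have [s sP] := lattice_absorbing Llat (f i); exists s; split=> //.
  by apply: memvZ; rewrite -(lcomb_delta f i); apply: fU.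
- have [b bP] : exists b, forall u, L u -> pideal b (beta u (g i)).
    by apply: (lattice_bounded Llat) => *; rewrite ?betaDl ?betaZl.
  exists b => c [/bP]; rewrite beta_lcombl (bigD1 i) //= gP eqxx mulr1 big1 ?addr0 // => j ji.
  by rewrite gP (negbTE ji) mulr0.
exists (fun i => lcomb f (row i G)); split=> [i j|c].
  by rewrite beta_polar !U0 ?subrr ?memvD ?fU.
by rewrite lcomb_mul -GP; split=> [h|[]] //; split=> //; apply: fU.
Qed.

Lemma maximal_structure (L : set V) : maximal_lattice beta L ->
  exists k (x y : 'I_l -> V), [/\ lattice_norm beta L = pideal k, hyperbolic k x y &
                    L = hlattice k x y].
Proof.
move=> Lmax; have [Llat _] := Lmax; have [k Lk] := lattice_norm_ex Llat.
have [x [xx xL]] := isotropic_basis_ex Llat.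
by have [y [hxy LE]] := maximal_hyperbolic Lmax Lk xx xL; exists k, x, y.
Qed.

Lemma hyperbolic_scale k z x y : hyperbolic k x y ->
  hyperbolic (k + z) x (fun i : 'I_l => pi ^ z *: y i).
Proof.
move=> [xx yy xy]; split=> // i j; first by rewrite betaZl betaZr yy !mulr0.
by rewrite betaZr xy expz_pD mulrCA mulrA.
Qed.

Lemma complement_scale z (x y : 'I_l -> V) :
  witt_complement x (fun i => pi ^ z *: y i) = witt_complement x y.
Proof.
apply/seteqP; split=> w Ww i; case: (Ww i) => h1; rewrite betaZr => h2; split=> //.
  by move/eqP: h2; rewrite mulf_eq0 (negbTE (expz_p_neq0 _ _)) /= => /eqP.
by rewrite h2 mulr0.
Qed.

(** Rewriting mu(L) v'_j as O (p^k v'_j) turns the sum in a Witt decomposition into an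
    [hlattice]. *)
Lemma decomposition_set (L : set V) k v v' :
  lattice_norm beta L = pideal k -> hyperbolic 0 v v' ->
  [set x | exists (a b : 'I_l -> F) (w : V),
     [/\ forall j, padic_integers (a j), forall j, lattice_norm beta L (b j),
         witt_L0 L v v' w & x = \sum_j (a j *: v j + b j *: v' j) + w]] =
  hlattice k v (fun i => pi ^ k *: v' i).
Proof.
move=> Lk h0; have := hyperbolic_scale k h0; rewrite add0r; set u := fun i => _ => hk.
have HS := hlattice_submod hk.
apply/seteqP; split=> z.
  move=> [a [b [w [aO bN [Ww Qw] ->]]]]; apply: submodD => //.
    apply: submod_sum => // j _; apply: submodD => //.
      apply: submodZ => //; last by case: (hlattice_mem hk j).
      by case: (aO j) => c _ <-; apply: pideal_frac.
    have -> : b j *: v' j = (b j * pi ^ (- k)) *: u j.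
      by rewrite /u scalerA -mulrA -expz_pD addNr expr0z mulr1.
    apply: submodZ => //; last by case: (hlattice_mem hk j).
    by rewrite mulrC -(addNr k); apply/pideal_scale; rewrite -Lk.
  rewrite Lk in Qw; split=> // i; have [h1 h2] := Ww i.
  by rewrite h1 betaZr h2 mulr0; split; apply: pideal0.
move=> hz; have /(hlatticeP hk)[h Qp] := hz.
exists (fun j => hcoef k z u 0 j), (fun j => pi ^ k * hcoef k z v 0 j), (hproj k v u z).
have cO (g : 'I_l -> V) j : pideal k (beta z (g j)) -> pideal 0 (hcoef k z g 0 j).
  by move=> gj; rewrite mxE -(addNr k); apply/pideal_scale.
split.
- by move=> j; have /pideal0P[c ->] := cO u j (h j).2; exists c.
- by move=> j; have := (pideal_scale k 0 _).2 (cO v j (h j).1); rewrite addr0 Lk.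
- split; last by rewrite Lk.
  by rewrite -(complement_scale k); apply: hproj_complement.
rewrite {1}(hproj_decomp k v u z); congr (_ + _); rewrite -big_split; apply: eq_bigr => j _ /=.
by rewrite scalerA [hcoef k z v 0 j * _]mulrC.
Qed.

Lemma decomposition_hlattice (L : set V) k (v v' : 'I_l -> V) :
  lattice_norm beta L = pideal k -> witt_decomposition L v v' ->
  hyperbolic k v (fun i => pi ^ k *: v' i) /\
  L = hlattice k v (fun i => pi ^ k *: v' i).
Proof.
move=> Lk [vv vv' _ LE].
have h0 : hyperbolic 0 v v'.
  by split=> i j; [case: (vv i j)|case: (vv i j)|rewrite vv' mul1r].
split; first by have := hyperbolic_scale k h0; rewrite add0r.
by rewrite -(decomposition_set Lk h0) -LE.
Qed.

Lemma hlattice_decomposition (L : set V) k (x y : 'I_l -> V) :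
  lattice_norm beta L = pideal k -> hyperbolic k x y -> L = hlattice k x y ->
  witt_decomposition L x (fun i => pi ^ (- k) *: y i).
Proof.
move=> Lk hxy LE; have := hyperbolic_scale (- k) hxy; rewrite subrr => h0.
have [xx yy xy] := h0; split=> [i j|i j|w Ww Qw|].
- by rewrite xx yy.
- by rewrite xy mul1r.
- by apply: (hyperbolic_aniso h0).
rewrite (decomposition_set Lk h0) [LHS]LE; congr (hlattice k x _).
by apply/funext => i; rewrite scalerA -expz_pD subrr scale1r.
Qed.

End MaximalLattices.

(** * Layers of the anisotropic kernel *)

Section Layers.
Variables (p : nat) (p_pr : prime p).
Local Notation O := (padic_int p_pr).
Local Notation F := (padic p_pr).
Local Notation pi := (p%:R : F).
Variables (V : vectType F) (beta : {symmetric V}).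
Local Notation Q := (quad beta).
Local Notation l := (witt_index beta).
Hypothesis nondeg : nondegenerate beta.
Variables (k : int) (x y : 'I_l -> V).
Hypothesis hxy : hyperbolic k x y.
Local Notation W := (witt_complement x y).
Local Notation n0 := (\dim {:V} - 2 * l)%N.

(** The index j counts from the norm exponent k: [layer 0] and [layer 1] are L_0 and L_0^[+1].
    Negative j occur for the W-components of the partners. *)
Definition layer (j : int) : set V := [set w | W w /\ pideal (k + j) (Q w)].

Lemma complement0 : W 0.
Proof. by move=> i; rewrite !beta0l. Qed.
Lemma complement_scaled c w : W w -> W (c *: w).
Proof. by move=> Ww; rewrite -[_ *: _]addr0; apply: complementZ => //; apply: complement0. Qed.
Lemma complementD w w' : W w -> W w' -> W (w + w').
Proof. by move=> Ww Ww'; rewrite -[w]scale1r; apply: complementZ. Qed.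
Lemma complement_lcombW d (f : 'I_d -> V) c : (forall i, W (f i)) -> W (lcomb f c).
Proof.
move=> Wf; rewrite /lcomb; elim/big_ind: _ => [|u v|i _]; first exact: complement0.
  exact: complementD.
exact: complement_scaled.
Qed.

Lemma layer_submod j : submod (layer j).
Proof.
split=> [|w w' [Ww Qw] [Ww' Qw']|c w [Ww Qw]].
- by split; [apply: complement0|rewrite quad_beta0 ?beta0l //; apply: pideal0].
- split; first exact: complementD.
  rewrite quadD; apply: pidealD => //; apply: pidealD => //.
  by apply: (complement_beta hxy Ww Ww' Qw Qw'); lia.
split; first exact: complement_scaled.
by rewrite quadZ; apply: pidealMl => //; rewrite -tofracXn; apply: pideal_frac.
Qed.

Lemma layerW i j : i <= j -> layer j `<=` layer i.
Proof. by move=> ij w [Ww Qw]; split=> //; apply: pidealW Qw; rewrite lerD2l. Qed.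

Lemma layer_scale z j w : layer (z + z + j) (pi ^ z *: w) <-> layer j w.
Proof.
have E : k + (z + z + j) = z + z + (k + j) by lia.
split=> [] [Ww Qw]; split; try exact: complement_scaled.
- rewrite -[w]scale1r -(expr0z pi) -(addNr z) expz_pD -scalerA.
  exact: complement_scaled.
- by move: Qw; rewrite quadpZ E => /pideal_scale.
- by rewrite quadpZ E; apply/pideal_scale.
Qed.

Lemma layer_absorbing j w : W w -> exists s, layer j (pi ^ s *: w).
Proof.
move=> Ww; have [a aP] := pideal_ex (Q w).
pose s : int := (`|k| + `|j| + `|a|)%N; exists s; split; first exact: complement_scaled.
by rewrite quadpZ; apply: (@pidealW _ _ _ (s + s + a)); [lia|apply/pideal_scale].
Qed.

Let Phi (z : V) : 'rV[F]_(l + l) :=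
  row_mx (\row_i beta z (x i)) (\row_i beta z (y i)).

Fact Phi_linear : linear Phi.
Proof.
move=> c u v; rewrite /Phi scale_row_mx add_row_mx; congr row_mx;
by apply/rowP => i; rewrite !mxE betaDl betaZl.
Qed.
HB.instance Definition _ := GRing.isLinear.Build F V 'rV[F]_(l + l) _ Phi Phi_linear.

Lemma PhiP z : Phi z = 0 <-> W z.
Proof.
split=> [Pz i|Wz].
  split.
    by have := congr1 (fun r : 'rV_(l + l) => r 0 (lshift l i)) Pz; rewrite row_mxEl !mxE.
  by have := congr1 (fun r : 'rV_(l + l) => r 0 (rshift l i)) Pz; rewrite row_mxEr !mxE.
rewrite /Phi -[RHS]row_mx0; congr row_mx; apply/rowP => i; rewrite !mxE; by case: (Wz i).
Qed.

(** W is the kernel of the pairing map V -> F^(2l), which is onto because the crossed coordinates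
    provide a preimage; rank-nullity gives its dimension. *)
Lemma complement_basis : (2 * l <= \dim {:V})%N /\
  exists f : 'I_n0 -> V, [/\ forall w, W w -> exists c, w = lcomb f c,
    forall i, W (f i) & forall c, lcomb f c = 0 -> c = 0].
Proof.
pose g : 'Hom(V, 'rV[F]_(l + l)) := linfun Phi.
have gE z : g z = Phi z by rewrite lfunE.
have gf : (g @: fullv)%VS = fullv.
  apply/vspaceP => r; rewrite memvf; apply/memv_imgP.
  exists (lcomb x (pi ^ (- k) *: rsubmx r) + lcomb y (pi ^ (- k) *: lsubmx r)); first exact: memvf.
  rewrite gE /Phi -[LHS]hsubmxK; congr row_mx; apply/rowP => i; rewrite [RHS]mxE betaDl ![beta (lcomb _ _) _]betaC.
    rewrite (beta_x_lcomb_x hxy) (beta_x_lcomb_y hxy) add0r [in RHS]mxE mulrA -expz_pD subrr.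
    by rewrite mul1r.
  rewrite (beta_y_lcomb_x hxy) (beta_y_lcomb_y hxy) addr0 [in RHS]mxE mulrA -expz_pD subrr.
  by rewrite mul1r.
have dimg : (\dim (lker g) + 2 * l = \dim {:V})%N.
  rewrite -(limg_ker_dim g fullv) capfv gf; congr addn.
  by rewrite dimvf /dim /= mul1n mul2n addnn.
split; first by rewrite -dimg leq_addl.
have dk : \dim (lker g) = n0 by rewrite -dimg addnK.
have [X XU] : exists X : n0.-tuple V, basis_of (lker g) X.
  by rewrite -dk; exists (vbasis (lker g)); apply: vbasisP.
exists (fun i : 'I_n0 => X`_i); split=> [w Ww|i|c c0].
- have wU : w \in lker g by rewrite memv_ker gE; apply/eqP/PhiP.
  exists (\row_i coord X i w); rewrite {1}(coord_basis XU wU).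
  by apply: eq_bigr => i _; rewrite mxE.
- have : X`_i \in lker g by apply: (basis_mem XU); apply: mem_nth; rewrite size_tuple.
  by rewrite memv_ker gE => /eqP/PhiP.
- apply/rowP => i; have /freeP fb := basis_free XU.
  by rewrite mxE; exact: (fb (fun i => c 0 i) c0 i).
Qed.

Lemma layer_basis j : exists e : 'I_n0 -> V,
  [/\ forall w, W w -> exists c, w = lcomb e c, forall i, W (e i),
      forall c, lcomb e c = 0 -> c = 0 &
      forall c : 'rV[F]_n0, layer j (lcomb e c) <-> forall i, pideal 0 (c 0 i)].
Proof.
have [_ [f [fW Wf finj]]] := complement_basis.
have [g gP] := dual_family nondeg finj.
have [|i|i|G Gu GP] := @submod_basis p p_pr V n0 f _ (layer_submod j).
- by move=> w [/fW].
- exact: layer_absorbing.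
- have [a aP] := pideal_ex (Q (hproj k x y (g i))).
  pose z : int := - (`|k| + `|j| + `|a|)%N%:Z; exists z => c [Wc Qc].
  have -> : c 0 i = beta (lcomb f c) (hproj k x y (g i)).
    transitivity (beta (lcomb f c) (g i)).
      rewrite beta_lcombl (bigD1 i) //= gP eqxx mulr1 big1 ?addr0 // => j' ji.
      by rewrite gP (negbTE ji) mulr0.
    by rewrite {1}(hproj_decomp k x y (g i)) betaDr complement_lcomb // add0r.
  by apply: (complement_beta hxy Wc (hproj_complement hxy _) Qc aP); rewrite /z; lia.
exists (fun i => lcomb f (row i G)); split.
- move=> w /fW[c ->]; exists (c *m invmx G); by rewrite lcomb_mul mulmxKV.
- by move=> i; apply: complement_lcombW.
- move=> c; rewrite lcomb_mul => /finj cG.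
  by rewrite -[c](mulmxK Gu) cG mul0mx.
- by move=> c; rewrite lcomb_mul; apply: GP.
Qed.

Lemma layer_subgroup j : subgroup (layer j).
Proof. exact/submod_subgroup/layer_submod. Qed.

Let ffcomb d (e : 'I_d -> V) (c : {ffun 'I_d -> F}) : V := \sum_i c i *: e i.
Let ffcombE d (e : 'I_d -> V) (c : {ffun 'I_d -> F}) : ffcomb e c = lcomb e (\row_i c i).
Proof. by apply: eq_bigr => i _; rewrite mxE. Qed.
Let ffcombB d (e : 'I_d -> V) : {morph ffcomb e : c c' / c - c'}.
Proof.
move=> c c'; rewrite -sumrB; apply: eq_bigr => i _.
by rewrite !ffunE scalerBl.
Qed.

Lemma has_index_comb d (e : 'I_d -> V) (a b : 'I_d -> int) (c : 'I_d -> nat) :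
  (forall c, lcomb e c = 0 -> c = 0) -> (forall i, b i = a i + (c i)%:Z) ->
  has_index [set lcomb e r | r in [set r : 'rV[F]_d | forall i, pideal (a i) (r 0 i)]]
    [set lcomb e r | r in [set r : 'rV[F]_d | forall i, pideal (b i) (r 0 i)]]
    (\prod_i p ^ c i).
Proof.
move=> einj ab.
have E (z : 'I_d -> int) :
    [set lcomb e r | r in [set r : 'rV[F]_d | forall i, pideal (z i) (r 0 i)]] =
    ffcomb e @` [set f : {ffun 'I_d -> F} | forall i, pideal (z i) (f i)].
  apply/seteqP; split=> _ [r rz <-].
    exists [ffun i => r 0 i]; first by move=> i; rewrite ffunE.
    by rewrite ffcombE; congr lcomb; apply/rowP => i; rewrite mxE ffunE.
  by exists (\row_i r i); [move=> i; rewrite mxE|rewrite ffcombE].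
rewrite !E; apply: has_index_image; first exact: ffcombB.
  move=> c1 c2 /eqP; rewrite -subr_eq0 -ffcombB ffcombE => /eqP/einj/rowP c0.
  by apply/ffunP => i; apply/eqP; have := c0 i; rewrite !mxE !ffunE => /eqP; rewrite subr_eq0.
apply: (@has_index_ffun F 'I_d (fun i => pideal (a i)) (fun i => pideal (b i))) => i.
by rewrite ab; apply: has_index_pideal.
Qed.

(** Multiplication by p multiplies Q by p^2 and maps [layer j] onto [layer (j + 2)], so the index is
    that of p O^n0 in O^n0. *)
Lemma layer_index2 j : has_index (layer j) (layer (1 + 1 + j)) (p ^ n0).
Proof.
have [e [eW We einj eP]] := layer_basis j.
have -> : layer j = [set lcomb e r | r in [set r : 'rV[F]_n0 | forall i, pideal 0 (r 0 i)]].
  apply/seteqP; split=> [w lw|_ [r rO <-]]; last exact/eP.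
  have [c wE] := eW _ lw.1; exists c => //; by apply/eP; rewrite -wE.
have -> : layer (1 + 1 + j) = [set lcomb e r | r in [set r : 'rV[F]_n0 | forall i, pideal 1 (r 0 i)]].
  have E c : layer (1 + 1 + j) (lcomb e c) <-> forall i, pideal 1 (c 0 i).
    have -> : lcomb e c = pi ^ 1 *: lcomb e (pi ^ (-1) *: c).
      by rewrite lcombZ scalerA -expz_pD subrr scale1r.
    rewrite layer_scale eP; split=> h i; have := h i; rewrite mxE.
      by move=> /(pideal_scale 1); rewrite addr0 mulrA -expz_pD subrr mul1r.
    by move=> h'; apply/(pideal_scale 1); rewrite addr0 mulrA -expz_pD subrr mul1r.
  apply/seteqP; split=> [w lw|_ [r rO <-]]; last exact/E.
  have [c wE] := eW _ lw.1; exists c => //; by apply/E; rewrite -wE.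
have <- : (\prod_(i < n0) p ^ 1 = p ^ n0)%N by rewrite prod_nat_const card_ord expn1.
exact: has_index_comb.
Qed.

Definition layer_exp (d : nat) (j : int) : nat := if odd `|j|%N then (n0 - d)%N else d.

(** Two consecutive indices multiply to p^n0, so the first determines the second; every other layer
    is [layer 0] or [layer 1] multiplied by a power of p. *)
Lemma layer_index1 d : has_index (layer 0) (layer 1) (p ^ d) ->
  (d <= n0)%N /\ forall j, has_index (layer j) (layer (j + 1)) (p ^ layer_exp d j).
Proof.
move=> h01; have h02 := layer_index2 0.
have [m h12] : exists m, has_index (layer 1) (layer (1 + 1 + 0)) m.
  by apply: has_index_sub h02; [apply: layer_subgroup|apply: layerW..].
have s01 : layer 1 `<=` layer 0 by apply: layerW.
have s12 : layer (1 + 1 + 0) `<=` layer 1 by apply: layerW.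
have h02' := has_index_trans (layer_subgroup 0) (layer_subgroup 1)
  (layer_subgroup (1 + 1 + 0)) s01 s12 h01 h12.
have E := has_index_uniq (layer_subgroup _) h02 h02'.
have dn : (d <= n0)%N.
  by rewrite -(dvdn_Pexp2l _ _ (prime_gt1 p_pr)) E dvdn_mulr.
split=> // j.
have mE : m = (p ^ (n0 - d))%N.
  apply/eqP; rewrite -(eqn_pmul2l (_ : 0 < p ^ d)%N) ?expn_gt0 ?prime_gt0 //.
  by rewrite -E -expnD subnKC.
have sc z i n : has_index (layer i) (layer (i + 1)) n ->
    has_index (layer (z + z + i)) (layer (z + z + i + 1)) n.
  have Es i' : layer (z + z + i') = (fun w => pi ^ z *: w) @` layer i'.
    apply/seteqP; split=> [w lw|_ [w lw <-]]; last exact/layer_scale.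
    exists (pi ^ (- z) *: w); last by rewrite scalerA -expz_pD subrr scale1r.
    by apply/(layer_scale z); rewrite scalerA -expz_pD subrr scale1r.
  rewrite -[z + z + i + 1]addrA !Es; apply: has_index_image => [u v|u v]; first by rewrite scalerBr.
  by move=> /scalerI; apply; apply: expz_p_neq0.
have := odd_double_half `|j|%N; rewrite /layer_exp; case: ifP => oj /= jE.
  have -> : j = ((j - 1) %/ 2)%Z + ((j - 1) %/ 2)%Z + 1 by lia.
  by apply: sc; rewrite -mE.
have -> : j = (j %/ 2)%Z + (j %/ 2)%Z + 0 by lia.
by apply: sc; rewrite add0r.
Qed.

Definition layer_sum d (j : int) (c : nat) : nat := \sum_(i < c) layer_exp d (j + i%:Z).

Lemma layer_index d j c : has_index (layer 0) (layer 1) (p ^ d) ->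
  has_index (layer j) (layer (j + c%:Z)) (p ^ layer_sum d j c).
Proof.
move=> /layer_index1[_ h1]; elim: c => [|c IHc].
  rewrite /layer_sum big_ord0 addr0 expn0; exists (fun=> 0); split=> [_|w lw].
    by case: (layer_subgroup j).
  exists ord0; split=> [|i _]; first by rewrite subr0.
  by apply: val_inj; case: i => -[].
rewrite /layer_sum big_ord_recr /= expnD.
have -> : j + c.+1%:Z = j + c%:Z + 1 by lia.
apply: has_index_trans IHc (h1 _); try exact: layer_subgroup.
  by apply: layerW; lia.
by apply: layerW; lia.
Qed.

Lemma Fp_quotient_dim_index d :
  Fp_quotient_dim (layer 0) (layer 1) d -> has_index (layer 0) (layer 1) (p ^ d).
Proof.
move=> [e [le eP]]; have <- : #|{ffun 'I_d -> 'I_p}| = (p ^ d)%N.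
  by rewrite card_ffun !card_ord.
apply: (has_index_fin (r := fun c : {ffun 'I_d -> 'I_p} => \sum_i (c i : nat)%:R *: e i)) => [c|w /eP//].
apply: submod_sum => [|i _]; first exact: layer_submod.
apply: submodZ => //; first exact: layer_submod.
by apply/pideal0P; exists (c i : nat)%:R; rewrite tofrac_nat.
Qed.

(** [layer 1] contains p times [layer 0], so its elementary divisors in [layer 0] are 1 or p. The
    basis vectors with divisor p, indexed by D, induce a basis of the quotient. *)
Lemma Fp_quotient_dim_ex : exists d, Fp_quotient_dim (layer 0) (layer 1) d.
Proof.
have [e [eW We einj eP]] := layer_basis 0.
pose M : set 'rV[O]_n0 := [set r | layer 1 (lcomb e (map_mx (@tofrac O) r))].
have l1 := layer_submod 1.
have MS : Osubmod M.
  split=> [|r r'|c r]; rewrite /M /=.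
  - by rewrite map_mx0 lcomb0; case: l1.
  - by move=> h h'; rewrite map_mxD lcombD; apply: submodD.
  - by move=> h; rewrite map_mxZ lcombZ; case: l1 => _ _; apply.
have Mm r : M (p%:R ^+ 1 *: r).
  rewrite /M /= map_mxZ lcombZ rmorphXn rmorph_nat exprnP.
  apply: (@layerW 1 (1 + 1 + 0)) => //; apply/layer_scale/eP => i.
  by rewrite mxE; apply: pideal_frac.
have [E [a [Eu ah a1 EP]]] := smith_normal_form MS Mm.
pose D := [set i : 'I_n0 | a i == 1%N]%SET.
have aD i : a i = (i \in D) :> nat.
  by rewrite inE; have := a1 i; case: (a i) => [|[|]].
pose b i := lcomb e (map_mx (@tofrac O) (row i E)).
exists #|D|, (fun t => b (enum_val t)); split=> [t|w lw].
  by apply/eP => i; rewrite !mxE; apply: pideal_frac.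
have [c wE] := eW _ lw.1; have /eP cO : layer 0 (lcomb e c) by rewrite -wE.
have /(_ _)/cid ex i := (pideal0P _).1 (cO i).
pose r : 'rV[O]_n0 := \row_i projT1 (ex i).
have cr : c = map_mx (@tofrac O) r by apply/rowP => i; rewrite !mxE; case: (ex i).
pose z := r *m invmx E.
have dig (t : 'I_#|D|) := padic_digit (z 0 (enum_val t)) 1.
have key (f : {ffun 'I_#|D| -> 'I_p}) :
    layer 1 (w - \sum_i (f i : nat)%:R *: b (enum_val i)) <->
    forall t : 'I_#|D|, pdvd 1 (z 0 (enum_val t) - (f t : nat)%:R).
  pose s : 'rV[O]_n0 := \sum_t (f t : nat)%:R *: delta_mx 0 (enum_val t).
  have sE (i : 'I_n0) : s 0 i = \sum_t (f t : nat)%:R * (i == enum_val t)%:R.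
    by rewrite summxE; apply: eq_bigr => t _; rewrite !mxE eqxx.
  have -> : w - \sum_i (f i : nat)%:R *: b (enum_val i) =
      lcomb e (map_mx (@tofrac O) ((z - s) *m E)).
    rewrite mulmxBl mulmxKV // map_mxB lcombD lcombN -cr -wE; congr (_ - _).
    rewrite mulmx_suml map_mx_sum.
    have -> : forall (I : finType) (g : I -> 'rV[F]_n0),
        lcomb e (\sum_i g i) = \sum_i lcomb e (g i).
      by move=> I g; elim/big_ind2: _ => [|? ? ? ? <- <-|//]; rewrite ?lcomb0 ?lcombD.
    apply: eq_bigr => t _; rewrite -scalemxAl -rowE map_mxZ lcombZ rmorph_nat.
    by [].
  have sV (t : 'I_#|D|) : s 0 (enum_val t) = (f t : nat)%:R.
    rewrite sE (bigD1 t) //= eqxx mulr1 big1 ?addr0 // => t' t't.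
    by rewrite (inj_eq enum_val_inj) eq_sym (negbTE t't) mulr0.
  have zsE i : (z - s) 0 i = z 0 i - s 0 i by rewrite [LHS]mxE [(- s) 0 i]mxE.
  rewrite -[layer 1 _]/(M _) EP; split=> h t.
    by have := h (enum_val t); rewrite aD enum_valP zsE sV.
  rewrite aD zsE; case: (boolP (t \in D)) => [tD|_] /=; last exact: pdvd0n.
  by have := h (enum_rank_in tD t); rewrite -sV enum_rankK_in.
have Ep : (p ^ 1)%N = p := expn1 p.
pose f0 : {ffun 'I_#|D| -> 'I_p} := [ffun t => cast_ord Ep (projT1 (cid (dig t)))].
exists f0; split.
  by apply/key => t; rewrite ffunE /=; case: cid => j [].
move=> f /key fP; apply/ffunP => t; rewrite ffunE; case: cid => j [_ jU] /=.
by rewrite (jU (cast_ord (esym Ep) (f t)) (fP t)); apply: val_inj.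
Qed.

End Layers.

(** * Lattices of given type modulo p^N *)

Local Close Scope classical_set_scope.

Section TriangularCount.
Variable F : finFieldType.
Local Notation q := #|F|.
Variables (l : nat) (n : nat -> nat).
Hypothesis n_homo : {homo n : i j / (i <= j)%N}.
Hypothesis n_le : forall k, (k < l)%N -> (n k <= l)%N.

Lemma card_supported_rows c : (c <= l)%N ->
  #|[set v : 'rV[F]_l | [forall j : 'I_l, (c <= j)%N ==> (v 0 j == 0)]]| = (q ^ c)%N.
Proof.
move=> cl; pose f (u : 'rV[F]_c) : 'rV[F]_l :=
  \row_j (if insub (j : nat) is Some i then u 0 i else 0).
have finj : injective f.
  move=> u u' /rowP uu'; apply/rowP => i; have := uu' (widen_ord cl i).
  by rewrite !mxE /= insubT //= => ic; rewrite (_ : Sub _ _ = i) //; apply: val_inj.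
rewrite -[c in RHS]mul1n -card_mx -cardsT -(card_imset _ finj); apply: fintype.eq_card => v; rewrite inE.
apply/forallP/imsetP => [vc|[u _ ->] j]; last first.
  by apply/implyP => cj; rewrite mxE insubN // -leqNgt.
exists (\row_i v 0 (widen_ord cl i)); rewrite ?inE //; apply/rowP => j; rewrite !mxE.
case: insubP => [i ic ij|]; first by rewrite mxE; congr (v _ _); apply: val_inj.
by rewrite -leqNgt => cj; have /implyP/(_ cj)/eqP := vc j.
Qed.

(* Row i of a k-row matrix carries the constraint of index k-1-i, so that the
   last chosen row is on top. *)
Definition tri_rows k (A : 'M[F]_(k, l)) : bool :=
  [forall i : 'I_k, forall j : 'I_l, (n (k.-1 - i) <= j)%N ==> (A i j == 0)].

(** The new top row has n k free coordinates, hence q^(n k) values. As n is nondecreasing, the span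
    of the k earlier rows lies among them, and its q^k vectors are excluded. *)
Lemma card_triangular_free k : (k <= l)%N ->
  #|[set A : 'M[F]_(k, l) | row_free A && tri_rows A]| =
  (\prod_(i < k) (q ^ n i - q ^ i))%N.
Proof.
elim: k => [_|k IHk kl].
  rewrite big_ord0 (@fintype.eq_card1 _ (0 : 'M_(0, l))) // => A.
  rewrite flatmx0 !inE eqxx /row_free mxrank0 eqxx /=.
  by apply/forallP => -[].
rewrite big_ord_recr /= -IHk; last exact: ltnW.
have idx (i : 'I_k) : ((1 + k).-1 - rshift 1 i = k.-1 - i)%N.
  by rewrite /=; have := ltn_ord i; lia.
have Ccol (v : 'rV[F]_l) (A : 'M[F]_(k, l)) : tri_rows (col_mx v A) =
    [forall j : 'I_l, (n k <= j)%N ==> (v 0 j == 0)] && tri_rows A.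
  apply/forallP/andP => [h|[/forallP hv /forallP hA] i].
    split; first by apply/forallP => j; have /forallP/(_ j) := h (lshift k 0); rewrite col_mxEu /= subn0.
    apply/forallP => i; apply/forallP => j; have /forallP/(_ j) := h (rshift 1 i).
    by rewrite col_mxEd idx.
  apply/forallP => j; case: (split_ordP i) => i' ->.
    by rewrite col_mxEu ord1 /= subn0; apply: hv.
  by rewrite col_mxEd idx; have /forallP/(_ j) := hA i'.
have freecol (v : 'rV[F]_l) (A : 'M[F]_(k, l)) : row_free (col_mx v A) =
    row_free A && ~~ (v <= A)%MS.
  rewrite /row_free -addsmxE; have [vA|vA] := boolP (v <= A)%MS.
    rewrite (addsmx_idPr vA) andbF; apply/negbTE.
    by rewrite neq_ltn add1n ltnS rank_leq_row.
  have v1 : \rank v = 1%N.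
    by apply/eqP; rewrite eqn_leq rank_leq_row lt0n mxrank_eq0; apply: contraNneq vA => ->; rewrite sub0mx.
  rewrite andbT; have := mxrank_sum_cap v A; rewrite v1.
  suff -> : \rank (v :&: A)%MS = 0%N by rewrite addn0 => ->; rewrite eqn_add2l.
  have : (\rank (v :&: A)%MS < \rank v)%N.
    by rewrite (ltn_leqif (mxrank_leqif_sup (capmxSl _ _))) sub_capmx submx_refl.
  by rewrite v1 ltnS leqn0 => /eqP.
rewrite -sum_nat_const -[k.+1]/(1 + k)%N -sum1_card.
rewrite (partition_big (@dsubmx F 1 k l)
   (mem [set A : 'M[F]_(k, l) | row_free A && tri_rows A])) /=; last first.
  move=> A; rewrite -[A](@vsubmxK _ 1 k) col_mxKd !inE freecol Ccol.
  by case/andP=> /andP[-> _] /andP[_ ->].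
apply: eq_bigr => A; rewrite inE => /andP[Af AC].
rewrite (reindex (fun v => col_mx v A)) /=; last first.
  exists usubmx => [v _|vA]; first by rewrite col_mxKu.
  by case/andP=> _ /eqP <-; rewrite vsubmxK.
pose S := [set v : 'rV[F]_l | [forall j : 'I_l, (n k <= j)%N ==> (v 0 j == 0)]].
pose T := [set v *m A | v in 'rV[F]_k].
have TS : T \subset S.
  apply/fintype.subsetP => _ /imsetP[v _ ->]; rewrite inE; apply/forallP => j; apply/implyP => nj.
  rewrite mxE big1 // => i _; have /forallP/(_ i)/forallP/(_ j)/implyP := AC.
  have ni : (n (k.-1 - i) <= j)%N by apply: leq_trans nj; apply: n_homo; lia.
  by move=> /(_ ni)/eqP->; rewrite mulr0.
transitivity #|S :\: T|; last first.
  rewrite cardsD (finset.setIidPr TS) card_supported_rows ?n_le // card_imset ?card_mx ?mul1n //.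
  have [B AB1] := row_freeP Af; apply: can_inj (mulmx^~ B) _ => v.
  by rewrite -mulmxA AB1 mulmx1.
rewrite -sum1_card; apply: eq_bigl => v; rewrite !inE col_mxKd eqxx andbT freecol Ccol Af AC /= andbT.
congr (~~ _ && _); apply/idP/imsetP => [/submxP[u ->]|[u _ ->]]; first by exists u.
exact: submxMl.
Qed.

Lemma card_triangular_unit :
  #|[set A : 'M[F]_l | (A \in unitmx) &&
      [forall i : 'I_l, forall j : 'I_l, (n i <= j)%N ==> (A i j == 0)]]| =
  (\prod_(i < l) (q ^ n i - q ^ i))%N.
Proof.
rewrite -card_triangular_free //.
(* Reversing the rows restores the natural order of the constraints, which [tri_rows] lists
   backwards. *)
pose s : {perm 'I_l} := perm rev_ord_inj.
have ss : involutive (row_perm (R := F) (n := l) s).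
  by move=> A; apply/matrixP => i j; rewrite !mxE !permE rev_ordK.
rewrite -[RHS](card_imset _ (inv_inj ss)); apply: fintype.eq_card => A.
rewrite inE -[in RHS](ss A) (mem_imset _ _ (inv_inj ss)) inE; congr (_ && _).
  by rewrite row_permE row_free_unit unitmx_mul unitmx_perm.
apply/forallP/forallP => h i; apply/forallP => j; have /forallP/(_ j) := h (rev_ord i).
  rewrite mxE permE /= (_ : (l - i.+1)%N = (l.-1 - i)%N) //.
  by have := ltn_ord i; lia.
rewrite mxE permE rev_ordK /=.
by rewrite (_ : (l.-1 - (l - i.+1))%N = i) //; have := ltn_ord i; lia.
Qed.

End TriangularCount.

(** * Submodules of (Z/p^N)^l with given elementary divisors *)

Section ZpMatrices.
Variables (p : nat) (p_pr : prime p) (N : nat).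
Hypothesis N_gt0 : (0 < N)%N.
Local Notation R := 'Z_(p ^ N).
Local Notation F := 'F_p.

(** ['Z_(p ^ N)] is the ring Z/p^N only for p^N > 1. The application takes N = m + 1, so that m = 0
    is covered. *)
Let pN1 : (1 < p ^ N)%N. Proof. by rewrite -(expn0 p) ltn_exp2l ?prime_gt1. Qed.

Lemma Zp_nat_val (x : R) : (x : nat)%:R = x.
Proof. by rewrite natr_Zp. Qed.

Lemma val_Zp_nat' k : ((k%:R : R) : nat) = (k %% p ^ N)%N.
Proof. by rewrite val_Zp_nat. Qed.

Definition red (x : R) : F := (x : nat)%:R.

Lemma red_nat k : red k%:R = k%:R.
Proof.
rewrite /red val_Zp_nat'; apply: val_inj; rewrite /= !val_Fp_nat //.
by rewrite modn_dvdm // dvdn_exp.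
Qed.

Fact red_zmod : zmod_morphism red.
Proof.
move=> x y; apply/eqP; rewrite eq_sym subr_eq; apply/eqP.
have h (u v : R) : red (u + v) = red u + red v.
  by rewrite -{1}(Zp_nat_val u) -{1}(Zp_nat_val v) -natrD red_nat natrD.
by rewrite -h subrK.
Qed.
HB.instance Definition _ := GRing.isZmodMorphism.Build R F red red_zmod.
Fact red_monoid : monoid_morphism red.
Proof.
split=> [|x y]; first exact: (red_nat 1).
by rewrite -{1}(Zp_nat_val x) -{1}(Zp_nat_val y) -natrM red_nat natrM.
Qed.
HB.instance Definition _ := GRing.isMonoidMorphism.Build R F red red_monoid.

Definition dvr (c : nat) (x : R) : bool := (p ^ c %| (x : nat))%N.

Lemma dvr_nat c k : (c <= N)%N -> dvr c k%:R = (p ^ c %| k)%N.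
Proof. by move=> cN; rewrite /dvr val_Zp_nat' /dvdn modn_dvdm // dvdn_exp2l. Qed.
Lemma dvrD c x y : (c <= N)%N -> dvr c x -> dvr c y -> dvr c (x + y).
Proof.
move=> cN; rewrite -(Zp_nat_val x) -(Zp_nat_val y) -natrD !dvr_nat // => ? ?.
by rewrite dvdn_add.
Qed.
Lemma dvrMl c x y : (c <= N)%N -> dvr c x -> dvr c (x * y).
Proof.
move=> cN; rewrite -(Zp_nat_val x) -(Zp_nat_val y) -natrM !dvr_nat // => ?.
by rewrite dvdn_mulr.
Qed.
Lemma dvr0 c : dvr c 0. Proof. by rewrite /dvr dvdn0. Qed.
Lemma dvr_sum c (I : finType) (f : I -> R) : (c <= N)%N ->
  (forall i, dvr c (f i)) -> dvr c (\sum_i f i).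
Proof.
by move=> cN fc; elim/big_ind: _ => // [|x y]; [apply: dvr0|apply: dvrD].
Qed.
Lemma dvr_pM a b x : (b <= N)%N -> dvr b ((p ^ a)%:R * x) = dvr (b - a) x.
Proof.
move=> bN; rewrite -{1}(Zp_nat_val x) -natrM dvr_nat // /dvr.
have [ab|/ltnW ba] := leqP a b.
  by rewrite -{1}(subnKC ab) expnD dvdn_pmul2l // expn_gt0 prime_gt0.
have -> : (b - a = 0)%N by apply/eqP.
by rewrite expn0 dvd1n dvdn_mulr // dvdn_exp2l.
Qed.
Lemma dvr_mul c x : (c <= N)%N -> dvr c x -> exists y, x = (p ^ c)%:R * y.
Proof.
move=> cN /dvdnP[k xE]; exists k%:R; rewrite -natrM mulnC -xE.
by rewrite Zp_nat_val.
Qed.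
Lemma red_eq0 x : (red x == 0) = dvr 1 x.
Proof. by rewrite /red /dvr expn1 -(Fp_nat_mod p_pr) -val_eqE /= val_Fp_nat // modn_mod. Qed.

Lemma unit_red x : (x \is a GRing.unit) = (red x != 0).
Proof.
rewrite red_eq0 -{1}(Zp_nat_val x) unitZpE // coprime_pexpl //.
by rewrite prime_coprime // /dvr expn1.
Qed.

Lemma card_dvr c : (c <= N)%N -> #|[set x : R | dvr c x]| = (p ^ (N - c))%N.
Proof.
move=> cN; have p0 : (0 < p)%N := prime_gt0 p_pr.
pose f (k : 'I_(p ^ (N - c))) : R := (k * p ^ c)%:R.
have fv k : (f k : nat) = (k * p ^ c)%N.
  rewrite /f val_Zp_nat' modn_small // -[in X in (_ < X)%N](subnK cN) expnD.
  by rewrite ltn_pmul2r ?expn_gt0 ?p0.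
have finj : injective f.
  move=> k k' /(congr1 (fun x : R => x : nat)); rewrite !fv => /eqP.
  by rewrite eqn_pmul2r ?expn_gt0 ?p0 // => /eqP/val_inj.
rewrite -[RHS]card_ord -cardsT -(card_imset _ finj); apply: fintype.eq_card => x.
rewrite inE; apply/idP/imsetP => [/dvdnP[k xE]|[k _ ->]]; last by rewrite /dvr fv dvdn_mull.
have kN : (k < p ^ (N - c))%N.
  rewrite -(@ltn_pmul2r (p ^ c)) ?expn_gt0 ?p0 // -expnD subnK // -xE.
  by rewrite -[X in (_ < X)%N](Zp_cast pN1).
by exists (Ordinal kN); rewrite ?inE //; apply: val_inj; rewrite /= fv xE.
Qed.

Lemma card_red (y : F) : #|[set x : R | red x == y]| = (p ^ N.-1)%N.
Proof.
have p0 : (0 < p)%N := prime_gt0 p_pr.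
pose x0 : R := (y : nat)%:R.
have rx0 : red x0 = y by rewrite red_nat natr_Zp.
rewrite -subn1 -card_dvr // -[RHS](card_imset _ (addrI x0)); apply: fintype.eq_card => x.
rewrite inE; apply/eqP/imsetP => [xy|[z]].
  exists (x - x0); last by rewrite addrC subrK.
  by rewrite inE -red_eq0 raddfB /= xy rx0 subrr.
by rewrite inE -red_eq0 => /eqP z0 ->; rewrite raddfD /= z0 rx0 addr0.
Qed.

Lemma card_mx_family (T : finType) l (P : 'I_l -> 'I_l -> {set T}) :
  #|[set g : 'M[T]_l | [forall i, forall j, g i j \in P i j]]| = (\prod_i \prod_j #|P i j|)%N.
Proof.
pose f (g : {ffun 'I_l * 'I_l -> T}) : 'M[T]_l := \matrix_(i, j) g (i, j).
have finj : injective f.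
  by move=> g h /matrixP gh; apply/ffunP => -[i j]; have := gh i j; rewrite !mxE.
have -> : (\prod_i \prod_j #|P i j|)%N =
    #|family (fun ij : 'I_l * 'I_l => mem (P ij.1 ij.2))|.
  by rewrite card_family foldrE big_map big_enum pair_big.
rewrite -[RHS](card_imset _ finj); apply: fintype.eq_card => g; rewrite inE; apply/idP/imsetP => [gP|[h /familyP hP ->]].
  exists [ffun ij => g ij.1 ij.2]; last by apply/matrixP => i j; rewrite mxE ffunE.
  by apply/familyP => -[i j]; rewrite ffunE; have /forallP/(_ i)/forallP/(_ j) := gP.
by apply/forallP => i; apply/forallP => j; rewrite mxE; apply: (hP (i, j)).
Qed.

Section Types.
Variable l : nat.
Implicit Types (a b : 'I_l -> nat) (g : 'M[R]_l).

Definition diagset a : {set 'rV[R]_l} := [set x : 'rV[R]_l | [forall i, dvr (a i) (x 0 i)]].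
Definition latset a g : {set 'rV[R]_l} := [set x *m g | x in diagset a].
Definition Lat a : {set {set 'rV[R]_l}} := [set latset a g | g in [set g | g \in unitmx]].
(** The stabilizer of [diagset a] in GL_l, by [stabP]; the divisibility conditions allow it to be
    counted entry by entry. *)
Definition stab a : {set 'M[R]_l} :=
  [set g | (g \in unitmx) && [forall i, forall j, dvr (a j - a i) (g i j)]].

Lemma latset_sub a b g : (forall i, (b i <= N)%N) -> (forall i, (a i <= N)%N) ->
  (latset a g \subset diagset b) = [forall i, forall j, dvr (b j - a i) (g i j)].
Proof.
move=> bN aN; apply/fintype.subsetP/forallP => [sub i|h _ /imsetP[x xa ->]].
  apply/forallP => j.
  have : ((p ^ a i)%:R *: delta_mx 0 i : 'rV[R]_l) *m g \in diagset b.
    apply: sub; apply: imset_f; rewrite inE; apply/forallP => j'.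
    rewrite !mxE eqxx /=; case: eqP => [->|_]; rewrite ?mulr0 ?dvr0 // mulr1.
    by rewrite dvr_nat.
  rewrite inE => /forallP/(_ j); rewrite -scalemxAl -rowE !mxE.
  by rewrite dvr_pM.
rewrite inE; apply/forallP => j; rewrite mxE; apply: dvr_sum => // i.
move: xa; rewrite inE => /forallP/(_ i)/(dvr_mul (aN i))[y ->].
rewrite -mulrA dvr_pM // mulrC; apply: dvrMl; first by rewrite (leq_trans (leq_subr _ _)).
by have /forallP := h i.
Qed.

Lemma latset1 a : latset a 1%:M = diagset a.
Proof.
by apply/setP => x; apply/imsetP/idP => [[y ya ->]|xa]; [|exists x]; rewrite ?mulmx1.
Qed.

Lemma latsetM a g h : latset a (g *m h) = [set x *m h | x in latset a g].
Proof.
apply/setP => x; apply/imsetP/imsetP => [[y ya ->]|[_ /imsetP[y ya ->] ->]].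
  by exists (y *m g); rewrite ?mulmxA //; apply: imset_f.
by exists y; rewrite ?mulmxA.
Qed.

Lemma mulmx_unit_inj g : g \in unitmx -> injective (fun x : 'rV[R]_l => x *m g).
Proof. by move=> gu; apply: can_inj (mulmx^~ (invmx g)) _ => x; rewrite mulmxK. Qed.

Lemma stabP a g : (forall i, (a i <= N)%N) -> g \in unitmx ->
  (g \in stab a) = (latset a g == diagset a).
Proof.
move=> aN gu; rewrite inE gu /= -latset_sub // eqEcard.
by rewrite [#|latset _ _|](card_imset _ (mulmx_unit_inj gu)) leqnn andbT.
Qed.

(** Orbit-stabilizer formula: the g that give the same module as g0 form the coset of g0 under
    [stab a]. *)
Lemma card_unit_Lat a : (forall i, (a i <= N)%N) ->
  #|[set g : 'M[R]_l | g \in unitmx]| = (#|Lat a| * #|stab a|)%N.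
Proof.
move=> aN; rewrite -sum_nat_const -sum1_card.
rewrite (partition_big (latset a) (mem (Lat a))) /=; last by move=> g gu; apply: imset_f.
apply: eq_bigr => M /imsetP[g0]; rewrite inE => g0u ->.
rewrite sum1dep_card.
have inj : injective (fun h : 'M[R]_l => h *m g0).
  by apply: can_inj (mulmx^~ (invmx g0)) _ => x; rewrite mulmxK.
rewrite -(card_imset (stab a) inj); apply: fintype.eq_card => g; rewrite !inE.
apply/andP/imsetP => [[gu /eqP gg0]|[h hs ->]].
  exists (g *m invmx g0); last by rewrite mulmxKV.
  rewrite stabP ?unitmx_mul ?gu ?unitmx_inv // latsetM gg0 -latsetM mulmxV //.
  by rewrite latset1.
have hu : h \in unitmx by move: hs; rewrite inE => /andP[].
by rewrite unitmx_mul hu g0u latsetM (eqP (_ : latset a h == diagset a)) -?stabP.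
Qed.

(** For nondecreasing a this is the end of the block of indices on which a takes the value a_i: the
    first index with a larger value, or l. *)
Definition nle a (i : 'I_l) : nat := #|[set j | (a j <= a i)%N]|.

Lemma card_initial (S : {set 'I_l}) (j : 'I_l) :
  (forall i k : 'I_l, (i <= k)%N -> k \in S -> i \in S) -> (j \in S) = (j < #|S|)%N.
Proof.
move=> Sdown; have cj : #|[set i : 'I_l | (i < j)%N]| = j.
  rewrite -[RHS]card_ord -[RHS]cardsT.
  have winj : injective (widen_ord (ltnW (ltn_ord j))) by move=> x y e; apply: val_inj; exact: (congr1 val e).
  rewrite -[RHS](card_imset _ winj).
  apply: fintype.eq_card => i; rewrite inE; apply/idP/imsetP => [ij|[k _ ->]]; last exact: (ltn_ord k).
  by exists (Ordinal ij); rewrite ?inE //; apply: val_inj.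
have [jS|jS] := boolP (j \in S); apply/esym.
  rewrite -{1}cj; apply: proper_card; apply/properP; split.
    by apply/fintype.subsetP => i; rewrite inE => /ltnW ij; apply: Sdown jS.
  by exists j; rewrite ?inE ?ltnn.
apply/negbTE; rewrite -leqNgt -[X in (_ <= X)%N]cj; apply: subset_leq_card.
apply/fintype.subsetP => i iS; rewrite inE ltnNge; apply: contra jS => ji.
exact: Sdown iS.
Qed.

Lemma nle_leq a (i j : 'I_l) : {homo a : i j / (i <= j)%N} ->
  (nle a i <= j)%N = (a i < a j)%N.
Proof.
move=> ah; rewrite leqNgt -card_initial => [|k k' kk']; rewrite !inE ?ltnNge //.
by apply: leq_trans; apply: ah.
Qed.

Definition nle_nat a (k : nat) : nat := if insub k is Some i then nle a i else l.

(** Modulo p the stabilizer becomes the group of invertible block triangular matrices over F_p, row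
    i being supported on the first [nle a i] columns. All of them have the same number of lifts, a
    product over the entries. *)
Lemma card_stab a : {homo a : i j / (i <= j)%N} -> (forall i, (a i < N)%N) ->
  #|stab a| = ((\prod_i (p ^ nle a i - p ^ i)) *
    \prod_i \prod_j (if (a i < a j)%N then p ^ (N - (a j - a i)) else p ^ N.-1))%N.
Proof.
move=> ah aN; have nord (i : 'I_l) : nle_nat a i = nle a i by rewrite /nle_nat valK.
have -> : (\prod_(i < l) (p ^ nle a i - p ^ i) = \prod_(i < l) (#|F| ^ nle_nat a i - #|F| ^ i))%N.
  by apply: eq_bigr => i _; rewrite nord card_Fp.
have nl (i : 'I_l) : (nle a i <= l)%N by rewrite -[X in (_ <= X)%N]card_ord max_card.
rewrite -card_triangular_unit; last first.
- by move=> k kl; rewrite /nle_nat; case: insubP.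
- move=> k k' kk'; rewrite /nle_nat; case: insubP => [i _ iE|kl]; case: insubP => [i' _ i'E|k'l] //.
    apply: subset_leq_card; apply/fintype.subsetP => j; rewrite !inE => h.
    by apply: leq_trans h (ah _ _ _); rewrite iE i'E.
  by move: kl; rewrite -leqNgt => kl; have := ltn_ord i'; rewrite i'E; lia.
rewrite -sum_nat_const -sum1_card.
rewrite (partition_big (map_mx red) (mem [set A : 'M[F]_l | (A \in unitmx) &&
   [forall i : 'I_l, forall j : 'I_l, (nle_nat a i <= j)%N ==> (A i j == 0)]])) /=; last first.
  move=> g; rewrite !inE => /andP[gu /forallP gd]; rewrite unitmxE det_map_mx unitfE -unit_red -unitmxE gu /=.
  apply/forallP => i; apply/forallP => j; apply/implyP; rewrite nord nle_leq // => aij.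
  rewrite mxE red_eq0; have /forallP/(_ j) := gd i; rewrite /dvr; apply: dvdn_trans.
  by rewrite dvdn_exp2l // subn_gt0.
apply: eq_bigr => A; rewrite inE => /andP[Au /forallP Az].
rewrite sum1dep_card.
transitivity #|[set g : 'M[R]_l | [forall i, forall j,
   g i j \in [set x | (red x == A i j) && dvr (a j - a i) x]]]|.
  apply: fintype.eq_card => g; rewrite !inE; apply/andP/forallP => [[/andP[_ gd] /eqP gA] i|h].
    apply/forallP => j; rewrite inE -gA mxE eqxx /=.
    by have /forallP/(_ i)/forallP := gd.
  have gA : map_mx red g = A.
    by apply/matrixP => i j; have /forallP/(_ j) := h i; rewrite inE mxE => /andP[/eqP].
  rewrite gA eqxx; split=> //; rewrite unitmxE unit_red -det_map_mx gA -unitfE -unitmxE Au /=.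
  by apply/forallP => i; apply/forallP => j; have /forallP/(_ j) := h i; rewrite inE => /andP[].
rewrite card_mx_family; apply: eq_bigr => i _; apply: eq_bigr => j _.
case: ifP => aij.
  have /eqP A0 : A i j == 0.
    by have /forallP/(_ j)/implyP := Az i; apply; rewrite nord nle_leq.
  rewrite -card_dvr; last by have := aN j; lia.
  apply: fintype.eq_card => x; rewrite !inE A0 red_eq0 andb_idl // /dvr; apply: dvdn_trans.
  by rewrite dvdn_exp2l // subn_gt0.
rewrite -(card_red (A i j)); apply: fintype.eq_card => x; rewrite !inE andb_idr // => _.
have -> : (a j - a i = 0)%N by apply/eqP; rewrite subn_eq0 leqNgt aij.
by rewrite /dvr expn0 dvd1n.
Qed.

(** Stated as a product to avoid a quotient of natural numbers. Subtraction is truncated, so the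
    pairs with a_j <= a_i contribute the factor 1. *)
Lemma card_Lat a : {homo a : i j / (i <= j)%N} -> (forall i, (a i < N)%N) ->
  (#|Lat a| * \prod_i (p ^ nle a i - p ^ i) =
   (\prod_(i < l) (p ^ l - p ^ i)) * \prod_i \prod_j p ^ (a j - a i).-1)%N.
Proof.
move=> ah aN; have p0 : (0 < p)%N := prime_gt0 p_pr.
have U0 : #|[set g : 'M[R]_l | g \in unitmx]| =
    ((\prod_(i < l) (p ^ l - p ^ i)) * \prod_(i < l) \prod_(j < l) p ^ N.-1)%N.
  have <- : #|stab (fun=> 0%N)| = #|[set g : 'M[R]_l | g \in unitmx]|.
    apply: fintype.eq_card => g; rewrite !inE andb_idr // => _.
    by apply/forallP => i; apply/forallP => j; rewrite /dvr expn0 dvd1n.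
  rewrite card_stab //; congr (_ * _)%N; apply: eq_bigr => i _.
  by rewrite /nle (_ : [set j | _] = [set: 'I_l]) ?cardsT ?card_ord //; apply/setP => j; rewrite !inE.
have := card_unit_Lat (fun i => ltnW (aN i)); rewrite U0 card_stab //.
set X := (\prod_i \prod_j (if _ then _ else _))%N => E.
have X0 : (0 < X)%N.
  by apply: prodn_gt0 => i; apply: prodn_gt0 => j; case: ifP; rewrite expn_gt0 p0.
apply/eqP; rewrite -(eqn_pmul2r X0) -mulnA -E -mulnA; apply/eqP; congr (_ * _)%N.
rewrite /X -big_split; apply: eq_bigr => i _ /=; rewrite -big_split; apply: eq_bigr => j _ /=.
case: ifP => aij; rewrite -expnD; congr (_ ^ _)%N; have := aN j; lia.
Qed.

(** The zero block has i0 + 1 rows and l - i0 columns, together more than l, so every permutation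
    meets it. *)
Lemma det_zero_block (K : fieldType) (A : 'M[K]_l) (i0 : 'I_l) :
  (forall i j : 'I_l, (i <= i0)%N -> (i0 <= j)%N -> A i j = 0) -> \det A = 0.
Proof.
move=> A0; rewrite /determinant big1 // => s _.
suff [i [ii0 si0]] : exists i : 'I_l, (i <= i0)%N /\ (i0 <= s i)%N.
  by rewrite (bigD1 i) //= A0 // mul0r mulr0.
apply: contrapT => h.
have sub : [set s i | i in [set i : 'I_l | (i <= i0)%N]] \subset [set j : 'I_l | (j < i0)%N].
  apply/fintype.subsetP => j; case/imsetP => i; rewrite inE => ii0 ->; rewrite inE ltnNge.
  by apply/negP => si; apply: h; exists i.
have := subset_leq_card sub; rewrite card_imset; last exact: perm_inj.
rewrite leqNgt; move/negP; apply; apply: proper_card; apply/properP; split.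
  by apply/fintype.subsetP => j; rewrite !inE; apply: ltnW.
by exists i0; rewrite !inE ?leqnn ?ltnn.
Qed.

(** If a_i < b_i at i = i0, the invertible matrix g h^(-1) acquires modulo p a zero block too large
    for its determinant. Used in both directions, this makes the type of a module unique. *)
Lemma Lat_type_leq a b M : {homo a : i j / (i <= j)%N} -> {homo b : i j / (i <= j)%N} ->
  (forall i, (a i < N)%N) -> (forall i, (b i < N)%N) ->
  M \in Lat a -> M \in Lat b -> forall i, (b i <= a i)%N.
Proof.
move=> ah bh aN bN /imsetP[g]; rewrite inE => gu -> /imsetP[h]; rewrite inE => hu gh i0.
rewrite leqNgt; apply/negP => abi.
pose E := g *m invmx h.
have Eu : E \in unitmx by rewrite unitmx_mul gu unitmx_inv.
have : latset a E \subset diagset b.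
  by rewrite latsetM gh -latsetM mulmxV // latset1.
rewrite latset_sub; [|by move=> i; apply: ltnW..] => /forallP Ed.
have : \det (map_mx red E) != 0 by rewrite det_map_mx -unit_red -unitmxE.
rewrite (@det_zero_block _ _ i0) ?eqxx // => i j ii0 i0j; rewrite mxE; apply/eqP; rewrite red_eq0.
have /forallP/(_ j) := Ed i; rewrite /dvr; apply: dvdn_trans; rewrite dvdn_exp2l // subn_gt0.
by apply: leq_ltn_trans (ah _ _ ii0) _; apply: leq_trans abi (bh _ _ i0j).
Qed.

End Types.

Local Notation O := (padic_int p_pr).

Definition rho (x : O) : R := (x N)%:~R.

Lemma intr_modpN (z : int) : ((z %% (p ^ N)%N%:Z)%Z)%:~R = z%:~R :> R.
Proof.
have p0 : ((p ^ N)%N%:Z)%:~R = 0 :> R.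
  by rewrite -pmulrn; apply: val_inj; rewrite /= val_Zp_nat' modnn.
have -> : z%:~R = ((z %/ (p ^ N)%N%:Z)%Z * (p ^ N)%N%:Z)%:~R + ((z %% (p ^ N)%N%:Z)%Z)%:~R :> R.
  by rewrite -intrD -divz_eq.
by rewrite [X in X + _]intrM p0 mulr0 add0r.
Qed.

Fact rho_zmod : zmod_morphism rho.
Proof.
move=> x y; rewrite /rho padicD padicN modzDmr intr_modpN.
by rewrite intrB.
Qed.
HB.instance Definition _ := GRing.isZmodMorphism.Build O R rho rho_zmod.
Fact rho_monoid : monoid_morphism rho.
Proof.
split=> [|x y]; first by rewrite /rho padic1 intr_modpN.
by rewrite /rho padicM intr_modpN intrM.
Qed.
HB.instance Definition _ := GRing.isMonoidMorphism.Build O R rho rho_monoid.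

Lemma rho_lift (x : R) : rho (x : nat)%:R = x.
Proof. by rewrite rmorph_nat Zp_nat_val. Qed.

Lemma dvr_rho c (x : O) : (c <= N)%N -> dvr c (rho x) <-> pdvd c x.
Proof.
move=> cN; rewrite /pdvd -padic_dvdP -(padic_dvd x cN) /rho.
have x0 : 0 <= x N.
  by rewrite -padic_mod modz_ge0 // eqz_nat -lt0n expn_gt0 prime_gt0.
by rewrite -(gez0_abs x0) -pmulrn dvr_nat // dvdzE.
Qed.

Lemma rho_eq0 (x : O) : rho x = 0 -> pdvd N x.
Proof. by move=> x0; apply/dvr_rho => //; rewrite x0 dvr0. Qed.

Lemma unit_rho (x : O) : rho x \is a GRing.unit -> x \is a GRing.unit.
Proof.
by rewrite unit_red red_eq0 => h; apply/padic_unitP => /(dvr_rho x N_gt0); apply/negP.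
Qed.

End ZpMatrices.

Local Open Scope classical_set_scope.

(** * Maximal sublattices with given isotropic part *)

Fact oppr_shuffle (G : zmodType) (A B C D : G) : - A - D - B = - (A - C + (B + C + D)).
Proof.
by rewrite [B + C]addrC -(addrA C) (addrA (A - C)) subrK !opprD addrA addrAC.
Qed.

Fact addr_exchange (G : zmodType) (a h c r e : G) :
  a + h + c + (r - h + e) = a + r + (c + e).
Proof.
by rewrite [r - h + e]addrAC [a + h + c]addrAC addrA [LHS]addrAC addrK addrACA.
Qed.

Section FixedIntersection.
Variables (p : nat) (p_pr : prime p).
Local Notation O := (padic_int p_pr).
Local Notation F := (padic p_pr).
Local Notation pi := (p%:R : F).
Variables (V : vectType F) (beta : {symmetric V}).
Local Notation Q := (quad beta).
Local Notation l := (witt_index beta).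
Hypothesis nondeg : nondegenerate beta.
Hypothesis l_gt0 : (0 < l)%N.
Variables (k : int) (v u : 'I_l -> V).
Hypothesis hvu : hyperbolic k v u.
Local Notation W := (witt_complement v u).
Local Notation lay := (layer k v u).
Variables (m : nat) (a : 'I_l -> nat).
Hypothesis a_homo : {homo a : i j / (i <= j)%N}.
Hypothesis a_le : forall i, (a i <= m)%N.
Variable d : nat.
Hypothesis lay01 : has_index (lay 0) (lay 1) (p ^ d).

Definition sublattices_over : set (set V) :=
  [set M | [/\ maximal_lattice beta M, M `<=` hlattice k v u,
     lattice_norm beta M = pideal (k + m%:Z) &
     forall c : 'rV[F]_l, M (lcomb v c) <-> forall i, pideal (a i)%:Z (c 0 i)]].

Local Notation co i := (m%:Z - (a i)%:Z).

Definition frame_x (i : 'I_l) : V := pi ^ (a i)%:Z *: v i.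
(* When M contains p^m (O v_1 + ... + O v_l), its hyperbolic partners of the
   p^(a_i) v_i have this shape; t_i is free modulo a layer of W, S_ij (j < i)
   modulo p^(a_j), and isotropy determines the other S_ij. *)
Definition frame_y (t : 'I_l -> V) (S : 'I_l -> 'I_l -> F) (i : 'I_l) : V :=
  pi ^ (co i) *: (u i + t i + lcomb v (\row_j S i j)).

Let expK (z : int) : pi ^ z * pi ^ (- z) = 1.
Proof. by rewrite -expz_pD subrr. Qed.
Let expKn (z : int) : pi ^ (- z) * pi ^ z = 1.
Proof. by rewrite -expz_pD addNr. Qed.

Lemma lcomb_frame_x c : lcomb frame_x c = lcomb v (\row_i (c 0 i * pi ^ (a i)%:Z)).
Proof. by apply: eq_bigr => i _; rewrite mxE scalerA. Qed.

Lemma beta_v_frame_y t S i j : (forall i, W (t i)) ->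
  beta (v i) (frame_y t S j) = pi ^ (k + co j) * (i == j)%:R.
Proof.
move=> Wt; have [vv uu vu] := hvu; rewrite betaZr !betaDr vu (beta_x_lcomb_x hvu).
by rewrite betaC (Wt j i).1 !addr0 [pi ^ (k + _)]expz_pD mulrCA mulrA.
Qed.

Lemma beta_u_frame_y t S i j : (forall i, W (t i)) ->
  beta (u i) (frame_y t S j) = pi ^ (k + co j) * S j i.
Proof.
move=> Wt; have [vv uu vu] := hvu; rewrite betaZr !betaDr uu (beta_y_lcomb_x hvu) mxE.
by rewrite betaC (Wt j i).2 !add0r [pi ^ (k + _)]expz_pD mulrCA mulrA.
Qed.

(** Isotropy of the partners thus reads S_ij + S_ji = - p^(-k) beta(t_i, t_j): the entries above the
    diagonal follow from those below it. *)
Lemma beta_frame_y t S i j : (forall i, W (t i)) ->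
  beta (frame_y t S i) (frame_y t S j) =
  pi ^ (co i + co j) * (pi ^ k * (S i j + S j i) + beta (t i) (t j)).
Proof.
move=> Wt; have [vv uu vu] := hvu; rewrite betaZl betaZr mulrA -expz_pD; congr (_ * _).
rewrite !betaDl !betaDr uu [beta (u i) (t j)]betaC (Wt j i).2 (beta_y_lcomb_x hvu) !add0r mxE.
rewrite (Wt i j).2 add0r -[lcomb v (\row_j' S j j')]addr0 -(lcomb0 u) complement_lcomb //.
rewrite lcomb0 !addr0.
rewrite [beta (lcomb _ _) (u j)]betaC (beta_y_lcomb_x hvu) mxE.
rewrite [beta (lcomb _ _) (t j)]betaC -[lcomb v (\row_j' S i j')]addr0 -(lcomb0 u) complement_lcomb //.
rewrite lcomb0 !addr0 beta_lcombl big1 ?addr0; last first.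
  by move=> i' _; rewrite (beta_x_lcomb_x hvu) mulr0.
by rewrite mulrDr addrAC; congr (_ + _); rewrite addrC.
Qed.

(** On the diagonal, Q(y_i) = 0 fixes S_ii through Q(t_i) without a division by 2. *)
Lemma quad_frame_y t S i : (forall i, W (t i)) ->
  Q (frame_y t S i) = pi ^ (co i + co i) * (pi ^ k * S i i + Q (t i)).
Proof.
move=> Wt; apply: (mulIf (padic_two_neq0 p_pr)); rewrite -beta_quad beta_frame_y //.
rewrite beta_quad -[RHS]mulrA; congr (_ * _); rewrite [RHS]mulrDl -[in RHS]mulrA.
by congr (_ * _ + _); rewrite mulr_natr mulr2n.
Qed.

Lemma frame_hyperbolic t S : (forall i, W (t i)) ->
  (forall i j, pi ^ k * (S i j + S j i) + beta (t i) (t j) = 0) ->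
  hyperbolic (k + m%:Z) frame_x (frame_y t S).
Proof.
move=> Wt St; have [vv uu vu] := hvu; split=> i j.
- by rewrite betaZl betaZr vv !mulr0.
- by rewrite beta_frame_y // St mulr0.
rewrite betaZl beta_v_frame_y //; have [->|ij] := eqVneq i j; last by rewrite !mulr0.
by rewrite !mulr1 -expz_pD; congr (_ ^ _); lia.
Qed.

Lemma frame_lcomb t S c : (forall i, W (t i)) ->
  hyperbolic (k + m%:Z) frame_x (frame_y t S) ->
  hlattice (k + m%:Z) frame_x (frame_y t S) (lcomb v c) <->
  forall i, pideal (a i)%:Z (c 0 i).
Proof.
move=> Wt hxy.
have bv i : beta (lcomb v c) (v i) = 0 by rewrite betaC (beta_x_lcomb_x hvu).
have by_ i : beta (lcomb v c) (frame_y t S i) = pi ^ (k + co i) * c 0 i.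
  rewrite beta_lcombl (bigD1 i) //= beta_v_frame_y // eqxx mulr1 big1 ?addr0 1?mulrC // => j ji.
  by rewrite beta_v_frame_y // (negbTE ji) !mulr0.
have e i : k + m%:Z = k + co i + (a i)%:Z by lia.
split=> [[_ h] i|h].
  by have := (h i).2; rewrite by_ {1}(e i) => /pideal_scale.
split=> [|i].
  rewrite quad_beta0; first exact: pideal0.
  by rewrite beta_lcombl big1 // => i _; rewrite (beta_x_lcomb_x hvu) mulr0.
rewrite betaZr bv mulr0 by_; split; first exact: pideal0.
by rewrite {1}(e i); apply/pideal_scale.
Qed.

(** The bounds on t_i and S_ij put the partner y_i in L. The anisotropic kernel of the new frame
    differs from W and has to be checked too: its vectors w are orthogonal to the v_i, have the same
    Q as their W-component w', and pair with u_i to -beta(w', t_i). *)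
Lemma frame_sub t S : (forall i, lay (- co i) (t i)) ->
  (forall i j, pideal (- co i) (S i j)) ->
  hyperbolic (k + m%:Z) frame_x (frame_y t S) ->
  hlattice (k + m%:Z) frame_x (frame_y t S) `<=` hlattice k v u.
Proof.
move=> lt SO hxy z hz; have Wt i : W (t i) := (lt i).1.
have LS := hlattice_submod hvu; have /(hlatticeP hxy)[hc Qp] := hz.
have cO (g : 'I_l -> V) j : pideal (k + m%:Z) (beta z (g j)) ->
    pideal 0 (hcoef (k + m%:Z) z g 0 j).
  by move=> gj; rewrite mxE -(addNr (k + m%:Z)); apply/pideal_scale.
rewrite (hproj_decomp (k + m%:Z) frame_x (frame_y t S) z).
apply: submodD => //; first apply: submodD => //.
- apply: submod_lcomb => // i; last by apply: cO; case: (hc i).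
  apply: submodZ => //; last by case: (hlattice_mem hvu i).
  by apply: (@pidealW _ _ 0 (a i)%:Z); [lia|apply: pideal_expz].
- apply: submod_lcomb => // i; last by apply: cO; case: (hc i).
  split=> [|j].
    rewrite quad_frame_y //; have Qt := (lt i).2.
    have e : k = co i + co i + (k - co i - co i) by lia.
    rewrite {1}e; apply/pideal_scale; apply: pidealD.
      have -> : k - co i - co i = k + (- co i - co i) by lia.
      apply/pideal_scale; apply: pidealW (SO i i); have := a_le i; lia.
    by apply: pidealW Qt; have := a_le i; lia.
  split; rewrite betaC.
    rewrite beta_v_frame_y // {1}(_ : k = k + co i + - co i); last by lia.
    apply/pideal_scale; apply: (@pidealW _ _ _ 0); first by have := a_le i; lia.
    by apply/pideal0P; exists ((j == i)%:R); rewrite tofrac_nat.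
  rewrite beta_u_frame_y // {1}(_ : k = k + co i + - co i); last by lia.
  exact/pideal_scale.
set w := hproj _ _ _ _; have Ww := hproj_complement hxy z; rewrite -/w in Ww Qp.
have wv i : beta w (v i) = 0.
  have := (Ww i).1; rewrite betaZr => /eqP; rewrite mulf_eq0 (negbTE (expz_p_neq0 _ _)) /=.
  by move=> /eqP.
have wu i : beta w (u i) = - beta (hproj k v u w) (t i).
  have := (Ww i).2; rewrite betaZr => /eqP; rewrite mulf_eq0 (negbTE (expz_p_neq0 _ _)) /=.
  rewrite !betaDr beta_lcombr big1 => [|j _]; last by rewrite wv mulr0.
  rewrite addr0 addr_eq0 => /eqP ->; congr (- _).
  rewrite {1}(hproj_decomp k v u w) betaDl betaC complement_lcomb // add0r //.
have Qw : Q w = Q (hproj k v u w).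
  rewrite {1}(quad_hproj hvu) big1 ?mulr0 ?add0r // => i _; by rewrite wv mul0r.
split=> [|i]; first by apply: pidealW Qp; lia.
rewrite wv wu; split; first exact: pideal0.
apply: pidealN; have [_ Qt] := lt i; rewrite Qw in Qp.
by apply: (complement_beta hvu (hproj_complement hvu w) (Wt i) Qp Qt); have := a_le i; lia.
Qed.

Lemma frame_decomp z i : (forall j, beta z (v j) = pi ^ (k + co i) * (j == i)%:R) ->
  z = pi ^ (co i) *: (u i + pi ^ (- co i) *: hproj k v u z +
        lcomb v (\row_j (pi ^ (- co i) * hcoef k z u 0 j))).
Proof.
move=> zv; move: (hproj k v u z) (hproj_decomp k v u z) => H zE.
rewrite {1}zE !scalerDr scalerA expK scale1r {zE}.
have -> : lcomb u (hcoef k z v) = pi ^ co i *: u i.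
  rewrite -(lcomb_delta u i) -lcombZ; congr lcomb; apply/rowP => j.
  by rewrite !mxE zv eqxx /= mulrA -expz_pD addKr.
have -> : lcomb v (\row_j (pi ^ (- co i) * hcoef k z u 0 j)) =
    pi ^ (- co i) *: lcomb v (hcoef k z u).
  by rewrite -lcombZ; congr lcomb; apply/rowP => j; rewrite !mxE.
by rewrite scalerA expK scale1r -addrA addrC.
Qed.

Section OneLattice.
Variable M : set V.
Hypothesis MP : sublattices_over M.

Lemma over_hyperbolic : exists y,
  hyperbolic (k + m%:Z) frame_x y /\ M = hlattice (k + m%:Z) frame_x y.
Proof.
have [Mmax Msub Mnorm Mv] := MP; have [vv uu vu] := hvu.
apply: (maximal_hyperbolic nondeg l_gt0 Mmax Mnorm).
  by move=> i j; rewrite betaZl betaZr vv !mulr0.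
move=> c; rewrite lcomb_frame_x Mv; split=> h i; have := h i; rewrite mxE mulrC.
  by rewrite -{1}[(a i)%:Z]addr0 => /pideal_scale.
by move=> ci; rewrite -{1}[(a i)%:Z]addr0; apply/pideal_scale.
Qed.

(** The coefficient c_i is chosen to cancel the pairing of w with y_i; adding a combination of the
    v_i changes neither Q w nor the pairings with the v_i. *)
Lemma over_lift y w : hyperbolic (k + m%:Z) frame_x y ->
  M = hlattice (k + m%:Z) frame_x y -> lay m%:Z w -> exists c, M (w + lcomb v c).
Proof.
move=> hxy ME [Ww Qw]; have [vv uu vu] := hvu; have [_ _ xy] := hxy.
pose c : 'rV[F]_l := \row_i (- (pi ^ ((a i)%:Z - (k + m%:Z)) * beta w (y i))).
have vy i j : beta (v i) (y j) = pi ^ (k + co i) * (i == j)%:R.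
  apply: (mulfI (expz_p_neq0 p_pr (a i)%:Z)); rewrite -betaZl xy mulrA -expz_pD.
  by congr (_ ^ _ * _); lia.
have ww i : beta w (lcomb v c) = 0 /\ beta (lcomb v c) (v i) = 0.
  split; last by rewrite betaC (beta_x_lcomb_x hvu).
  by rewrite -[lcomb v c]addr0 -(lcomb0 u) complement_lcomb.
exists c; rewrite ME; split=> [|i].
  rewrite quadD (ww (Ordinal l_gt0)).1 addr0 [Q (lcomb _ _)]quad_beta0 ?addr0 //.
  by rewrite beta_lcombl big1 // => i _; rewrite (beta_x_lcomb_x hvu) mulr0.
rewrite betaZr !betaDl (Ww i).1 (ww i).2 addr0 mulr0; split; first exact: pideal0.
rewrite beta_lcombl (bigD1 i) //= vy eqxx mulr1 big1 => [|j ji]; last by rewrite vy (negbTE ji) !mulr0.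
have e0 : pi ^ ((a i)%:Z - (k + m%:Z)) * pi ^ (k + co i) = 1.
  by rewrite -expz_pD (_ : _ + _ = 0) ?expr0z //; lia.
by rewrite addr0 mxE mulNr mulrAC e0 mul1r subrr; exact: pideal0.
Qed.

(** The index splits in three: the pairings with the v_i give the product of the p^(m - a_i), the
    W-components give [layer 0] over [layer m], and the intersections with the span of the v_i give
    the product of the p^(a_i). The a_i cancel. *)
Lemma over_index : has_index (hlattice k v u) M (p ^ (l * m) * p ^ layer_sum beta d 0 m).
Proof.
have [Mmax Msub Mnorm Mv] := MP; have [vv uu vu] := hvu.
have [y [hxy ME]] := over_hyperbolic; have [_ _ xy] := hxy.
have LS := hlattice_submod hvu; have MS : submod M := maximal_submod Mmax.
have vy i j : beta (v i) (y j) = pi ^ (k + co i) * (i == j)%:R.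
  apply: (mulfI (expz_p_neq0 p_pr (a i)%:Z)); rewrite -betaZl xy mulrA -expz_pD.
  by congr (_ ^ _ * _); lia.
have -> : (p ^ (l * m) * p ^ layer_sum beta d 0 m = (\prod_(i < l) p ^ (m - a i)) *
    (p ^ layer_sum beta d 0 m * \prod_(i < l) p ^ (a i)))%N.
  rewrite mulnCA mulnC; congr (_ * _)%N; rewrite -big_split /=.
  rewrite (eq_bigr (fun=> p ^ m)%N) => [|i _]; last by rewrite -expnD subnK.
  by rewrite prod_nat_const card_ord -expnM mulnC.
pose f1 (z : V) : {ffun 'I_l -> F} := [ffun i => pi ^ (- k) * beta z (v i)].
have f1B : {morph f1 : z z' / z - z'}.
  by move=> z z'; apply/ffunP => i; rewrite !ffunE betaBl mulrBr.
have f1_0 z : f1 z = 0 <-> forall i, beta z (v i) = 0.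
  split=> [/ffunP h i|h]; last by apply/ffunP => i; rewrite !ffunE h mulr0.
  have := h i; rewrite !ffunE => /eqP; rewrite mulf_eq0 (negbTE (expz_p_neq0 _ _)) /=.
  by move=> /eqP.
have f2B : {morph hproj k v u : z z' / z - z'}.
  move=> z z'; rewrite /hproj.
  have hB (g : 'I_l -> V) : hcoef k (z - z') g = hcoef k z g - hcoef k z' g.
    by apply/rowP => i; rewrite !mxE betaBl mulrBr.
  rewrite !hB !lcombD !lcombN [X in _ - X = _]addrACA -opprD.
  move: (lcomb v (hcoef k z u) + _) (lcomb v (hcoef k z' u) + _) => C D.
  by rewrite !opprD !opprK [LHS]addrACA.
have hp_lc c : hproj k v u (lcomb v c) = 0.
  rewrite /hproj (_ : hcoef k (lcomb v c) u = c); last first.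
    by apply/rowP => i; rewrite mxE betaC (beta_y_lcomb_x hvu) mulrA expKn mul1r.
  rewrite (_ : hcoef k (lcomb v c) v = 0) ?lcomb0 ?addr0 ?subrr //.
  by apply/rowP => i; rewrite !mxE betaC (beta_x_lcomb_x hvu) mulr0.
have hpD z z' : hproj k v u (z + z') = hproj k v u z + hproj k v u z'.
  by rewrite -{2}(addrK z' z) f2B subrK.
have hpW w : W w -> hproj k v u w = w.
  move=> Ww; rewrite /hproj (_ : hcoef k w u = 0); last first.
    by apply/rowP => i; rewrite !mxE (Ww i).2 mulr0.
  rewrite (_ : hcoef k w v = 0); last by apply/rowP => i; rewrite !mxE (Ww i).1 mulr0.
  by rewrite !lcomb0 addr0 subr0.
have vinj c : lcomb v c = 0 -> c = 0 by apply: (hyperbolic_lcomb_inj hvu).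
apply: (has_index_exact f1B) => //; try exact: submod_subgroup.
- have -> : f1 @` hlattice k v u = [set f : {ffun 'I_l -> F} | forall i, pideal 0 (f i)].
    apply/seteqP; split=> [_ [z [_ hz] <-] i|f fO].
      by rewrite ffunE -(addNr k); apply/pideal_scale; case: (hz i).
    exists (lcomb u (\row_i f i)).
      by apply: submod_lcomb => // i; [case: (hlattice_mem hvu i)|rewrite mxE].
    by apply/ffunP => i; rewrite ffunE betaC (beta_x_lcomb_y hvu) mxE mulrA expKn mul1r.
  have -> : f1 @` M = [set f : {ffun 'I_l -> F} | forall i, pideal (co i) (f i)].
    apply/seteqP; split=> [_ [z Mz <-] i|f fO].
      move: Mz; rewrite ME => -[_ /(_ i)[+ _]]; rewrite betaZr ffunE => h.
      rewrite (_ : co i = - k + (k + co i)); last by lia.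
      apply/pideal_scale; apply/(pideal_scale (a i)%:Z).
      by rewrite (_ : _ + _ = k + m%:Z); last by lia.
    exists (lcomb y (\row_i (pi ^ (- co i) * f i))).
      apply: submod_lcomb => // i; first by rewrite ME; case: (hlattice_mem hxy i).
      by rewrite mxE -(addNr (co i)); apply/pideal_scale.
    apply/ffunP => i; rewrite ffunE betaC beta_lcombr (bigD1 i) //= vy eqxx mulr1 big1.
      rewrite addr0 mxE mulrAC -expz_pD mulrA -expz_pD (_ : - k + _ = 0) ?expr0z ?mul1r //.
      by lia.
    by move=> j ji; rewrite vy eq_sym (negbTE ji) !mulr0.
  apply: (@has_index_ffun F 'I_l (fun=> pideal 0) (fun i => pideal (co i))) => i.
  have := @has_index_pideal p p_pr 0 (m - a i)%N; rewrite add0r -subzn ?a_le //.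
have sub2 (N : set V) : submod N -> subgroup [set z | N z /\ f1 z = 0].
  move=> NS; split=> [|z1 z2 [N1 f10] [N2 f20]] /=.
    by split; [case: NS|apply/f1_0 => i; rewrite beta0l].
  by split; [apply: submod_sub|rewrite f1B f10 f20 subrr].
apply: (has_index_exact f2B); try exact: sub2.
- by move=> z [Mz fz]; split=> //; apply: Msub.
- have -> : hproj k v u @` [set z | hlattice k v u z /\ f1 z = 0] = lay 0.
    apply/seteqP; split=> [_ [z [/(hlatticeP hvu)[_ Qz] _] <-]|w [Ww Qw]].
      by split; [apply: hproj_complement|rewrite addr0].
    exists w; last exact: hpW.
    split; last by apply/f1_0 => i; case: (Ww i).
    rewrite addr0 in Qw; split=> // i; case: (Ww i) => -> ->.
    by split; apply: pideal0.
  have -> : hproj k v u @` [set z | M z /\ f1 z = 0] = lay m%:Z.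
    apply/seteqP; split=> [_ [z [Mz /f1_0 fz] <-]|w lw].
      split; first exact: hproj_complement.
      move: Mz; rewrite ME => -[Qz _]; move: Qz; rewrite (quad_hproj hvu) big1 ?mulr0 ?add0r // => i _.
      by rewrite fz mul0r.
    have [c Mc] := over_lift hxy ME lw; exists (w + lcomb v c).
      split=> //; apply/f1_0 => i; rewrite betaDl (lw.1 i).1 add0r betaC.
      exact: (beta_x_lcomb_x hvu).
    by rewrite hpD hp_lc addr0 hpW //; case: lw.
  have := @layer_index _ _ _ _ nondeg _ _ _ hvu d 0 m lay01; rewrite add0r; exact.
have E (N : set V) (b : 'I_l -> int) : (forall c : 'rV[F]_l, N (lcomb v c) <-> forall i, pideal (b i) (c 0 i)) ->
    [set z | [set z | N z /\ f1 z = 0] z /\ hproj k v u z = 0] =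
    [set lcomb v r | r in [set r : 'rV[F]_l | forall i, pideal (b i) (r 0 i)]].
  move=> Nb; apply/seteqP; split=> [z [[Nz /f1_0 fz] hz]|_ [c cb <-]].
    have zE : z = lcomb v (hcoef k z u).
      rewrite {1}(hproj_decomp k v u z) hz addr0 (_ : hcoef k z v = 0) ?lcomb0 ?addr0 //.
      by apply/rowP => i; rewrite !mxE fz mulr0.
    by exists (hcoef k z u) => //; apply/Nb; rewrite -zE.
  split; last exact: hp_lc.
  by split; [apply/Nb|apply/f1_0 => i; rewrite betaC (beta_x_lcomb_x hvu)].
rewrite (E _ (fun=> 0)) => [|c]; last first.
  split=> [[_ h] i|cO].
    have := (h i).2; rewrite betaC (beta_y_lcomb_x hvu) -{1}[k]addr0; by move/pideal_scale.
  by apply: submod_lcomb => // i; case: (hlattice_mem hvu i).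
rewrite (E _ (fun i => (a i)%:Z)) //.
apply: has_index_comb => // i; by rewrite add0r.
Qed.

End OneLattice.

(** The parameters are t_i in [layer (a_i - m)] modulo [layer (2 a_i - m)] and, for j < i, S_ij in
    p^(a_i - m) O modulo p^(a_i + a_j - m) O. Transversals for both give each lattice exactly
    once. *)
Lemma card_sublattices_over : finite_set sublattices_over /\
  ncard sublattices_over =
  ((\prod_i p ^ layer_sum beta d ((a i)%:Z - m%:Z) (a i)) *
   \prod_(ij : 'I_l * 'I_l) (if (ij.2 < ij.1)%N then p ^ (a ij.2) else 1))%N.
Proof.
have [vv uu vu] := hvu.
have [rt [rtA rtP]] : has_index [set f : {ffun 'I_l -> V} | forall i, lay (- co i) (f i)]
    [set f | forall i, lay ((a i)%:Z - co i) (f i)]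
    (\prod_i p ^ layer_sum beta d ((a i)%:Z - m%:Z) (a i)).
  apply: (@has_index_ffun V 'I_l (fun i => lay (- co i)) (fun i => lay ((a i)%:Z - co i))) => i.
  have := @layer_index _ _ _ _ nondeg _ _ _ hvu d ((a i)%:Z - m%:Z) (a i) lay01.
  have -> : (a i)%:Z - m%:Z + (a i)%:Z = (a i)%:Z - co i by lia.
  by have -> : (a i)%:Z - m%:Z = - co i by lia.
(* Entries on and above the diagonal carry no choice: [setT] over [setT] has index 1. *)
pose As (ij : 'I_l * 'I_l) : set F := if (ij.2 < ij.1)%N then pideal (- co ij.1) else setT.
pose Bs (ij : 'I_l * 'I_l) : set F :=
  if (ij.2 < ij.1)%N then pideal (- co ij.1 + (a ij.2)%:Z) else setT.
have [rs [rsA rsP]] : has_index [set f : {ffun 'I_l * 'I_l -> F} | forall ij, As ij (f ij)]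
    [set f | forall ij, Bs ij (f ij)]
    (\prod_(ij : 'I_l * 'I_l) (if (ij.2 < ij.1)%N then p ^ (a ij.2) else 1)).
  apply: (@has_index_ffun F _ As Bs) => ij; rewrite /As /Bs; case: ifP => _.
    exact: has_index_pideal.
  by exists (fun=> 0); split=> // w _; exists ord0; split=> // i _; apply: val_inj; case: i => -[].
pose T := ('I_(\prod_i p ^ layer_sum beta d ((a i)%:Z - m%:Z) (a i)) *
  'I_(\prod_(ij : 'I_l * 'I_l) (if (ij.2 < ij.1)%N then p ^ (a ij.2) else 1)))%type.
(* The only completion of the entries below the diagonal that solves the isotropy equations. *)
pose S (t : 'I_l -> V) (s : {ffun 'I_l * 'I_l -> F}) (i j : 'I_l) : F :=
  if (j < i)%N then s (i, j)
  else if i == j then - (pi ^ (- k) * Q (t i))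
  else - s (j, i) - pi ^ (- k) * beta (t i) (t j).
have St t s i j : pi ^ k * (S t s i j + S t s j i) + beta (t i) (t j) = 0.
  have key (b : F) : pi ^ k * - (pi ^ (- k) * b) + b = 0.
    by rewrite mulrN mulrA expK mul1r addNr.
  rewrite /S eq_sym; case: (ltngtP i j) => [ij|ji|/val_inj ->].
  - have -> : (j == i) = false by apply/negbTE; rewrite -val_eqE /= gtn_eqF.
    by rewrite addrAC addNr add0r key.
  - have -> : (j == i) = false by apply/negbTE; rewrite -val_eqE /= ltn_eqF.
    by rewrite addrA subrr add0r betaC key.
  - by rewrite eqxx beta_quad mulrDr mulr_natr mulr2n addrACA key addr0.
pose yt (t : T) := frame_y (rt t.1) (S (rt t.1) (rs t.2)).
pose Lam (t : T) : set V := hlattice (k + m%:Z) frame_x (yt t).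
have Wt (t : T) i : W (rt t.1 i) := (rtA t.1 i).1.
have hyp t : hyperbolic (k + m%:Z) frame_x (yt t) by apply: frame_hyperbolic.
have SO (t : T) (i j : 'I_l) : pideal (- co i) (S (rt t.1) (rs t.2) i j).
  have Qt i' : pideal (- co i') (pi ^ (- k) * Q (rt t.1 i')).
    rewrite -[- co i'](addKr k); apply/pideal_scale; exact: (rtA t.1 i').2.
  have sA (i' j' : 'I_l) : (j' < i')%N -> pideal (- co i') (rs t.2 (i', j')).
    by move=> ji; have := rsA t.2 (i', j'); rewrite /As /= ji.
  rewrite /S; case: (ltngtP i j) => [ij|ji|/val_inj ->].
  - have -> : (i == j) = false by apply/negbTE; rewrite -val_eqE /= ltn_eqF.
    have aij := a_homo (ltnW ij).
    apply: pidealB; first by apply: pidealN; apply: pidealW (sA _ _ ij); lia.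
    rewrite -[- co i](addKr k); apply/pideal_scale.
    by apply: (complement_beta hvu (Wt t i) (Wt t j) (rtA t.1 i).2 (rtA t.1 j).2); lia.
  - exact: sA.
  - by rewrite eqxx; apply: pidealN.
have Lam_over t : sublattices_over (Lam t).
  split; first exact: hlattice_maximal.
  - exact: (frame_sub (rtA t.1) (SO t) (hyp t)).
  - exact: hlattice_norm.
  - by move=> c; apply: (frame_lcomb _ (Wt t) (hyp t)).
have -> : ((\prod_i p ^ layer_sum beta d ((a i)%:Z - m%:Z) (a i)) * \prod_(ij : 'I_l * 'I_l) (if (ij.2 < ij.1)%N then p ^ (a ij.2) else 1) = #|{: T}|)%N.
  by rewrite card_prod !card_ord.
apply: (@ncard_inj T (set V) Lam) => [t1 t2 E|].
  (* If two parameters give the same lattice, it contains the differences of their partners. Q of a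
     difference determines t_i modulo its layer; once the t_i agree, the difference is a combination
     of the v_j, whose coordinates determine S below the diagonal. *)
  have D i : pideal (k + m%:Z) (Q (yt t1 i - yt t2 i)) /\ Lam t1 (yt t1 i - yt t2 i).
    have hs : Lam t1 (yt t1 i - yt t2 i).
      apply: submod_sub; first exact: hlattice_submod.
        by case: (hlattice_mem (hyp t1) i).
      by rewrite /Lam in E *; rewrite E; case: (hlattice_mem (hyp t2) i).
    by split=> //; case: hs.
  have yD i : yt t1 i - yt t2 i = pi ^ (co i) *: (rt t1.1 i - rt t2.1 i +
      lcomb v (\row_j (S (rt t1.1) (rs t1.2) i j - S (rt t2.1) (rs t2.2) i j))).
    rewrite -scalerBr; congr (_ *: _).
    have -> : \row_j (S (rt t1.1) (rs t1.2) i j - S (rt t2.1) (rs t2.2) i j) =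
       (\row_j S (rt t1.1) (rs t1.2) i j) - \row_j S (rt t2.1) (rs t2.2) i j.
      by apply/rowP => j; rewrite !mxE.
    rewrite lcombD lcombN [X in X - _]addrC [X in _ - X]addrC opprD addrACA [RHS]addrC.
    by congr (_ + _); rewrite opprD addrACA subrr add0r.
  have Et : t1.1 = t2.1.
    have [t [_ tU]] := rtP _ (rtA t1.1).
    apply: (etrans (esym (tU t1.1 _)) (tU t2.1 _)) => i /=.
      by rewrite subrr ffunE; case: (layer_submod nondeg hvu ((a i)%:Z - co i)).
    have Wd : W (rt t1.1 i - rt t2.1 i).
      by rewrite -scaleN1r addrC; apply: complementZ.
    rewrite !ffunE; split=> //.
    have := (D i).1; rewrite yD quadpZ quadD -[lcomb v _]addr0 -(lcomb0 u) complement_lcomb //.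
    rewrite lcomb0 !addr0 [Q (lcomb _ _)]quad_beta0; last first.
      by rewrite beta_lcombl big1 // => i' _; rewrite (beta_x_lcomb_x hvu) mulr0.
    rewrite !addr0 (_ : k + m%:Z = co i + co i + (k + ((a i)%:Z - co i))); last by lia.
    by move/pideal_scale.
  have Es : t1.2 = t2.2.
    have [t [_ tU]] := rsP _ (rsA t1.2).
    apply: (etrans (esym (tU t1.2 _)) (tU t2.2 _)) => -[i j] /=.
      by rewrite subrr ffunE /Bs; case: ifP => // _; apply: pideal0.
    rewrite !ffunE /Bs /=; case: ifP => // ji.
    have := (D i).2; rewrite yD Et subrr add0r -lcombZ => /(frame_lcomb _ (Wt t1) (hyp t1))/(_ j).
    rewrite !mxE /S ji => h; apply/(pideal_scale (co i)).
    by rewrite (_ : co i + (- co i + (a j)%:Z) = (a j)%:Z); [exact: h|lia].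
  by case: t1 t2 Et Es {E D yD} => [? ?] [? ?] /= -> ->.
(* Conversely, arbitrary partners y0 in M are normalized inside M: [over_lift] moves their
   W-components to the chosen representatives, and then elements of M in the span of the v_j do the
   same for S. *)
apply/seteqP; split=> [M MP|_ [t _ <-] //].
have [Mmax Msub Mnorm Mv] := MP; have [y0 [h0 ME]] := over_hyperbolic MP.
have MS : submod M := maximal_submod Mmax.
have y0v i j : beta (y0 i) (v j) = pi ^ (k + co i) * (j == i)%:R.
  have [_ _ /(_ j i)] := h0; rewrite betaZl [beta (v j) _]betaC => e.
  apply: (mulfI (expz_p_neq0 p_pr (a j)%:Z)); rewrite e mulrA -expz_pD.
  have [->|_] := eqVneq j i; last by rewrite !mulr0.
  by congr (_ ^ _ * _); lia.
have My0 i : M (y0 i) by rewrite ME; case: (hlattice_mem h0 i).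
pose t0 : {ffun 'I_l -> V} := [ffun i => pi ^ (- co i) *: hproj k v u (y0 i)].
have bL z i : M z -> pideal k (beta z (u i)) by move=> /Msub[_ /(_ i)[]].
have Wt0 i : W (t0 i) by rewrite ffunE; apply: complement_scaled; apply: hproj_complement.
have t0A i : lay (- co i) (t0 i).
  split=> //.
  pose S0 i j := pi ^ (- co i) * hcoef k (y0 i) u 0 j.
  have y0E i' : y0 i' = frame_y t0 S0 i' by rewrite {1}(frame_decomp (y0v i')) /frame_y ffunE.
  have : Q (y0 i) = 0 by apply: quad_beta0; case: h0.
  rewrite y0E quad_frame_y // => /eqP; rewrite mulf_eq0 (negbTE (expz_p_neq0 _ _)) /=.
  rewrite addrC addr_eq0 => /eqP ->; apply: pidealN; apply/pideal_scale.
  rewrite /S0 mxE -{1}[- co i]addr0; apply/pideal_scale.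
  by rewrite -{1}(addNr k); apply/pideal_scale; apply: bL.
have [i1 [i1P _]] := rtP t0 t0A.
have lam_ex i : exists c, M (pi ^ (co i) *: (rt i1 i - t0 i) + lcomb v c).
  have hi : lay ((a i)%:Z - co i) (t0 i - rt i1 i) by have := i1P i; rewrite !ffunE.
  apply: (over_lift h0 ME); have e : m%:Z = co i + co i + ((a i)%:Z - co i) by lia.
  rewrite {1}e; have [_ sc] := layer_scale nondeg k v u (co i) ((a i)%:Z - co i) (rt i1 i - t0 i).
  apply: sc; rewrite -[_ - t0 i]opprB; exact: (submodN (layer_submod nondeg hvu _) hi).
have [lam lamP] := choice lam_ex.
pose y1 i := y0 i + (pi ^ (co i) *: (rt i1 i - t0 i) + lcomb v (lam i)).
have My1 i : M (y1 i) := submodD MS (My0 i) (lamP i).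
pose S1 i j : F := pi ^ (- co i) * hcoef k (y0 i) u 0 j + pi ^ (- co i) * lam i 0 j.
have y1E i : y1 i = frame_y (rt i1) S1 i.
  rewrite /y1 {1}(frame_decomp (y0v i)) /frame_y.
  have -> : \row_j S1 i j = \row_j (pi ^ (- co i) * hcoef k (y0 i) u 0 j) +
      pi ^ (- co i) *: lam i by apply/rowP => j; rewrite /S1 !mxE.
  rewrite [t0 i]ffunE; move: (hproj k v u (y0 i)) => H.
  rewrite lcombD lcombZ !scalerDr !scalerN !scalerA expK !scale1r.
  exact: addr_exchange.
have S1O i j : pideal (- co i) (S1 i j).
  have := bL _ j (My1 i); rewrite y1E betaC beta_u_frame_y; last by move=> i'; apply: (rtA i1 i').1.
  by rewrite {1}(_ : k = k + co i + - co i); [move/pideal_scale|lia].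
have Wr i : W (rt i1 i) := (rtA i1 i).1.
have S1A : [set f : {ffun 'I_l * 'I_l -> F} | forall ij, As ij (f ij)] [ffun ij => S1 ij.1 ij.2].
  by move=> [i j]; rewrite /As ffunE /=; case: ifP.
have [i2 [i2P _]] := rsP _ S1A.
pose t : T := (i1, i2).
exists t => //; rewrite /Lam; set y := yt t.
have unscale z (b c : F) : pideal (k + z) (pi ^ k * b + c) -> pideal z (b + pi ^ (- k) * c).
  by move=> h; apply/(pideal_scale k); rewrite mulrDr mulrA expK mul1r.
(* The modulus p^(a_i + a_j - m) is symmetric in i and j, so the congruences below the diagonal pass
   to the entries above it by integrality of beta on M; on the diagonal, integrality of Q is
   used. *)
have SS i j : pideal (- co i + (a j)%:Z) (S (rt i1) (rs i2) i j - S1 i j).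
  have lt (i' j' : 'I_l) : (j' < i')%N -> pideal (- co i' + (a j')%:Z) (S (rt i1) (rs i2) i' j' - S1 i' j').
    move=> ji; have h := i2P (i', j'); rewrite /Bs /= ji in h.
    by rewrite /S ji -[_ - S1 _ _]opprB; apply: pidealN; move: h; rewrite !ffunE.
  have E i' j' : pideal (- co i' + (a j')%:Z) (S1 i' j' + S1 j' i' + pi ^ (- k) * beta (rt i1 i') (rt i1 j')).
    have := norm_beta Mmax Mnorm (My1 i') (My1 j'); rewrite !y1E beta_frame_y //.
    rewrite (_ : k + m%:Z = co i' + co j' + (k + (- co i' + (a j')%:Z))); last by lia.
    by move/pideal_scale/unscale.
  rewrite {1}/S; case: (ltngtP i j) => [ij|ji|/val_inj ijE].
  - have ijF : (i == j) = false by apply/negbTE; rewrite -val_eqE /= ltn_eqF.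
    have e : - co j + (a i)%:Z = - co i + (a j)%:Z by lia.
    have := lt _ _ ij; rewrite /S ij e ijF => h1.
    by rewrite (oppr_shuffle _ _ (S1 j i)); exact: (pidealN (pidealD h1 (E i j))).
  - by have := lt _ _ ji; rewrite {1}/S ji.
  - rewrite -{}ijE eqxx; have := norm_quad Mnorm (My1 i); rewrite y1E quad_frame_y //.
    rewrite (_ : k + m%:Z = co i + co i + (k + (- co i + (a i)%:Z))); last by lia.
    move/pideal_scale/unscale/pidealN => h.
    rewrite (_ : _ - S1 i i = - (S1 i i + pi ^ (- k) * Q (rt i1 i))); first exact: h.
    by rewrite [RHS]opprD [RHS]addrC.
have My i : M (y i).
  have -> : y i = y1 i + lcomb v (\row_j (pi ^ (co i) * (S (rt i1) (rs i2) i j - S1 i j))).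
    rewrite y1E /y /yt /frame_y /=.
    have -> : \row_j (pi ^ (co i) * (S (rt i1) (rs i2) i j - S1 i j)) =
        pi ^ (co i) *: (\row_j S (rt i1) (rs i2) i j - \row_j S1 i j).
      by apply/rowP => j; rewrite !mxE.
    rewrite lcombZ lcombD lcombN -scalerDr; congr (_ *: _).
    by rewrite -[RHS]addrA; congr (_ + _); rewrite addrC subrK.
  apply: submodD => //; apply/Mv => j; rewrite mxE.
  rewrite (_ : (a j)%:Z = co i + (- co i + (a j)%:Z)); last by lia.
  by apply/pideal_scale.
have hy : hyperbolic (k + m%:Z) frame_x y := hyp t.
have [_ Mm] := Mmax; apply: Mm.
- exact: hlattice_lattice.
- move=> z Mz; split=> [|i]; first exact: (norm_quad Mnorm).
  split; last exact: (norm_beta Mmax Mnorm).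
  apply: (norm_beta Mmax Mnorm) => //; rewrite ME; by case: (hlattice_mem h0 i).
- by rewrite Mnorm; apply: hlattice_norm.
Qed.

End FixedIntersection.

(** * Coefficients of the rational functions *)

Local Close Scope classical_set_scope.

Section FormalProducts.
Variable K : fieldType.
Implicit Types (f g : nat -> K) (P Q : {poly K}).

Lemma fps_inv_seqP f n : size (fps_inv_seq f n) = n.+1 /\
  forall i, (i <= n)%N -> (fps_inv_seq f n)`_i = fps_inv f i.
Proof.
elim: n => [|n [sz IHn]]; first by split=> // -[].
split=> [|i]; first by rewrite /= size_rcons sz.
rewrite leq_eqVlt => /predU1P[->//|]; rewrite ltnS => le_in.
by rewrite /= nth_rcons sz ltnS le_in IHn.
Qed.

Lemma fps_invS f n : fps_inv f n.+1 =
  - (f 0%N)^-1 * \sum_(i < n.+1) f (n.+1 - i)%N * fps_inv f i.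
Proof.
have [sz nE] := fps_inv_seqP f n.
rewrite {1}/fps_inv /= nth_rcons sz ltnn eqxx; congr (_ * _).
by apply: eq_bigr => i _; rewrite nE // -ltnS.
Qed.

Definition geometric2 (c : K) (n : nat) : K := if odd n then 0 else c ^+ n./2.

Lemma fps_inv_geometric c : fps_inv (fps_poly (1 - c *: 'X^2)) =1 geometric2 c.
Proof.
have cE j : fps_poly (1 - c *: 'X^2) j = (j == 0%N)%:R - c * (j == 2)%:R.
  by rewrite /fps_poly coefB coef1 coefZ coefXn.
move=> n; elim/ltn_ind: n => -[_|[_|n IHn]].
- by rewrite /fps_inv /= cE eqxx mulr0 subr0 invr1 /geometric2 expr0.
- by rewrite fps_invS big_ord1 [fps_poly _ (1 - _)%N]cE /= mulr0 subr0 mul0r mulr0.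
rewrite fps_invS !cE /= mulr0 subr0 invr1 mulN1r.
rewrite (bigD1 (inord n)) //= inordK // cE subSn ?subSn // subnn /= sub0r mulr1.
rewrite big1 ?addr0 => [|i ni]; first by rewrite mulNr opprK IHn // /geometric2 /= negbK; case: odd; rewrite ?mulr0 // exprS.
rewrite cE; have : (i < n.+2)%N by [].
have /eqP : (i : nat) != n by apply: contraNneq ni => ine; apply/eqP/val_inj; rewrite /= inordK.
move=> ine ilt; have -> : (n.+2 - i == 0)%N = false by apply/negbTE; rewrite subn_eq0 -ltnNge.
have -> : (n.+2 - i == 2)%N = false by apply/negbTE/eqP; lia.
by rewrite mulr0 subr0 mul0r.
Qed.

(** Compares a power series with a polynomial up to degree M, so that products of series can be
    computed in the ring [{poly K}]. *)
Definition agree (M : nat) f P : Prop := forall n, (n <= M)%N -> f n = P`_n.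

Lemma agree_mul M f g P Q : agree M f P -> agree M g Q -> agree M (fps_mul f g) (P * Q).
Proof.
move=> fP gQ n nM; rewrite coefM; apply: eq_bigr => i _.
have iM : (i <= M)%N by apply: leq_trans nM; rewrite -ltnS.
by rewrite fP // gQ // (leq_trans (leq_subr _ _)).
Qed.

Lemma agree_prod M m (f : 'I_m -> nat -> K) (P : 'I_m -> {poly K}) :
  (forall i, agree M (f i) (P i)) -> agree M (fps_prod f) (\prod_i P i).
Proof.
move=> fP; rewrite /fps_prod; elim/big_ind2: _ => // g Q g' Q'.
exact: agree_mul.
Qed.

Lemma agree_poly_prod M (I : finType) (P Q : I -> {poly K}) :
  (forall i, agree M (fps_poly (P i)) (Q i)) ->
  agree M (fps_poly (\prod_i P i)) (\prod_i Q i).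
Proof.
move=> PQ; elim/big_ind2: _ => // A B A' B' AB A'B' n nM.
by rewrite /fps_poly coefM -(agree_mul AB A'B' nM) /fps_mul.
Qed.

Lemma coef_prod_trunc M m (k : 'I_m -> nat -> K) :
  (\prod_i \poly_(n < M.+1) k i n)`_M =
  \sum_(d : {ffun 'I_m -> 'I_M.+1} | \sum_i (d i : nat) == M) \prod_i k i (d i).
Proof.
under eq_bigr do rewrite poly_def.
rewrite bigA_distr_bigA coef_sum (bigID (fun d : {ffun 'I_m -> 'I_M.+1} => \sum_i (d i : nat) == M)) /=.
have E (d : {ffun 'I_m -> 'I_M.+1}) : (\prod_i (k i (d i) *: 'X^(d i)))`_M =
    (\prod_i k i (d i)) * (M == \sum_i (d i : nat))%:R.
  by rewrite scaler_prod prodrXr coefZ coefXn.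
rewrite [X in _ + X]big1 ?addr0 => [|d dM]; last by rewrite E eq_sym (negbTE dM) mulr0.
by apply: eq_bigr => d /eqP dM; rewrite E dM eqxx mulr1.
Qed.

End FormalProducts.

Section SubsetSums.
Variables (K : fieldType) (I : finType).

Lemma sum_signed_subsets (D : {set I}) :
  \sum_(S : {set I} | S \subset D) (-1) ^+ #|S| = (D == finset.set0)%:R :> K.
Proof.
transitivity (\prod_i ((if i \in D then -1 else 0) + 1) : K).
  rewrite bigA_distr [RHS](bigID (fun S : {set I} => S \subset D)) /=.
  rewrite [X in _ = _ + X]big1 ?addr0 => [|S SD]; last first.
    have [i iS iD] := fintype.subsetPn SD.
    by rewrite (bigD1 i) //= iS (negbTE iD) mul0r.
  apply: eq_bigr => S /fintype.subsetP SD.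
  by rewrite -big_mkcond /= -prodr_const; apply: eq_bigr => i /SD ->.
have [->|[i iD]] := set_0Vmem D.
  by rewrite eqxx big1 // => i _; rewrite inE add0r.
rewrite (bigD1 i) //= iD addNr mul0r; case: eqP => // D0.
by rewrite D0 inE in iD.
Qed.

(** After exchanging the sums, the coefficient of [phi J] is a signed sum over the subsets of H
    minus J, which vanishes unless J = H. *)
Lemma moebius_subsets (phi : {set I} -> K) (H : {set I}) :
  \sum_(S : {set I} | S \subset H)
    \sum_(J : {set I} | J \subset S) (-1) ^+ #|S :\: J| * phi J = phi H.
Proof.
rewrite (exchange_big_dep (fun J : {set I} => J \subset H)) /=; last first.
  by move=> S J SH JS; apply: fintype.subset_trans JS SH.
transitivity (\sum_(J : {set I} | J \subset H) phi J * (H :\: J == finset.set0)%:R).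
  apply: eq_bigr => J JH; rewrite -sum_signed_subsets mulr_sumr.
  rewrite (reindex_onto (fun S => S :|: J) (fun S => S :\: J)) /=; last first.
    move=> S /andP[_ /fintype.subsetP JS]; apply/setP => i; rewrite !inE.
    by have := JS i; case: (i \in J) => [/(_ isT) ->|_] //=; rewrite ?orbF.
  apply: eq_big => [S|S /andP[_ /eqP SE]]; last by rewrite SE mulrC.
  rewrite finset.subUset JH andbT finset.subsetUr andbT; apply/andP/idP => [[SH /eqP SE]|].
    rewrite finset.subsetD SH /=; apply/finset.setDidPl.
    by rewrite -{1}SE finset.setDDl finset.setUid SE.
  rewrite finset.subsetD => /andP[SH /finset.setDidPl SJ]; split=> //.
  by rewrite finset.setDUl finset.setDv finset.setU0 SJ.
rewrite (bigD1 H) //= finset.setDv eqxx mulr1 big1 ?addr0 // => J /andP[JH JneH].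
case: eqP => [/eqP|_]; last by rewrite mulr0.
by rewrite finset.setD_eq0 => HJ; rewrite finset.eqEsubset JH HJ in JneH.
Qed.

(** I0 and I1 are the parts of H inside and outside J, so the double sum in the definition of U
    becomes a sum over one subset. As J lies in S, the restriction to S only concerns I1. *)
Lemma sum_split_subsets (J P S : {set I}) (w : {set I} -> K) : J \subset S ->
  \sum_(I0 : {set I} | I0 \subset J :&: P)
   \sum_(I1 : {set I} | (I1 \subset P :\: J) && (I1 \subset S)) w (I0 :|: I1) =
  \sum_(H : {set I} | H \subset P :&: S) w H.
Proof.
move=> JS; rewrite pair_big_dep /=.
rewrite (reindex (fun H : {set I} => (H :&: J, H :\: J))) /=.
  apply: eq_big => [H|H _]; last by rewrite finset.setID.
  apply/and3P/fintype.subsetP => [[h1 h2 h3] i iH|h].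
    rewrite inE; have [iJ|iJ] := boolP (i \in J).
      have := fintype.subsetP h1 i; rewrite !inE iH iJ => /(_ isT) /= ->.
      exact: (fintype.subsetP JS).
    have := fintype.subsetP h2 i; have := fintype.subsetP h3 i.
    by rewrite !inE iH (negbTE iJ) /= => /(_ isT) -> /(_ isT) ->.
  split; apply/fintype.subsetP => i; rewrite !inE.
  - by case/andP => /h; rewrite inE => /andP[-> _] ->.
  - by case/andP => -> /h; rewrite inE => /andP[-> _].
  - by case/andP => _ /h; rewrite inE => /andP[_ ->].
exists (fun s : {set I} * {set I} => s.1 :|: s.2) => [H _|[I0 I1]] /=; first exact: finset.setID.
rewrite inE /= => /and3P[/fintype.subsetP h0 /fintype.subsetP h1 _].
congr (_, _); apply/setP => i; rewrite !inE.
  have := h0 i; have := h1 i; rewrite !inE.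
  by case: (i \in I0) => [_ /(_ isT)/andP[-> _]//|]; case: (i \in I1) => // /(_ isT)/andP[/negbTE->].
have := h0 i; have := h1 i; rewrite !inE.
case: (i \in I1) => [/(_ isT)/andP[-> _] _|_]; first by rewrite orbT.
by case: (i \in I0) => [/(_ isT)/andP[-> _]|_] //=; rewrite andbF.
Qed.

End SubsetSums.

Section GeneratingFunction.
Variables (K : fieldType) (l : nat).
Variables (x : 'I_l -> K) (w : {set 'I_l} -> K) (b : {set 'I_l} -> K).
Variable eps : bool.

(** The added index l has weight 1 and belongs to the factor r = 0 of the denominator; in general
    index i belongs to r = l - i. *)
Definition xext (i : 'I_l.+1) : K := if unlift ord_max i is Some j then x j else 1.

(* W^(0) (eps = false) and W^(1) (eps = true) with X^A, X^B, ... replaced by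
   indeterminate weights x_i and b_J. *)
Definition Wgen : {poly K} :=
  \sum_(J : {set 'I_l}) b J *:
    \sum_(I0 : {set 'I_l} | I0 \subset J :&: @posI l)
    \sum_(I1 : {set 'I_l} | I1 \subset @posI l :\: J)
      (w (I0 :|: I1) * ((\prod_(i in J) x i) * (\prod_(i in I1) x i) ^+ 2)) *:
        'X^(#|J| + 2 * #|I1| + (odd #|J| (+) eps)).

Definition dodd M (d : {ffun 'I_l.+1 -> 'I_M.+1}) : {set 'I_l} :=
  [set i | odd (d (lift ord_max i))].
Definition dpos M (d : {ffun 'I_l.+1 -> 'I_M.+1}) : {set 'I_l} :=
  [set i | (0 < d (lift ord_max i))%N].

Variable M : nat.
Local Notation D := {ffun 'I_l.+1 -> 'I_M.+1}.

(** The power of T carried by index i in the monomial of (J, I1): 1 on J, 2 on I1, and at the added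
    index l the correction that gives the total degree the parity eps. *)
Let e (J I1 : {set 'I_l}) (i : 'I_l.+1) : nat :=
  if unlift ord_max i is Some j then ((j \in J) + 2 * (j \in I1))%N
  else (odd #|J| (+) eps).

(** The coefficient of T^n in (x_i T)^e / (1 - x_i^2 T^2), where e is the exponent above. *)
Let kap (J I1 : {set 'I_l}) (i : 'I_l.+1) (n : nat) : K :=
  if (e J I1 i <= n)%N && (odd n == odd (e J I1 i)) then xext i ^+ n else 0.

Let big_lift_max (T : Type) (idx : T) (op : Monoid.com_law idx) (f : 'I_l.+1 -> T) :
  \big[op/idx]_i f i = op (\big[op/idx]_(i < l) f (lift ord_max i)) (f ord_max).
Proof.
rewrite big_ord_recr /=; congr (op _ _); apply: eq_bigr => i _; congr f.
by apply: val_inj; rewrite /= /bump leqNgt ltn_ord.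
Qed.

Let e_lift J I1 j : e J I1 (lift ord_max j) = ((j \in J) + 2 * (j \in I1))%N.
Proof. by rewrite /e liftK. Qed.
Let e_max J I1 : e J I1 ord_max = (odd #|J| (+) eps).
Proof. by rewrite /e unlift_none. Qed.
Let x_lift j : xext (lift ord_max j) = x j. Proof. by rewrite /xext liftK. Qed.
Let x_max : xext ord_max = 1. Proof. by rewrite /xext unlift_none. Qed.

Let monomial_prod (J I1 : {set 'I_l}) :
  ((\prod_(i in J) x i) * (\prod_(i in I1) x i) ^+ 2) *:
    'X^(#|J| + 2 * #|I1| + (odd #|J| (+) eps)) =
  \prod_(i < l.+1) (xext i ^+ e J I1 i *: 'X^(e J I1 i)).
Proof.
rewrite scaler_prod prodrXr; congr (_ *: 'X^_).
  rewrite big_lift_max /= x_max expr1n mulr1 -prodrXl.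
  rewrite [X in X * _]big_mkcond [X in _ * X]big_mkcond -big_split; apply: eq_bigr => i _ /=.
  rewrite x_lift e_lift exprD; congr (_ * _); first by case: ifP.
  by case: ifP; rewrite ?muln1 ?muln0.
rewrite (big_lift_max addn) /= e_max; congr (_ + _)%N.
under eq_bigr do rewrite e_lift.
by rewrite big_split -big_distrr /= -!sum1_card [X in (X + _)%N]big_mkcond [X in (_ + 2 * X)%N]big_mkcond.
Qed.

Let coef_factor J I1 i : agree M
  (fps_poly ((\poly_(n < M.+1) geometric2 (xext i ^+ 2) n) * (xext i ^+ e J I1 i *: 'X^(e J I1 i))))
  (\poly_(n < M.+1) kap J I1 i n).
Proof.
move=> n nM; rewrite /fps_poly -scalerAr coefZ coefMXn !coef_poly !ltnS nM /kap.
case: ltnP => [lt|le] /=; first by rewrite mulr0.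
rewrite (leq_trans (leq_subr _ _) nM) /geometric2 oddB //.
case: (odd n) (odd_double_half n); case: (odd (e J I1 i)) (odd_double_half (e J I1 i)) => /= h1 h2; rewrite ?mulr0 //;
by rewrite -exprM -exprD; congr (_ ^+ _); lia.
Qed.

(** Outside J the exponent d_j is even, so that d_j >= 2, as required on I1, only means d_j > 0.
    Hence d determines J and confines I1 to its support. *)
Let kap_prod (J I1 : {set 'I_l}) (d : D) : I1 \subset @posI l :\: J ->
  \prod_(i < l.+1) kap J I1 i (d i) =
  if [&& J == dodd d, I1 \subset dpos d & odd (d ord_max) == odd #|J| (+) eps]
  then \prod_(j < l) x j ^+ d (lift ord_max j) else 0.
Proof.
move=> /fintype.subsetP I1J; rewrite big_lift_max /=.
have kmax : kap J I1 ord_max (d ord_max) = (odd (d ord_max) == odd #|J| (+) eps)%:R.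
  rewrite /kap e_max x_max expr1n oddb.
  by case: (odd #|J| (+) eps) (nat_of_ord (d ord_max)) => -[|n] //=; case: odd.
have klift j : kap J I1 (lift ord_max j) (d (lift ord_max j)) =
   if ((j \in J) == odd (d (lift ord_max j))) && ((j \in I1) ==> (0 < d (lift ord_max j))%N)
   then x j ^+ d (lift ord_max j) else 0.
  rewrite /kap e_lift x_lift; congr (if _ then _ else _).
  have h : (j \in I1) -> (j \in J) = false.
    by move=> /I1J; rewrite inE => /andP[/negbTE].
  move: h; case: (j \in I1) => [/(_ isT) ->|_] /=; last first.
    by case: (nat_of_ord (d _)) => [|n] //=; case: (j \in J) => //=; case: odd.
  by case: (nat_of_ord (d _)) => [|[|n]] //=; rewrite ?negbK; case: odd.
rewrite kmax; case: eqP => [_|_]; last by rewrite mulr0 !andbF.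
rewrite mulr1 andbT; case: andP => [[/eqP JE /fintype.subsetP Id]|h].
  apply: eq_bigr => j _; rewrite klift {1}JE inE eqxx /=.
  by case: implyP => // h; case: h => /Id; rewrite inE.
have [j hj] : exists j, ~~ (((j \in J) == odd (d (lift ord_max j))) &&
    ((j \in I1) ==> (0 < d (lift ord_max j))%N)).
  apply: contrapT => nh; apply: h; split.
    apply/eqP/setP => j; rewrite inE; apply/eqP; apply: contrapT => /negP hj.
    by apply: nh; exists j; rewrite (negbTE hj).
  apply/fintype.subsetP => j jI; rewrite inE; apply: contrapT => /negP hj.
  by apply: nh; exists j; rewrite jI /= (negbTE hj) andbF.
by rewrite (bigD1 j) //= klift (negbTE hj) mul0r.
Qed.

(** The product over i expands into a sum over exponent vectors d of total M. For each d only J =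
    [dodd d] survives, and the sums over I0 and I1 merge into one. *)
Lemma coef_Wgen (c : 'I_l.+1 -> K) : (forall r, c r = xext (rev_ord r) ^+ 2) ->
  fps_mul (fps_prod (fun r => fps_inv (fps_poly (1 - c r *: 'X^2)))) (fps_poly Wgen) M =
  if odd M == eps then
    \sum_(d : D | \sum_i (d i : nat) == M)
      (\prod_(j < l) x j ^+ d (lift ord_max j)) * b (dodd d) *
      \sum_(H : {set 'I_l} | H \subset @posI l :&: dpos d) w H
  else 0.
Proof.
move=> cE; pose G := \prod_i \poly_(n < M.+1) geometric2 (xext i ^+ 2) n.
have den : agree M (fps_prod (fun r => fps_inv (fps_poly (1 - c r *: 'X^2)))) G.
  rewrite /G (reindex_inj rev_ord_inj) /=; apply: agree_prod => r n nM.
  by rewrite fps_inv_geometric coef_poly ltnS nM cE.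
rewrite (agree_mul den (_ : agree M (fps_poly Wgen) Wgen) (leqnn M)) //.
have mono (J I1 : {set 'I_l}) : (G * (((\prod_(i in J) x i) * (\prod_(i in I1) x i) ^+ 2) *:
     'X^(#|J| + 2 * #|I1| + (odd #|J| (+) eps))))`_M =
   \sum_(d : D | \sum_i (d i : nat) == M) \prod_(i < l.+1) kap J I1 i (d i).
  rewrite monomial_prod -big_split /= -coef_prod_trunc.
  exact: (agree_poly_prod (coef_factor J I1) (leqnn M)).
transitivity (\sum_(J : {set 'I_l}) \sum_(I0 : {set 'I_l} | I0 \subset J :&: @posI l)
    \sum_(I1 : {set 'I_l} | I1 \subset @posI l :\: J)
    \sum_(d : D | \sum_i (d i : nat) == M)
      b J * (w (I0 :|: I1) * \prod_(i < l.+1) kap J I1 i (d i))).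
  rewrite /Wgen mulr_sumr coef_sum; apply: eq_bigr => J _.
  rewrite -scalerAr coefZ mulr_sumr coef_sum mulr_sumr; apply: eq_bigr => I0 _.
  rewrite mulr_sumr coef_sum mulr_sumr; apply: eq_bigr => I1 _.
  by rewrite -scalerA -scalerAr coefZ mono -!mulr_sumr.
transitivity (\sum_(d : D | \sum_i (d i : nat) == M) \sum_(J : {set 'I_l})
   \sum_(I0 : {set 'I_l} | I0 \subset J :&: @posI l)
    \sum_(I1 : {set 'I_l} | I1 \subset @posI l :\: J)
      b J * (w (I0 :|: I1) * \prod_(i < l.+1) kap J I1 i (d i))).
  rewrite exchange_big /=; apply: eq_bigr => J _; rewrite [RHS]exchange_big /=.
  by apply: eq_bigr => I0 _; rewrite [RHS]exchange_big.
(* The total M fixes the parity of the last exponent, so the condition at the added index becomes a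
   condition on M alone. *)
have par (d : D) : \sum_i (d i : nat) == M -> odd (d ord_max) = odd M (+) odd #|dodd d|.
  move=> /eqP dM; rewrite -[in odd M]dM (big_lift_max addn) /= oddD -addbA addbC -addbA.
  rewrite (_ : odd (\sum_(i < l) d (lift ord_max i)) = odd #|dodd d|) ?addbb ?addbF //.
  rewrite -sum1_card [in RHS]big_mkcond /=.
  apply: (big_ind2 (fun a b : nat => odd a = odd b)) => // [? ? ? ? e1 e2|i _].
    by rewrite !oddD e1 e2.
  by rewrite inE; case: odd.
have stepd (d : D) : \sum_i (d i : nat) == M ->
   \sum_(J : {set 'I_l}) \sum_(I0 : {set 'I_l} | I0 \subset J :&: @posI l)
    \sum_(I1 : {set 'I_l} | I1 \subset @posI l :\: J)
      b J * (w (I0 :|: I1) * \prod_(i < l.+1) kap J I1 i (d i)) =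
   if odd M == eps then (\prod_(j < l) x j ^+ d (lift ord_max j)) * b (dodd d) *
      \sum_(H : {set 'I_l} | H \subset @posI l :&: dpos d) w H else 0.
  move=> dM; rewrite (bigD1 (dodd d)) //= [X in _ + X]big1 ?addr0; last first.
    move=> J JE; apply: big1 => I0 _; apply: big1 => I1 I1s.
    by rewrite kap_prod // (negbTE JE) !mulr0.
  have cond : (odd (d ord_max) == odd #|dodd d| (+) eps) = (odd M == eps).
    by rewrite (par d dM); case: (odd M); case: (odd #|_|); case: eps.
  have doddpos : dodd d \subset dpos d.
    by apply/fintype.subsetP => i; rewrite !inE; case: (nat_of_ord _).
  rewrite -(sum_split_subsets _ w doddpos); case: ifP => Me; last first.
    apply: big1 => I0 _; apply: big1 => I1 I1s.
    by rewrite kap_prod // cond Me !andbF !mulr0.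
  rewrite mulr_sumr; apply: eq_bigr => I0 _; rewrite mulr_sumr.
  rewrite [RHS]big_mkcondr; apply: eq_bigr => I1 I1s; rewrite kap_prod // eqxx cond Me andbT /=.
  case: ifP => _; last by rewrite !mulr0.
  by rewrite mulrA mulrC mulrA.
case: ifP => Me; last by apply: big1 => d dM; rewrite stepd // Me.
by apply: eq_bigr => d dM; rewrite stepd // Me.
Qed.

End GeneratingFunction.

Local Open Scope classical_set_scope.

(** * Convergence *)

Section Limits.
Variable K : numFieldType.
Implicit Types (u a : nat -> K) (c s z : K).

Definition tends u s : Prop :=
  forall e, 0 < e -> exists M, forall n, (M <= n)%N -> `|u n - s| < e.

Lemma tendsD u u' s s' : tends u s -> tends u' s' -> tends (fun n => u n + u' n) (s + s').
Proof.
move=> us us' e e0; have e2 : 0 < e / 2%:R by rewrite divr_gt0 ?ltr0n.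
have [[M hM] [M' hM']] := (us _ e2, us' _ e2).
exists (maxn M M') => n; rewrite geq_max => /andP[Mn M'n].
rewrite opprD addrACA (le_lt_trans (ler_normD _ _)) // [e]splitr.
by apply: ltrD; [apply: hM|apply: hM'].
Qed.

Lemma tendsZ c u s : tends u s -> tends (fun n => c * u n) (c * s).
Proof.
move=> us e e0; have c1 : 0 < `|c| + 1 by rewrite ltr_wpDl.
have [M hM] := us (e / (`|c| + 1)) (divr_gt0 e0 c1).
exists M => n /hM; rewrite -mulrBr normrM ltr_pdivlMr // mulrC; apply: le_lt_trans.
by rewrite ler_wpM2r // lerDl ler01.
Qed.

Hypothesis arch : forall c E e : K, `|c| < 1 -> 0 <= E -> 0 < e ->
  exists k, `|c| ^+ k * E < e.

(** The distance to the limit shrinks by the factor |c| every two steps, and the new errors, kept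
    below (e / 2)(1 - |c|), accumulate to at most e / 2. *)
Lemma tends_recurrence u a c s : (forall n, u n.+2 = a n.+2 + c * u n) ->
  tends a s -> `|c| < 1 -> tends u (s / (1 - c)).
Proof.
move=> uE as_ c1 e e0.
have c0 : 1 - c != 0.
  by rewrite subr_eq0; apply: contraTneq c1 => <-; rewrite normr1 ltxx.
pose t := s / (1 - c); have tE : t = s + c * t.
  by apply/eqP; rewrite -subr_eq -[X in X - _]mul1r -mulrBl mulrC /t divfK.
pose D n := `|u n - t|; have c1' : 0 < 1 - `|c| by rewrite subr_gt0.
have e2 : 0 < e / 2%:R by rewrite divr_gt0 ?ltr0n.
have [M hM] := as_ _ (mulr_gt0 e2 c1').
have Dn n : (M <= n)%N -> D n.+2 <= e / 2%:R * (1 - `|c|) + `|c| * D n.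
  move=> Mn; rewrite /D uE {1}tE opprD addrACA -mulrBr (le_trans (ler_normD _ _)) //.
  by rewrite normrM lerD2r ltW // hM // (leq_trans Mn) // -addn2 leq_addr.
have Dk k n : (M <= n)%N -> D (n + k.*2)%N <= e / 2%:R + `|c| ^+ k * D n.
  move=> Mn; elim: k => [|k IHk]; first by rewrite addn0 mul1r lerDr ltW.
  rewrite doubleS !addnS; apply: le_trans (Dn _ _) _; first by rewrite (leq_trans Mn) ?leq_addr.
  rewrite -lerBrDl; apply: le_trans (ler_wpM2l (normr_ge0 c) IHk) _.
  rewrite exprS le_eqVlt; apply/predU1P; left.
  by move: (e / 2%:R) (D n) => e' x; ring.
have DM0 : 0 <= D M + D M.+1 by apply: addr_ge0; apply: normr_ge0.
have [k hk] := arch c1 DM0 e2.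
exists (M + k.*2)%N => n Mn; rewrite -/t -/(D n).
(* The recurrence advances by two, so n is reached from M or from M + 1; hence the bound by D M + D
   M.+1. *)
pose r := odd (n - M); pose j := (n - M)./2.
have nE : n = (M + r + j.*2)%N by rewrite -addnA odd_double_half subnKC // (leq_trans _ Mn) ?leq_addr.
have kj : (k <= j)%N by rewrite /j -[k]doubleK half_leq // leq_subRL // (leq_trans _ Mn) ?leq_addr.
rewrite nE (le_lt_trans (Dk _ _ (leq_addr _ _))) // [X in _ < X]splitr ltrD2l.
apply: le_lt_trans hk; apply: ler_pM.
- exact: exprn_ge0.
- exact: normr_ge0.
- by apply: ler_wiXn2l => //; apply: ltW.
- by case: (r) => /=; rewrite ?addn1 ?addn0 ?lerDr ?lerDl; apply: normr_ge0.
Qed.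

Definition psum z a (M : nat) : K := \sum_(0 <= i < M) a i * z ^+ i.

Lemma fps_mul_geometric c a n :
  [/\ fps_mul (geometric2 c) a 0 = a 0%N, fps_mul (geometric2 c) a 1 = a 1%N &
      fps_mul (geometric2 c) a n.+2 = a n.+2 + c * fps_mul (geometric2 c) a n].
Proof.
have E k : fps_mul (geometric2 c) a k = \sum_(0 <= i < k.+1) geometric2 c i * a (k - i)%N.
  by rewrite big_mkord.
rewrite !E; split; first by rewrite big_nat1 subn0 /geometric2 /= mul1r.
  by rewrite big_nat_recl // big_nat1 /geometric2 /= mul1r mul0r addr0.
rewrite 2?big_nat_recl // [geometric2 c 0]/geometric2 [geometric2 c 1]/geometric2 /= expr0 mul1r mul0r add0r.
congr (_ + _); rewrite big_distrr /=; apply: eq_bigr => i _.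
rewrite !subSS mulrA; congr (_ * _); rewrite /geometric2 /= negbK.
by case: odd; rewrite ?mulr0 // exprS.
Qed.

(** Multiplication by 1 / (1 - c T^2) makes the partial sums at z satisfy the recurrence of
    [tends_recurrence] with ratio c z^2. *)
Lemma tends_geometric c z a s : tends (psum z a) s -> `|c * z ^+ 2| < 1 ->
  tends (psum z (fps_mul (geometric2 c) a)) (s / (1 - c * z ^+ 2)).
Proof.
move=> as_ c1; apply: tends_recurrence as_ c1 => M.
have [b0 b1 _] := fps_mul_geometric c a 0.
rewrite /psum 4?big_nat_recl // b0 b1 -!addrA; congr (_ + (_ + _)).
rewrite big_distrr -big_split /=; apply: eq_bigr => i _.
have [_ _ ->] := fps_mul_geometric c a i.
by rewrite mulrDl; congr (_ + _); rewrite !exprS expr0 mulr1; ring.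
Qed.

Lemma tends_poly z (W : {poly K}) : tends (psum z (fps_poly W)) W.[z].
Proof.
move=> e e0; exists (size W) => n szn.
by rewrite /psum big_mkord (horner_coef_wide _ szn) subrr normr0.
Qed.

End Limits.

Section FormalAssociativity.
Variable K : fieldType.

Lemma fps_mulA (a b c : nat -> K) : fps_mul (fps_mul a b) c = fps_mul a (fps_mul b c).
Proof.
apply/funext => n.
have tr (f : nat -> K) : agree n f (\poly_(i < n.+1) f i).
  by move=> i iN; rewrite coef_poly ltnS iN.
rewrite (agree_mul (agree_mul (tr a) (tr b)) (tr c) (leqnn n)) -mulrA.
by rewrite -(agree_mul (tr a) (agree_mul (tr b) (tr c)) (leqnn n)).
Qed.

Lemma fps_mul1 (a : nat -> K) : fps_mul (fps_poly 1) a = a.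
Proof.
apply/funext => n; rewrite /fps_mul big_ord_recl /= subn0 /fps_poly coef1 mul1r big1 ?addr0 //.
by move=> i _; rewrite coef1 mul0r.
Qed.

End FormalAssociativity.

Lemma tends_fps_prod (K : numFieldType) m (c : 'I_m -> K) (a : nat -> K) (z s : K) :
  (forall c E e : K, `|c| < 1 -> 0 <= E -> 0 < e -> exists k, `|c| ^+ k * E < e) ->
  tends (psum z a) s -> (forall r, `|c r * z ^+ 2| < 1) ->
  tends (psum z (fps_mul (fps_prod (fun r => fps_inv (fps_poly (1 - c r *: 'X^2)))) a))
    ((\prod_r (1 - c r * z ^+ 2)^-1) * s).
Proof.
move=> arch as_; elim: m c => [|m IHm] c c1.
  by rewrite /fps_prod !big_ord0 fps_mul1 mul1r.
rewrite /fps_prod !big_ord_recl fps_mulA -mulrA mulrC.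
rewrite (_ : fps_inv _ = geometric2 (c ord0)); last exact/funext/fps_inv_geometric.
by apply: (tends_geometric arch _ (c1 _)); apply: IHm.
Qed.

Section SumByLevels.
Variables (R : realType) (T : choiceType) (lev : T -> nat) (N : nat -> nat).
Hypothesis levN : forall m, finite_set [set t | lev t = m] /\ ncard [set t | lev t = m] = N m.

Lemma count_level (s : seq T) m : uniq s ->
  (count (fun t => lev t == m) s <= N m)%N /\
  ((forall t, lev t = m -> t \in s) -> count (fun t => lev t == m) s = N m).
Proof.
move=> us; have [fin <-] := levN m; rewrite /ncard -size_filter.
have us' := filter_uniq (fun t => lev t == m) us.
have memE t : (t \in fset_set [set t | lev t = m]) = (lev t == m).
  by rewrite in_fset_set //; apply/idP/eqP => [/set_mem|/mem_set].
have le : (size [seq t <- s | lev t == m] <= #|` fset_set [set t | lev t = m]|)%N.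
  by apply: uniq_leq_size => // t; rewrite mem_filter memE => /andP[].
split=> // ms; apply/eqP; rewrite eqn_leq le /=; apply: uniq_leq_size; first exact: fset_uniq.
by move=> t; rewrite memE mem_filter => /eqP tm; rewrite tm eqxx ms.
Qed.

Lemma sum_by_levels (K : nzRingType) (g : nat -> K) (s : seq T) M : (forall t, t \in s -> (lev t < M)%N) ->
  \sum_(t <- s) g (lev t) = \sum_(0 <= m < M) (count (fun t => lev t == m) s)%:R * g m.
Proof.
elim: s => [|t s IHs] sM; first by rewrite big_nil big1 // => m _; rewrite mul0r.
rewrite big_cons IHs => [|t' t's]; last by apply: sM; rewrite inE t's orbT.
under [in RHS]eq_bigr => m _ do rewrite /= natrD mulrDl.
rewrite big_split /=; congr (_ + _).
rewrite big_mkord (bigD1 (Ordinal (sM t (mem_head _ _)))) //= eqxx mul1r big1 ?addr0 // => m mt.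
case: eqP => [tm|_]; last by rewrite mul0r.
by case/eqP: mt; apply: val_inj.
Qed.

Lemma level_bound (s : seq T) M0 : exists2 M, (M0 <= M)%N & forall t, t \in s -> (lev t < M)%N.
Proof.
elim: s => [|t s [M M0M hM]]; first by exists M0.
exists (maxn M (lev t).+1) => [|t']; first by rewrite leq_max M0M.
by rewrite inE leq_max => /predU1P[->|/hM ->] //; rewrite leqnn orbT.
Qed.

Lemma finite_levels M : finite_set [set t | (lev t < M)%N].
Proof.
elim: M => [|M IHM]; first by rewrite (_ : [set _ | _] = set0) //; apply/seteqP; split.
rewrite (_ : [set _ | _] = [set t | (lev t < M)%N] `|` [set t | lev t = M]).
  by rewrite finite_setU; split=> //; case: (levN M).
apply/seteqP; split=> t /=; last by rewrite ltnS => -[/ltnW|->].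
by rewrite ltnS leq_eqVlt => /predU1P[]; [right|left].
Qed.

(** The sum over a finite set containing all elements of level below M0 differs from a later partial
    sum over levels by at most a tail of the series of absolute values. Convergence of that series
    thus allows summation in any order. *)
Lemma partial_sum_levels (g : nat -> R[i]) (f : T -> R[i]^o) (s s' : R[i]) :
  (forall t, f t = g (lev t)) ->
  tends (fun M => \sum_(0 <= m < M) (N m)%:R * g m) s ->
  tends (fun M => \sum_(0 <= m < M) (N m)%:R * `|g m|) s' ->
  partial_sum f @ totally --> (s : R[i]^o).
Proof.
move=> fg gs gs'; have FF : Filter (@totally T) by have [] := @totally_filter T.
apply/cvgrPdist_lt => e e0.
have e2 : 0 < e / 2%:R by rewrite divr_gt0 ?ltr0n.
have e4 : 0 < e / 2%:R / 2%:R by rewrite divr_gt0 ?ltr0n.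
have [[M1 h1] [M2 h2]] := (gs _ e2, gs' _ e4).
pose M0 := maxn M1 M2; pose X := fset_set [set t | (lev t < M0)%N].
exists X => // B XB; rewrite /= /partial_sum -(big_seq_fsetE _ _ xpredT f) /=.
have [M M0M hM] := level_bound (enum_fset B) M0.
have sE : \sum_(t <- B) f t = \sum_(0 <= m < M) (count (fun t => lev t == m) B)%:R * g m.
  by rewrite -(sum_by_levels _ hM); apply: eq_bigr => t _.
pose cnt m := count (fun t => lev t == m) B.
have cle m : (cnt m <= N m)%N by case: (count_level m (fset_uniq B)).
have ceq m : (m < M0)%N -> cnt m = N m.
  move=> mM; case: (count_level m (fset_uniq B)) => _; apply=> t tm.
  apply: (fsubsetP XB); rewrite in_fset_set; last exact: finite_levels.
  by apply: mem_set; rewrite /= tm.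
rewrite distrC sE -(subrKA (\sum_(0 <= m < M) (N m)%:R * g m)) (le_lt_trans (ler_normD _ _)) //.
rewrite [e]splitr; apply: ltr_leD; last first.
  by rewrite ltW // h1 // (leq_trans _ M0M) // leq_maxl.
rewrite -sumrB; apply: le_lt_trans (ler_norm_sum _ _ _) _.
have tail : \sum_(0 <= m < M) `|(cnt m)%:R * g m - (N m)%:R * g m| <=
   \sum_(0 <= m < M) (N m)%:R * `|g m| - \sum_(0 <= m < M0) (N m)%:R * `|g m|.
  rewrite (big_cat_nat _ M0M) //= big_nat big1 ?add0r => [|m /andP[_ mM]]; last first.
    by rewrite ceq // subrr normr0.
  rewrite [X in _ <= X - _](big_cat_nat (leq0n M0) M0M) /= addrAC subrr add0r; apply: ler_sum => m _.
  rewrite -mulrBl normrM ler_wpM2r // distrC -natrB // normr_nat ler_nat.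
  exact: leq_subr.
apply: le_lt_trans tail _; set P := \sum_(0 <= m < M) _; set P0 := \sum_(0 <= m < M0) _.
have PP0 : P - P0 \is Num.real.
  by rewrite realB // ger0_real // sumr_ge0 // => m _; rewrite mulr_ge0.
apply: le_lt_trans (real_ler_norm PP0) _.
rewrite -(subrKA s') (le_lt_trans (ler_normD _ _)) // [e / _]splitr.
apply: ltrD; first by apply: h2; rewrite (leq_trans _ M0M) // leq_maxr.
by rewrite distrC; apply: h2; rewrite leq_maxr.
Qed.

End SumByLevels.

Lemma complex_archimedean (R : realType) (c E e : R[i]) : `|c| < 1 -> 0 <= E -> 0 < e ->
  exists k, `|c| ^+ k * E < e.
Proof.
move=> c1 E0 e0.
have [x cE] : exists x, `|c| = x%:C%C by exists (complex.Re `|c|); rewrite RRe_real ?normr_real.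
have [y yE] : exists y, E = y%:C%C by exists (complex.Re E); rewrite RRe_real ?ger0_real.
have [z zE] : exists z, e = z%:C%C by exists (complex.Re e); rewrite RRe_real ?gtr0_real.
rewrite cE yE zE; have x0 : 0 <= x by rewrite -ler0c -cE.
have x1 : x < 1 by rewrite -ltcR -cE.
have y0 : 0 <= y by rewrite -ler0c -yE.
have z0 : 0 < z by rewrite -ltcR -zE.
have y1 : 0 < y + 1 by rewrite ltr_wpDl.
have x1' : `|x| < 1 by rewrite ger0_norm.
have /cvgrPdist_lt/(_ _ (divr_gt0 z0 y1))[k _ /(_ k (leqnn k))] := cvg_expr x1'.
rewrite /= sub0r normrN normrX (ger0_norm x0) ltr_pdivlMr // => h.
exists k; rewrite -rmorphXn -rmorphM ltcR; apply: le_lt_trans h.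
by rewrite ler_wpM2l ?exprn_ge0 // lerDl ler01.
Qed.

Section ComplexPower.
Variables (R : realType) (a : R).
Hypothesis a0 : 0 < a.

Lemma cpowD s t : cpow a (s + t) = cpow a s * cpow a t.
Proof.
rewrite /cpow raddfD /= (raddfD (@complex.Im R)) /= powRD; last by rewrite (gt_eqF a0) implybT.
rewrite rmorphM /= mulrDl cosD sinD mulrACA; congr (_ * _).
by apply/eqP; rewrite eq_complex /= eqxx /= addrC eqxx.
Qed.

Lemma cpow0 : cpow a 0 = 1.
Proof. by rewrite /cpow /= powRr0 mul0r cos0 sin0 mul1r. Qed.

Lemma cpowMn m s : cpow a (m%:R * s) = cpow a s ^+ m.
Proof.
elim: m => [|m IHm]; first by rewrite mul0r cpow0.
by rewrite -natr1 mulrDl mul1r cpowD IHm exprSr.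
Qed.

Lemma cpow_base e s : cpow (a ^+ e) s = cpow a s ^+ e.
Proof.
elim: e => [|e IHe]; first by rewrite /cpow powR1 ln1 mulr0 cos0 sin0 mul1r.
have ae : 0 < a ^+ e by rewrite exprn_gt0.
rewrite [in RHS]exprSr -IHe /cpow exprSr powRM ?(ltW a0) ?(ltW ae) // lnM ?posrE // mulrDr cosD sinD rmorphM /=.
rewrite mulrACA; congr (_ * _).
by apply/eqP; rewrite eq_complex /= eqxx /= addrC eqxx.
Qed.

Lemma norm_cpow s : `|cpow a s| = ((a `^ complex.Re s)%:C)%C.
Proof.
rewrite /cpow normrM [X in _ * X](_ : _ = 1) ?mulr1; last first.
  by rewrite normc_def /= cos2Dsin2 sqrtr1.
by rewrite ger0_norm // ler0c powR_ge0.
Qed.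

End ComplexPower.

(** The absolute value is p^(e - n Re s), with a negative exponent. *)
Lemma norm_expn_cpow (R : realType) (p e n : nat) (s : R[i]) : (1 < p)%N ->
  e%:R < n%:R * complex.Re s ->
  `|(p%:R : R[i]) ^+ e * cpow p%:R (- s) ^+ n| < 1.
Proof.
move=> p1 es; have p0 : 0 < p%:R :> R by rewrite ltr0n ltnW.
rewrite normrM !normrX normr_nat norm_cpow //.
have -> : p%:R ^+ e = ((p%:R : R) ^+ e)%:C%C :> R[i] by rewrite rmorphXn rmorph_nat.
have cX (x : R) : (x%:C ^+ n = (x ^+ n)%:C)%C by rewrite rmorphXn.
rewrite cX -rmorphM [X in _ < X](_ : 1 = (1 : R)%:C%C) // ltcR raddfN /=.
rewrite -powR_mulrn ?(ltW p0) // -(powR_mulrn n (powR_ge0 _ _)) -powRrM -powRD; last first.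
  by rewrite (gt_eqF p0) implybT.
rewrite /powR (gt_eqF p0) expR_lt1 pmulr_llt0 ?ln_gt0 ?ltr1n // mulNr subr_lt0 mulrC.
exact: es.
Qed.

(** * Types and their differences *)

Local Close Scope classical_set_scope.

Section TypeDifferences.
Variables (l m : nat).
Implicit Types (d : {ffun 'I_l.+1 -> 'I_m.+1}) (a : {ffun 'I_l -> 'I_m.+1}).

Definition asum d (i : nat) : nat := (\sum_(j < l.+1 | j <= i) d j)%N.

Lemma asum0 d : asum d 0 = d ord0.
Proof.
rewrite /asum (bigD1 ord0) //= big1 ?addn0 // => j /andP[j0 /eqP].
by case; apply: val_inj; apply/eqP; rewrite -leqn0.
Qed.

Lemma asumS d i : (i < l)%N -> asum d i.+1 = (asum d i + d (inord i.+1))%N.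
Proof.
move=> il; rewrite /asum (bigD1 (inord i.+1)) /= ?inordK // addnC; congr (_ + _)%N.
apply: eq_bigl => j; rewrite -val_eqE /= inordK //; lia.
Qed.

Lemma asum_max d : asum d l = (\sum_j d j)%N.
Proof. by apply: eq_bigl => j; rewrite -ltnS ltn_ord. Qed.

Lemma asum_homo d : {homo asum d : i j / (i <= j)%N}.
Proof.
move=> i j ij; rewrite /asum [X in (_ <= X)%N](bigID (fun k : 'I_l.+1 => (k <= i)%N)) /=.
rewrite [X in (_ <= X + _)%N](_ : _ = \sum_(k < l.+1 | k <= i) d k)%N ?leq_addr //.
by apply: eq_bigl => k; lia.
Qed.

(** [inord] is faithful only on values at most m, which is ensured when d has total m. *)
Definition type_of_diff d : {ffun 'I_l -> 'I_m.+1} := [ffun i : 'I_l => inord (asum d i)].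

(** The convention a_l = m beyond the last index makes m - a_(l-1) the last difference d_l. *)
Definition type_ext a (i : nat) : nat := if insub i is Some j then a j : nat else m.

Definition diff_of_type a : {ffun 'I_l.+1 -> 'I_m.+1} :=
  [ffun j : 'I_l.+1 => inord (type_ext a j - (if (j : nat) is k.+1 then type_ext a k else 0))%N].

Definition sortedb a : bool := [forall i : 'I_l, forall j : 'I_l, (i <= j)%N ==> (a i <= a j)%N].

Lemma type_ext_leq a i : (type_ext a i <= m)%N.
Proof. by rewrite /type_ext; case: insubP => [j _ _|_] //; rewrite -ltnS ltn_ord. Qed.

Lemma type_ext_homo a i : sortedb a -> (type_ext a i <= type_ext a i.+1)%N.
Proof.
move=> /forallP sa; rewrite {2}/type_ext; case: insubP => [j jl jE|_]; last exact: type_ext_leq.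
rewrite /type_ext insubT; first by rewrite ltnW // -jE ltn_ord.
move=> il; have /forallP/(_ j)/implyP := sa (Ordinal il); apply.
by rewrite /= jE leqnSn.
Qed.

Lemma asum_diff a i : sortedb a -> (i <= l)%N -> asum (diff_of_type a) i = type_ext a i.
Proof.
move=> sa; elim: i => [_|i IHi il].
  by rewrite asum0 ffunE subn0 inordK // ltnS type_ext_leq.
rewrite asumS // IHi ?(ltnW il) // ffunE !inordK // ?ltnS ?subnKC ?type_ext_homo //.
by rewrite (leq_trans (leq_subr _ _)) // type_ext_leq.
Qed.

Lemma type_ext_type d i : (\sum_j d j)%N = m -> (i <= l)%N ->
  type_ext (type_of_diff d) i = asum d i.
Proof.
move=> dm il; rewrite /type_ext; case: insubP => [j jl jE|].
  by rewrite ffunE inordK ?jE // ltnS -[X in (_ <= X)%N]dm -asum_max asum_homo.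
by rewrite -leqNgt => li; rewrite (_ : i = l) ?asum_max ?dm //; lia.
Qed.

Lemma type_of_diff_val d (i : 'I_l) : (\sum_j d j)%N = m -> type_of_diff d i = asum d i :> nat.
Proof.
by move=> dm; rewrite ffunE inordK // ltnS -[X in (_ <= X)%N]dm -asum_max asum_homo // ltnW.
Qed.

Lemma sum_types (K : nmodType) (F : {ffun 'I_l -> 'I_m.+1} -> K) :
  \sum_(a | sortedb a) F a =
  \sum_(d : {ffun 'I_l.+1 -> 'I_m.+1} | (\sum_j d j)%N == m) F (type_of_diff d).
Proof.
rewrite (reindex_onto type_of_diff diff_of_type) /=; last first.
  move=> a sa; apply/ffunP => i; apply: val_inj; rewrite /= ffunE asum_diff // ?(ltnW (ltn_ord i)) //.
  by rewrite inordK ?ltnS ?type_ext_leq // /type_ext valK.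
apply: eq_bigl => d; apply/andP/eqP => [[sa /eqP dE]|dm].
  by rewrite -asum_max -dE asum_diff // /type_ext insubF // ltnn.
split.
  apply/forallP => i; apply/forallP => j; apply/implyP => ij.
  by rewrite !type_of_diff_val // asum_homo.
apply/eqP/ffunP => j; apply: val_inj; rewrite /= ffunE.
have jl0 : (j <= l)%N by rewrite -ltnS ltn_ord.
rewrite type_ext_type //; have := ltn_ord j.
case E : (nat_of_ord j) => [|k] jl.
  rewrite subn0 asum0 inordK //; congr (nat_of_ord (d _)); exact: val_inj.
rewrite type_ext_type //; last by rewrite -ltnS ltnW.
rewrite asumS // addKn inord_val; congr (nat_of_ord (d _)); apply: val_inj.
by rewrite /= inordK // -E.
Qed.

End TypeDifferences.

(** * The exponent <J> and the polynomial varphi_(I) *)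

Section Brackets.

(** A smaller element x put in front of s replaces each parity by its complement for k >= x and
    leaves 0 below x. The sum of parities S becomes (l - x) - S, and so does the alternating sum. *)
Lemma alternating_sum (s : seq nat) l : sorted ltn s -> all (fun x => (x < l)%N) s ->
  \sum_(nu < size s) (-1) ^+ nu.+1 * ((nth 0%N s nu)%:Z - l%:Z) =
  \sum_(k < l) (odd (count (fun j => (j <= k)%N) s) : nat)%:Z.
Proof.
elim: s => [|x s IHs] /= ps; first by rewrite big_ord0 big1.
move=> /andP[xl sl]; rewrite big_ord_recl /= expr1 mulN1r opprB.
have IH := IHs (path_sorted ps) sl.
rewrite (eq_bigr (fun nu : 'I_(size s) => - ((-1) ^+ nu.+1 * ((nth 0%N s nu)%:Z - l%:Z)))); last first.
  by move=> nu _; rewrite /= exprS mulN1r mulNr.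
rewrite sumrN IH.
have xs : all (fun y => (x < y)%N) s by rewrite (order_path_min ltn_trans).
have E (k : 'I_l) : (odd ((x <= k)%N + count (fun j => (j <= k)%N) s) : nat)%:Z =
    ((x <= k)%N : nat)%:Z - (odd (count (fun j => (j <= k)%N) s) : nat)%:Z.
  have [xk|kx] := leqP x k; first by rewrite oddD /=; case: (odd (count _ _)).
  rewrite (_ : count _ s = 0%N) //; apply/eqP; rewrite -leqn0 leqNgt -has_count; apply/hasPn => y ys.
  by rewrite -ltnNge (ltn_trans kx) // (allP xs).
under [in RHS]eq_bigr => k _ do rewrite E.
rewrite sumrB; congr (_ - _).
rewrite -(big_mkord xpredT (fun k => ((x <= k)%N : nat)%:Z)) (big_cat_nat (leq0n x) (ltnW xl)) //=.
rewrite big_nat big1 ?add0r => [|k /andP[_ kx]]; last by rewrite leqNgt kx.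
rewrite (@eq_big_nat _ _ _ x l _ (fun=> 1)) => [|k /andP[xk _]]; last by rewrite xk.
by rewrite sumr_const_nat natz -subzn // ltnW.
Qed.

Lemma elements_sorted l (J : {set 'I_l}) : sorted ltn (elements J).
Proof.
have : sorted ltn (map val (Finite.enum 'I_l)) by rewrite -enumT val_enum_ord iota_ltn_sorted.
rewrite /elements !sorted_map /enum_mem => ls.
by apply: sorted_filter ls => ? ? ?; apply: ltn_trans.
Qed.

Lemma count_elements l (J : {set 'I_l}) (P : pred nat) :
  count P (elements J) = #|[set j in J | P (val j)]|.
Proof.
rewrite /elements count_map cardE -size_filter /enum_mem -filter_predI.
by congr size; apply: eq_filter => j; rewrite /= !inE andbC.
Qed.

(** Together with [odd_asum] this makes <J>, for J the set of odd differences, the number of odd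
    a_k, which is the form in which it comes out of the count. *)
Lemma bracketE l (J : {set 'I_l}) :
  bracket J = \sum_(k < l) (odd #|[set j in J | (j <= k)%N]| : nat)%:Z.
Proof.
have sz : size (elements J) = #|J| by rewrite size_map -cardE.
rewrite /bracket -sz alternating_sum ?elements_sorted //; last first.
  by apply/allP => x /mapP[i _ ->]; apply: ltn_ord.
by apply: eq_bigr => k _; rewrite count_elements.
Qed.

Lemma odd_asum l m (d : {ffun 'I_l.+1 -> 'I_m.+1}) (k : 'I_l) :
  odd #|[set j in dodd d | (j <= k)%N]| = odd (asum d k).
Proof.
rewrite /asum big_mkcond big_ord_recr /= [X in (_ + X)%N](_ : _ = 0%N); last first.
  by rewrite leqNgt ltn_ord.
rewrite addn0 -sum1_card big_mkcond /=.
apply: (big_ind2 (fun a b : nat => odd a = odd b)) => // [? ? ? ? e1 e2|i _].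
  by rewrite !oddD e1 e2.
rewrite !inE (_ : lift ord_max i = widen_ord (leqnSn l) i); last first.
  by apply: val_inj; rewrite /= /bump leqNgt ltn_ord.
by case: (i <= k)%N; rewrite ?andbT ?andbF //; case E: (odd (d (widen_ord (leqnSn l) i))).
Qed.

End Brackets.

Section PhiSet.
Variables (K : fieldType) (q : K).

Lemma phi_shift x y : (x <= y)%N -> phi (y - x) q = \prod_(x <= k < y) (q ^+ (y - k) - 1).
Proof.
move=> xy; have [e ->] : exists e, y = (x + e)%N by exists (y - x)%N; rewrite subnKC.
have shift (G : nat -> K) : \prod_(x <= k < x + e) G k = \prod_(0 <= i < e) G (i + x)%N.
  by have := @big_addn K 1 *%R 0 (x + e) x xpredT G; rewrite add0n addKn.
rewrite shift addKn /phi big_add1 /= big_nat_rev; apply: eq_big_nat => i ie.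
by congr (q ^+ _ - 1); lia.
Qed.

Lemma phi_blocks (s : seq nat) x l : path ltn x s -> all (fun y => (y < l)%N) (x :: s) ->
  \prod_(e <- pairmap (fun i j => j - i)%N x (rcons s l)) phi e q =
  \prod_(x <= k < l) (q ^+ (head l [seq j <- s | (k < j)%N] - k) - 1).
Proof.
elim: s x => [|y s IHs] x /=.
  by move=> _ /andP[xl _]; rewrite big_cons big_nil mulr1 phi_shift // ltnW.
move=> /andP[xy ps] /and3P[xl yl sl]; rewrite big_cons IHs //= ?yl // phi_shift ?(ltnW xy) //.
rewrite [RHS](big_cat_nat (ltnW xy) (ltnW yl)) /=; congr (_ * _).
  by apply: eq_big_nat => k /andP[_ ky]; rewrite ky.
by apply: eq_big_nat => k /andP[yk _]; rewrite ltnNge yk.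
Qed.

Lemma head_filter (s : seq nat) (l x : nat) : sorted ltn s -> x \in s ->
  all (fun y => (x <= y)%N) s -> head l s = x.
Proof.
case: s => // y s /= ps; rewrite inE => /predU1P[->//|xs] /andP[xy _].
have := allP (order_path_min ltn_trans ps) x xs; lia.
Qed.

(** Distributes the block factors of the multinomial over single indices, n k being the next element
    of I after k, or l. In this form varphi_(I) is compared with [card_Lat] index by index. *)
Lemma phi_setE l (I : {set 'I_l}) (n : 'I_l -> nat) : (forall i : 'I_l, i \in I -> (0 < i)%N) ->
  (forall k : 'I_l, n k = head l [seq j <- elements I | (k < j)%N]) ->
  phi_set I q = \prod_(k < l) ((q ^+ (l - k) - 1) / (q ^+ (n k - k) - 1)).
Proof.
move=> I0 nE; rewrite big_split /= prodfV /phi_set; congr (_ / _).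
  by rewrite -[in phi l](subn0 l) phi_shift // big_mkord.
case: l I n I0 nE => [|l] I n I0 nE.
  rewrite big_ord0 (_ : elements I = [::]) /= ?big_cons ?big_nil; last first.
    by case E : (elements I) => [|x s] //; have : x \in elements I by [rewrite E mem_head]; move=> /mapP[[]].
  by rewrite /phi big_geq ?mulr1.
rewrite phi_blocks; first by rewrite big_mkord; apply: eq_bigr => k _; rewrite nE.
  have := elements_sorted I; case E : (elements I) => [|x s] //= ->; rewrite andbT.
  have : x \in elements I by rewrite E mem_head.
  by case/mapP => i; rewrite mem_enum => /I0 i0 ->.
rewrite /=; apply/allP => x /mapP[i _ ->]; exact: ltn_ord.
Qed.

End PhiSet.

Section NextIndex.
Variables (l m : nat) (d : {ffun 'I_l.+1 -> 'I_m.+1}).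
Let a (i : 'I_l) : nat := asum d i.

Lemma asum_type_homo : {homo a : i j / (i <= j)%N}.
Proof. by move=> i j ij; apply: asum_homo. Qed.

Lemma asum_pred (j : 'I_l) : (0 < j)%N ->
  asum d j = (asum d j.-1 + d (lift ord_max j))%N.
Proof.
case E : (nat_of_ord j) => [|k] // _; have kl : (k.+1 < l)%N by rewrite -E.
rewrite asumS ?(ltnW kl) //=; congr (_ + nat_of_ord (d _))%N; apply: val_inj.
by rewrite /= /bump leqNgt ltn_ord E inordK // ltnW.
Qed.

(** The values of a jump exactly at the indices j > 0 with d_j > 0, so the block of k ends at the
    next of these. *)
Lemma nle_head (k : 'I_l) :
  nle a k = head l [seq j <- elements (@posI l :&: dpos d) | (k < j)%N].
Proof.
set I := @posI l :&: dpos d; set s := [seq j <- elements I | (k < j)%N].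
have hom := asum_type_homo.
have kn : (k < nle a k)%N by rewrite ltnNge nle_leq // ltnn.
have nl : (nle a k <= l)%N by rewrite -[X in (_ <= X)%N]card_ord max_card.
have sin (j : 'I_l) : (val j \in s) = (k < j)%N && (j \in I).
  by rewrite mem_filter /elements mem_map ?mem_enum //; apply: val_inj.
have lb x : x \in s -> (nle a k <= x)%N.
  move=> xs; have : x \in elements I by move: xs; rewrite mem_filter => /andP[].
  move=> /mapP[j _ xE]; move: xs; rewrite xE sin => /andP[kj]; rewrite !inE => /andP[j0 dj].
  rewrite nle_leq // /a (asum_pred j0).
  have : (asum d k <= asum d j.-1)%N by apply: asum_homo; lia.
  lia.
have ss : sorted ltn s by apply: (sorted_filter ltn_trans); apply: elements_sorted.
have [nE|nl'] := eqVneq (nle a k) l.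
  case E : s => [|x s'] //=; have xs : x \in s by rewrite E mem_head.
  have := lb x xs; rewrite nE; have : x \in elements I by move: xs; rewrite mem_filter => /andP[].
  by move=> /mapP[j _ ->]; rewrite leqNgt ltn_ord.
have jl : (nle a k < l)%N by rewrite ltn_neqAle nl'.
pose j := Ordinal jl; apply: esym; apply: head_filter => //; last by apply/allP.
rewrite -[nle a k]/(val j) sin kn !inE /= (leq_ltn_trans _ kn) //=.
have j0 : (0 < j)%N by rewrite (leq_ltn_trans _ kn).
have : (nle a k <= j)%N by [].
rewrite nle_leq // /a (asum_pred j0).
have jl1 : (j.-1 < l)%N by apply: leq_ltn_trans (leq_pred _) jl.
have : ~~ (nle a k <= Ordinal jl1)%N by rewrite -ltnNge /=; lia.
rewrite nle_leq // -leqNgt /a /=; lia.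
Qed.

End NextIndex.

(** * Powers of p in the number of lattices of a given type *)

Section PowerCount.
Variables (K : numFieldType) (h : K) (p : nat).
Hypotheses (p_gt1 : (1 < p)%N) (h2 : h ^+ 2 = p%:R).
Local Notation q := (p%:R^-1 : K).

Let p0 : p%:R != 0 :> K. Proof. by rewrite pnatr_eq0 -lt0n ltnW. Qed.
Let h0 : h != 0. Proof. by apply: contraNneq p0 => h0; rewrite -h2 h0 expr0n. Qed.

Lemma expq_neq1 e : (0 < e)%N -> q ^+ e - 1 != 0.
Proof.
move=> e0; rewrite subr_eq0 exprVn invr_eq1 -natrX pnatr_eq1.
by rewrite -(expn0 p) eqn_exp2l // -lt0n.
Qed.

Lemma natr_powB n k : (k <= n)%N -> (p ^ n - p ^ k)%:R = - (p%:R ^+ n * (q ^+ (n - k) - 1)) :> K.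
Proof.
move=> kn; rewrite natrB ?leq_exp2l // !natrX mulrBr mulr1 opprB; congr (_ - _).
by rewrite -{1}(subnK kn) exprD exprVn mulrAC mulfV ?mul1r // expf_neq0.
Qed.

Lemma Lat_count l (a : 'I_l -> nat) (C : nat) : {homo a : i j / (i <= j)%N} ->
  (C * \prod_i (p ^ nle a i - p ^ i) =
    (\prod_(i < l) (p ^ l - p ^ i)) * \prod_i \prod_j p ^ (a j - a i).-1)%N ->
  C%:R = p%:R ^+ (\sum_i \sum_j (a j - a i))%N *
    \prod_(k < l) ((q ^+ (l - k) - 1) / (q ^+ (nle a k - k) - 1)) :> K.
Proof.
move=> hom E.
have kn (k : 'I_l) : (k < nle a k)%N by rewrite ltnNge nle_leq // ltnn.
have nz (k : 'I_l) : (p ^ nle a k - p ^ k)%:R != 0 :> K.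
  by rewrite pnatr_eq0 subn_eq0 -ltnNge ltn_exp2l.
have /(congr1 (fun n : nat => n%:R : K)) := E; rewrite !natrM !natr_prod => E'.
have nz' : \prod_i (p ^ nle a i - p ^ i)%:R != 0 :> K by apply/prodf_neq0 => i _.
apply: (mulIf nz'); rewrite E' -[p%:R ^+ _]prodrXr -!big_split /=; apply: eq_bigr => k _.
rewrite !natr_powB ?(ltnW (kn k)) ?(ltnW (ltn_ord k)) //.
(* For each j, the 1 contributed by l completes a_j - a_k - 1 to a_j - a_k if a_j > a_k; otherwise
   it is the contribution of j to [nle a k]. *)
have key : p%:R ^+ l * (\prod_j p ^ (a j - a k).-1)%:R = p%:R ^+ (\sum_j (a j - a k)) * p%:R ^+ nle a k :> K.
  rewrite -!exprD natr_prod; under eq_bigr do rewrite natrX.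
  rewrite prodrXr -exprD; congr (_ ^+ _).
  have lE : l = (\sum_(j < l) 1)%N by rewrite sum1_card card_ord.
  rewrite [X in (X + _ = _)%N]lE.
  have -> : nle a k = (\sum_(j < l) (a j <= a k : nat))%N.
    by rewrite /nle -sum1_card big_mkcond /=; apply: eq_bigr => j _; rewrite inE; case: leqP.
  rewrite -!big_split /=; apply: eq_bigr => j _.
  by case: leqP; lia.
have z := expq_neq1 (_ : 0 < nle a k - k)%N; rewrite subn_gt0 kn in z; have {}z := z isT.
rewrite mulNr mulrN; congr (- _).
by rewrite mulrAC key [RHS]mulrACA divfK.
Qed.

(** For each pair i < j, the a_j - a_i coming from [card_Lat] and the a_i coming from the free
    coefficient S_ji add up to a_j. *)
Lemma sum_leading l (a : 'I_l -> nat) : {homo a : i j / (i <= j)%N} ->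
  (\sum_i \sum_j (a j - a i) + \sum_(ij : 'I_l * 'I_l) (if (ij.2 < ij.1)%N then a ij.2 else 0) =
   \sum_(j < l) j * a j)%N.
Proof.
move=> hom; rewrite -(pair_big xpredT xpredT (fun i j : 'I_l => if (j < i)%N then a j else 0%N)) /=.
rewrite [in X in (_ + X)%N]exchange_big /= -big_split /=.
under eq_bigr do rewrite -big_split /=.
rewrite exchange_big /=; apply: eq_bigr => j _.
rewrite (eq_bigr (fun i : 'I_l => (i < j)%N * a j)%N) => [|i _]; last first.
  have [ij|ji] := ltnP i j; first by rewrite mul1n subnK // hom // ltnW.
  by rewrite mul0n addn0; apply/eqP; rewrite subn_eq0 hom.
rewrite -big_distrl /=; congr (_ * _)%N.
rewrite -(big_mkord xpredT (fun i => (i < j)%N : nat)) (big_cat_nat (leq0n j) (ltnW (ltn_ord j))) //=.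
rewrite big_nat (eq_bigr (fun=> 1%N)) => [|i /andP[_ ->]] //.
rewrite -big_nat sum_nat_const_nat subn0 muln1 big_nat big1 ?addn0 // => i /andP[ji _].
by rewrite ltnNge ji.
Qed.

(** Exponents are doubled and put on h, a square root of p, because the sums over layers deviate
    from n0 a_i / 2 by half integers; z will be 2 B or -2 B. *)
Lemma total_count l n0 (z : int) (a : 'I_l -> nat) (C : nat) (ls : nat -> nat) :
  {homo a : i j / (i <= j)%N} ->
  (C * \prod_i (p ^ nle a i - p ^ i) =
    (\prod_(i < l) (p ^ l - p ^ i)) * \prod_i \prod_j p ^ (a j - a i).-1)%N ->
  (forall i, (2 * ls (a i))%:Z = (n0 * a i)%:Z + (odd (a i) : nat)%:Z * z) ->
  (C * ((\prod_i p ^ ls (a i)) *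
   \prod_(ij : 'I_l * 'I_l) (if (ij.2 < ij.1)%N then p ^ (a ij.2) else 1)))%:R =
  h ^+ (\sum_(j < l) (2 * j + n0) * a j)%N * h ^ (\sum_(k < l) (odd (a k) : nat)%:Z * z) *
    \prod_(k < l) ((q ^+ (l - k) - 1) / (q ^+ (nle a k - k) - 1)) :> K.
Proof.
move=> hom CE lsE; rewrite natrM (Lat_count hom CE) mulrAC; congr (_ * _).
rewrite natrM !natr_prod.
have -> : \prod_(ij : 'I_l * 'I_l) (if (ij.2 < ij.1)%N then (p ^ a ij.2)%N else 1%N)%:R =
   p%:R ^+ (\sum_(ij : 'I_l * 'I_l) (if (ij.2 < ij.1)%N then a ij.2 else 0))%N :> K.
  by rewrite -prodrXr; apply: eq_bigr => ij _; case: ifP => _; rewrite ?natrX ?expr0.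
rewrite mulrCA -exprD sum_leading // -h2 -exprM.
under eq_bigr do rewrite natrX -h2 -exprM.
rewrite prodrXr -[LHS]exprD.
have hz (n : nat) : h ^+ n = h ^ n%:Z by [].
rewrite !hz -expfzDr //; congr (h ^ _).
have -> : (\sum_(j < l) (2 * j + n0) * a j = \sum_i n0 * a i + 2 * \sum_(j < l) j * a j)%N.
  by rewrite big_distrr -big_split /=; apply: eq_bigr => j _; rewrite mulnDl addnC mulnA.
rewrite !PoszD addrAC; congr (_ + _).
rewrite !(big_morph Posz PoszD (erefl _)) -big_split /=; apply: eq_bigr => i _; exact: lsE.
Qed.

(** Summation by parts, with a_j = d_0 + ... + d_j: the term 2 j + n0 is collected by every d_i with
    i <= j. *)
Lemma prod_diff_pow l m n0 (d : {ffun 'I_l.+1 -> 'I_m.+1}) :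
  \prod_(j < l) (h ^+ (n0 * (l - j) + (l * l.-1 - j * j.-1))) ^+ d (lift ord_max j) =
  h ^+ (\sum_(j < l) (2 * j + n0) * asum d j)%N.
Proof.
under eq_bigr do rewrite -exprM.
rewrite prodrXr; congr (_ ^+ _).
have tail (i : nat) : (i <= l)%N ->
    (n0 * (l - i) + (l * l.-1 - i * i.-1) = \sum_(i <= j < l) (2 * j + n0))%N.
  move=> il; rewrite -(subnKC il); move: (l - i)%N => e; rewrite addKn.
  elim: e => [|e IHe]; first by rewrite addn0 big_geq // subnn muln0.
  rewrite addnS big_nat_recr ?leq_addr //= -IHe.
  have h1 : ((i + e).+1 * (i + e) = (i + e) * (i + e).-1 + 2 * (i + e))%N.
    by case: (i + e)%N => [|t] //=; lia.
  have h3 : (i * i.-1 <= (i + e) * (i + e).-1)%N by rewrite leq_mul ?leq_addr //; lia.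
  rewrite h1; move: h3; move: ((i + e) * (i + e).-1)%N (i * i.-1)%N => A B; lia.
under [in RHS]eq_bigr => j _ do rewrite /asum big_mkcond big_distrr /= big_ord_recr /=.
rewrite big_split /= [X in (_ = _ + X)%N]big1 ?addn0; last first.
  by move=> j _; rewrite leqNgt ltn_ord muln0.
rewrite exchange_big /=; apply: eq_bigr => i _.
rewrite (_ : lift ord_max i = widen_ord (leqnSn l) i); last first.
  by apply: val_inj; rewrite /= /bump leqNgt ltn_ord.
rewrite tail ?(ltnW (ltn_ord i)) // big_distrl /=.
rewrite -(big_mkord xpredT (fun j => (2 * j + n0) * (if (i <= j)%N then d (widen_ord (leqnSn l) i) : nat else 0)))%N.
rewrite [RHS](big_cat_nat (leq0n i) (ltnW (ltn_ord i))) /= [X in (_ = X + _)%N](_ : _ = 0%N).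
  by rewrite add0n; apply: eq_big_nat => j /andP[ij _]; rewrite ij.
by rewrite big_nat_cond big1 // => j /andP[/andP[_ ji] _]; rewrite leqNgt ji muln0.
Qed.

End PowerCount.

Local Open Scope classical_set_scope.

(** * Counting maximal sublattices of given norm *)

Section ReductionModulo.
Variables (p : nat) (p_pr : prime p) (m : nat).
(** [rho] at N = m + 1, where 0 < N is provable outright, so that the ring morphism structure
    carries no side condition. *)
Definition rhoS : padic_int p_pr -> 'Z_(p ^ m.+1) := @rho p p_pr m.+1.
HB.instance Definition _ := GRing.isZmodMorphism.Build _ _ rhoS (rho_zmod (ltn0Sn m)).
HB.instance Definition _ := GRing.isMonoidMorphism.Build _ _ rhoS (rho_monoid p_pr (ltn0Sn m)).
End ReductionModulo.

Section LevelCount.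
Variables (p : nat) (p_pr : prime p).
Local Notation O := (padic_int p_pr).
Local Notation F := (padic p_pr).
Local Notation pi := (p%:R : F).
Variables (V : vectType F) (beta : {symmetric V}).
Local Notation Q := (quad beta).
Local Notation l := (witt_index beta).
Hypothesis nondeg : nondegenerate beta.
Hypothesis l_gt0 : (0 < l)%N.
Variables (k : int) (v u : 'I_l -> V).
Hypothesis hvu : hyperbolic k v u.
Local Notation L := (hlattice k v u).
Variable d : nat.
Hypothesis lay01 : has_index (layer k v u 0) (layer k v u 1) (p ^ d).
Variable m : nat.
Local Notation rh := (@rhoS p p_pr m).
Local Notation fr := (@tofrac O).

Lemma hlattice_lcomb_integral (c : 'rV[F]_l) : L (lcomb v c) ->
  exists c' : 'rV[O]_l, c = map_mx fr c'.
Proof.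
move=> [_ h]; have cO i : pideal 0 (c 0 i).
  by have := (h i).2; rewrite betaC (beta_y_lcomb_x hvu) -{1}[k]addr0 => /pideal_scale.
have /choice[f fE] : forall i, exists x : O, c 0 i = fr x.
  by move=> i; have [x ->] := cO i; exists x; rewrite expr0z mul1r.
by exists (\row_i f i); apply/rowP => i; rewrite !mxE.
Qed.

Section ChangeOfBasis.
Variable G : 'M[O]_l.
Hypothesis Gu : G \in unitmx.

Definition basis_v (i : 'I_l) : V := lcomb v (row i (map_mx fr G)).
(** The partners change by the inverse transpose, which preserves the pairing. As G is invertible
    over O, neither L nor W changes. *)
Definition basis_u (i : 'I_l) : V := lcomb u (row i (map_mx fr (invmx G)^T)).

Lemma lcomb_basis_v (c : 'rV[O]_l) :
  lcomb basis_v (map_mx fr c) = lcomb v (map_mx fr (c *m G)).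
Proof. by rewrite /basis_v lcomb_mul -map_mxM. Qed.

Lemma basis_hyperbolic : hyperbolic k basis_v basis_u.
Proof.
split=> i j.
- by rewrite beta_lcombl big1 // => i' _; rewrite (beta_x_lcomb_x hvu) mulr0.
- by rewrite beta_lcombl big1 // => i' _; rewrite (beta_y_lcomb_y hvu) mulr0.
rewrite beta_lcombl.
have -> : (i == j)%:R = (map_mx fr (G *m invmx G)) i j.
  by rewrite mulmxV // map_mx1 mxE.
rewrite map_mxM mxE mulr_sumr; apply: eq_bigr => t _.
by rewrite (beta_x_lcomb_y hvu) !mxE mulrCA.
Qed.

Lemma lcomb_basis_integral (w : 'I_l -> V) (H : 'M[O]_l) z :
  (forall i, pideal k (beta z (w i))) ->
  forall i, pideal k (beta z (lcomb w (row i (map_mx fr H)))).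
Proof.
move=> zw i; rewrite beta_lcombr; apply: pideal_sum => j _; rewrite !mxE.
by rewrite -[k]add0r; apply: pidealM => //; apply: pideal_frac.
Qed.

Lemma basis_lattice : hlattice k basis_v basis_u = L.
Proof.
have vE i : v i = lcomb basis_v (row i (map_mx fr (invmx G))).
  by rewrite /basis_v lcomb_mul -row_mul -map_mxM mulVmx // map_mx1 row1 lcomb_delta.
have uE i : u i = lcomb basis_u (row i (map_mx fr G^T)).
  by rewrite /basis_u lcomb_mul -row_mul -map_mxM -trmx_mul mulVmx // trmx1 map_mx1 row1 lcomb_delta.
apply/seteqP; split=> z [Qz h]; split=> // i; split.
- by rewrite vE; apply: lcomb_basis_integral => j; case: (h j).
- by rewrite uE; apply: lcomb_basis_integral => j; case: (h j).
- by apply: lcomb_basis_integral => j; case: (h j).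
- by apply: lcomb_basis_integral => j; case: (h j).
Qed.

Lemma basis_complement : witt_complement basis_v basis_u = witt_complement v u.
Proof.
have lin (w w' : 'I_l -> V) (H : 'M[O]_l) z : (forall i, beta z (w i) = 0) ->
    forall i, beta z (lcomb w (row i (map_mx fr H))) = 0.
  by move=> zw i; rewrite beta_lcombr big1 // => j _; rewrite zw mulr0.
have vE i : v i = lcomb basis_v (row i (map_mx fr (invmx G))).
  by rewrite /basis_v lcomb_mul -row_mul -map_mxM mulVmx // map_mx1 row1 lcomb_delta.
have uE i : u i = lcomb basis_u (row i (map_mx fr G^T)).
  by rewrite /basis_u lcomb_mul -row_mul -map_mxM -trmx_mul mulVmx // trmx1 map_mx1 row1 lcomb_delta.
apply/seteqP; split=> z h i; split.
- by rewrite vE; apply: (lin) => // j; case: (h j).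
- by rewrite uE; apply: (lin) => // j; case: (h j).
- by apply: (lin) => // j; case: (h j).
- by apply: (lin) => // j; case: (h j).
Qed.

End ChangeOfBasis.

Definition sublattices_level : set (set V) :=
  [set M | [/\ maximal_lattice beta M, M `<=` L & lattice_norm beta M = pideal (k + m%:Z)]].

Local Notation T := {set 'rV['Z_(p ^ m.+1)]_l}.

(** The intersection of M with the span of the v_i, modulo p^(m+1). Nothing is lost, as M contains
    the p^m v_i by [level_scaled]. *)
Definition reduction (M : set V) : T :=
  [set x | `[< exists2 c : 'rV[O]_l, M (lcomb v (map_mx fr c)) & x = map_mx rh c >]]%SET.

(** M lies in L, hence pairs with p^m v_i into p^(k + m) O, and maximality of M applies. *)
Lemma level_scaled M (c : 'rV[O]_l) : sublattices_level M ->
  (forall i, pdvd m (c 0 i)) -> M (lcomb v (map_mx fr c)).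
Proof.
move=> [Mmax ML Mn] cm; apply: (maximal_mem Mmax Mn).
  rewrite quad_beta0; first exact: pideal0.
  by rewrite beta_lcombl big1 // => i _; rewrite (beta_x_lcomb_x hvu) mulr0.
move=> y /ML[_ h]; rewrite beta_lcombr; apply: pideal_sum => i _.
by rewrite mxE addrC; apply: pidealM; [apply/pideal_dvd|case: (h i)].
Qed.

Lemma reductionE M (a : 'I_l -> nat) (G : 'M[O]_l) : sublattices_level M -> G \in unitmx ->
  (forall i, (a i <= m)%N) ->
  (forall c : 'rV[O]_l, M (lcomb v (map_mx fr (c *m G))) <-> forall i, pdvd (a i) (c 0 i)) <->
  reduction M = latset a (map_mx rh G).
Proof.
move=> Ml Gu am; have MS := maximal_submod (let: And3 Mmax _ _ := Ml in Mmax).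
have aN i : (a i <= m.+1)%N := leqW (am i).
have diagP (c : 'rV[O]_l) : (map_mx rh c \in diagset p m.+1 a) <-> forall i, pdvd (a i) (c 0 i).
  rewrite inE; split=> [/forallP h i|h].
    by apply/(dvr_rho (ltn0Sn m) _ (aN i)); have := h i; rewrite mxE.
  by apply/forallP => i; rewrite mxE; apply/(dvr_rho (ltn0Sn m) _ (aN i)).
have lift (y : 'rV['Z_(p ^ m.+1)]_l) : exists c : 'rV[O]_l, y = map_mx rh c.
  by exists (\row_i (y 0 i : nat)%:R); apply/rowP => i; rewrite !mxE; apply/esym/rho_lift.
have gu : map_mx rh G \in unitmx by rewrite unitmxE det_map_mx rmorph_unit // -unitmxE.
split=> [h|h c].
  apply/setP => x; rewrite inE; apply/asboolP/imsetP => [[c Mc ->]|[y yd ->]].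
    exists (map_mx rh (c *m invmx G)); last by rewrite -map_mxM mulmxKV.
    by apply/diagP/h; rewrite mulmxKV.
  have [c yE] := lift y; exists (c *m G); last by rewrite yE map_mxM.
  by apply/h/diagP; rewrite -yE.
split=> [Mc|cd].
  have : map_mx rh (c *m G) \in reduction M by rewrite inE; apply/asboolP; exists (c *m G).
  rewrite h => /imsetP[y yd]; rewrite map_mxM => /(can_inj (mulmxK gu)) yE.
  by apply/diagP; rewrite yE.
have : map_mx rh (c *m G) \in reduction M.
  by rewrite h; apply/imsetP; exists (map_mx rh c); [apply/diagP|rewrite map_mxM].
rewrite inE => /asboolP[c1 Mc1 e].
have -> : c *m G = (c *m G - c1) + c1 by rewrite subrK.
rewrite map_mxD lcombD; apply: submodD => //; apply: level_scaled => // i.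
have e0 : rho m.+1 ((c *m G - c1) 0 i) = 0.
  have := congr1 (fun z : 'rV_l => z 0 i) e; rewrite !mxE => e1.
  by rewrite -[rho m.+1 _]/(rh _) rmorphB /= e1 subrr.
have [y ->] := rho_eq0 (ltn0Sn m) e0.
by exists (p%:R * y); rewrite mulrA -exprSr.
Qed.

(** Adapting the basis by G brings a fibre of [reduction] to the diagonal case, where the lattices
    are already counted. *)
Lemma level_over (a : 'I_l -> nat) (G : 'M[O]_l) : G \in unitmx ->
  (forall i, (a i <= m)%N) ->
  sublattices_level `&` [set M | reduction M = latset a (map_mx rh G)] =
  sublattices_over k (basis_v G) (basis_u G) m a.
Proof.
move=> Gu am; apply/seteqP; split=> [M [Ml /(reductionE Ml Gu am) h]|M [Mmax ML Mn Mv]].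
  have [Mmax ML Mn] := Ml; split=> //; first by rewrite basis_lattice.
  move=> c; split=> [Mc i|cd].
    have cE : c = (c *m map_mx fr G) *m map_mx fr (invmx G).
      by rewrite -mulmxA -map_mxM mulmxV // map_mx1 mulmx1.
    have [c' c'E] : exists c' : 'rV[O]_l, c *m map_mx fr G = map_mx fr c'.
      by apply: hlattice_lcomb_integral; apply: ML; rewrite -lcomb_mul.
    move: cE Mc; rewrite c'E -map_mxM => -> ; rewrite lcomb_basis_v => /h hc.
    by rewrite mxE; apply/pideal_dvd.
  have /choice[f fE] : forall i, exists x : O, c 0 i = fr x.
    move=> i; have [x ->] := cd i; exists (p%:R ^+ a i * x).
    by rewrite rmorphM rmorphXn rmorph_nat.
  have cE : c = map_mx fr (\row_i f i) by apply/rowP => i; rewrite !mxE.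
  rewrite cE lcomb_basis_v; apply/h => i; apply/pideal_dvd.
  by have := cd i; rewrite mxE fE.
have Ml : sublattices_level M by split=> //; rewrite -(basis_lattice Gu).
split=> //; apply/(reductionE Ml Gu am) => c; rewrite -lcomb_basis_v; split=> [/Mv h i|h].
  by apply/pideal_dvd; have := h i; rewrite mxE.
by apply/Mv => i; rewrite mxE; apply/pideal_dvd.
Qed.

Lemma level_type M : sublattices_level M -> exists a : {ffun 'I_l -> 'I_m.+1},
  sortedb a /\ reduction M \in Lat p m.+1 (fun i => a i : nat).
Proof.
move=> Ml; have MS := maximal_submod (let: And3 Mmax _ _ := Ml in Mmax).
pose N : set 'rV[O]_l := [set c | M (lcomb v (map_mx fr c))].
have NS : Osubmod N.
  split=> [|x y Nx Ny|c x Nx]; rewrite /N /=.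
  - by rewrite map_mx0 lcomb0; case: MS.
  - by rewrite map_mxD lcombD; apply: submodD.
  - by rewrite map_mxZ lcombZ; apply: submodZ => //; apply: pideal_frac.
have Nm x : N (p%:R ^+ m *: x).
  by apply: level_scaled => // i; rewrite mxE; exists (x 0 i).
have [E [a [Eu ah am aE]]] := smith_normal_form NS Nm.
exists [ffun i => inord (a i)]; split.
  apply/forallP => i; apply/forallP => j; apply/implyP => ij.
  by rewrite !ffunE !inordK ?ltnS ?am // ah.
have -> : (fun i => [ffun i => inord (a i) : 'I_m.+1] i : nat) = a.
  by apply/funext => i; rewrite ffunE inordK // ltnS.
apply/imsetP; exists (map_mx rh E); first by rewrite inE unitmxE det_map_mx rmorph_unit // -unitmxE.
by apply/(reductionE Ml Eu am) => c; apply: aE.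
Qed.

Definition type_count (a : 'I_l -> nat) : nat :=
  ((\prod_i p ^ layer_sum beta d ((a i)%:Z - m%:Z) (a i)) *
   \prod_(ij : 'I_l * 'I_l) (if (ij.2 < ij.1)%N then p ^ (a ij.2) else 1))%N.

(** The lattices are sorted by the module [reduction M]. A module has at most one sorted type, and
    the size of its fibre depends on this type only. *)
Lemma card_level : finite_set sublattices_level /\ ncard sublattices_level =
  (\sum_(a : {ffun 'I_l -> 'I_m.+1} | sortedb a)
     #|Lat p m.+1 (fun i => a i : nat)| * type_count (fun i => a i : nat))%N.
Proof.
pose av (a : {ffun 'I_l -> 'I_m.+1}) := fun i => a i : nat.
have avm a i : (av a i <= m)%N by rewrite -ltnS ltn_ord.
have avN a i : (av a i < m.+1)%N by exact: ltn_ord.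
have avh a : sortedb a -> {homo av a : i j / (i <= j)%N}.
  by move=> /forallP h i j ij; have /forallP/(_ j)/implyP := h i; apply.
have -> : (\sum_(a | sortedb a) #|Lat p m.+1 (av a)| * type_count (av a) =
   \sum_(t : T) \sum_(a | sortedb a) (t \in Lat p m.+1 (av a)) * type_count (av a))%N.
  rewrite exchange_big /=; apply: eq_bigr => a _; rewrite -big_distrl /=; congr (_ * _)%N.
  by rewrite -sum1_card big_mkcond /=; apply: eq_bigr => t _; case: (t \in _).
apply: (@ncard_fibers _ _ reduction) => t.
have [[a /andP[sa ta]]|na] := pselect (exists a, sortedb a && (t \in Lat p m.+1 (av a))).
  rewrite (bigD1 a) //= ta mul1n [X in (_ + X)%N]big1 ?addn0 => [|b /andP[sb ba]]; last first.
    case tb : (t \in _); rewrite ?mul0n //; case/eqP: ba; apply/ffunP => i; apply: val_inj; apply/eqP.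
    rewrite eqn_leq (Lat_type_leq p_pr (ltn0Sn m) (avh a sa) (avh b sb) (avN a) (avN b) ta tb i).
    by rewrite (Lat_type_leq p_pr (ltn0Sn m) (avh b sb) (avh a sa) (avN b) (avN a) tb ta i).
  move: (ta) => /imsetP[g]; rewrite inE => gu tE.
  pose G : 'M[O]_l := \matrix_(i, j) (g i j : nat)%:R.
  have GE : map_mx rh G = g by apply/matrixP => i j; rewrite !mxE; apply: rho_lift.
  have Gu : G \in unitmx.
    rewrite unitmxE; apply: (unit_rho (ltn0Sn m)); rewrite -[rho _ _]/(rh _).
    by rewrite -det_map_mx GE -unitmxE.
  have := @level_over (av a) G Gu (avm a); rewrite GE -tE => ->.
  have hG := basis_hyperbolic Gu.
  have layG : has_index (layer k (basis_v G) (basis_u G) 0) (layer k (basis_v G) (basis_u G) 1) (p ^ d).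
    by rewrite /layer (basis_complement Gu).
  have avha := avh a sa; have avma := avm a.
  exact: card_sublattices_over.
have -> : sublattices_level `&` [set M | reduction M = t] = set0.
  apply/seteqP; split=> // M [Ml /= Mt]; case: na; have [a [sa ra]] := level_type Ml.
  by exists a; rewrite sa -Mt.
rewrite big1 => [|a sa]; last first.
  by case ta : (t \in _); rewrite ?mul0n //; case: na; exists a; rewrite sa.
by split; [exact: finite_set0|rewrite /ncard fset_set0].
Qed.

Lemma level_index M : sublattices_level M ->
  has_index L M (p ^ (l * m + layer_sum beta d 0 m)).
Proof.
move=> Ml; have [a [sa /imsetP[g]]] := level_type Ml; rewrite inE => gu tE.
pose G : 'M[O]_l := \matrix_(i, j) (g i j : nat)%:R.
have GE : map_mx rh G = g by apply/matrixP => i j; rewrite !mxE; apply: rho_lift.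
have Gu : G \in unitmx.
  rewrite unitmxE; apply: (unit_rho (ltn0Sn m)); rewrite -[rho _ _]/(rh _).
  by rewrite -det_map_mx GE -unitmxE.
have am i : (a i <= m)%N by rewrite -ltnS ltn_ord.
have Mo : sublattices_over k (basis_v G) (basis_u G) m (fun i => a i) M.
  by rewrite -level_over // GE; split.
have ah : {homo (fun i => a i : nat) : i j / (i <= j)%N}.
  by move=> i j ij; have /forallP/(_ i)/forallP/(_ j)/implyP := sa; apply.
rewrite expnD -(basis_lattice Gu).
have hG := basis_hyperbolic Gu.
have layG : has_index (layer k (basis_v G) (basis_u G) 0) (layer k (basis_v G) (basis_u G) 1) (p ^ d).
  by rewrite /layer (basis_complement Gu).
exact: (over_index nondeg l_gt0 hG am layG Mo).
Qed.

End LevelCount.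

(** * Comparison with the polynomials W *)

Local Close Scope classical_set_scope.

Lemma odd_abszD (j : int) (c : nat) : odd (absz (j + c%:Z)) = odd (absz j) (+) odd c.
Proof.
elim: c => [|c IHc]; first by rewrite addr0 addbF.
rewrite -addn1 PoszD addrA addn1 /= addbN -IHc; move: (j + c%:Z) => z.
case: z => [n|[|n]] //; first by rewrite -PoszD addn1.
by have -> : Negz n.+1 + 1 = Negz n by [lia]; rewrite /= negbK.
Qed.

Section LayerSums.
Variables (p : nat) (p_pr : prime p) (V : vectType (padic p_pr)) (beta : {symmetric V}).
Local Notation n0 := (\dim {:V} - 2 * witt_index beta)%N.

(** Consecutive exponents sum to n0 in pairs; the one left over when c is odd is d or n0 - d
    according to the parity of the first layer j. *)
Lemma layer_sum_double d (j : int) c : (d <= n0)%N ->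
  (2 * layer_sum beta d j c)%:Z = (n0 * c)%:Z +
    (odd c : nat)%:Z * (if odd `|j|%N then n0%:Z - (2 * d)%:Z else (2 * d)%:Z - n0%:Z).
Proof.
move=> dn; elim: c => [|c IHc]; first by rewrite /layer_sum big_ord0 !muln0 mul0r.
rewrite /layer_sum big_ord_recr /= -/(layer_sum beta d j c) mulnDr PoszD IHc {IHc}.
rewrite /layer_exp odd_abszD; move: dn; move: n0 => N dn.
by case: (odd c); case: (odd `|j|%N) => /=; rewrite ?mulnS; lia.
Qed.

End LayerSums.

Section Monomials.
Variables (K : numFieldType) (h : K) (l n0 d : nat).
Hypothesis h0 : h != 0.

Definition Aexp : rat := n0%:R / 2%:R - 1.
Definition Bexp : rat := - d%:R + n0%:R / 2%:R.
(* The sum of the 2 j + n0 over i <= j < l. *)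
Definition xe (i : nat) : nat := (n0 * (l - i) + (l * l.-1 - i * i.-1))%N.
Definition xmono (i : 'I_l) : K := h ^+ xe i.
Local Notation u := (hpow h Aexp).

Lemma hpowE r (z : int) : 2%:R * r = z%:~R -> hpow h r = h ^ z.
Proof. by move=> e; rewrite /hpow e numq_int. Qed.

Lemma hpowA : u = h ^ (n0%:Z - 2%:Z).
Proof. by apply: hpowE; rewrite /Aexp rmorphB /= -!pmulrn; lra. Qed.

Lemma triangular_gap i : (i <= l)%N ->
  (l * l.+1 - i * i.+1 = (l * l.-1 - i * i.-1) + 2 * (l - i))%N.
Proof.
move=> il; have tri k : (k * k.+1 = k * k.-1 + 2 * k)%N by case: k => [|k] //=; lia.
have le : (i * i.-1 <= l * l.-1)%N by apply: leq_mul => //; lia.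
by rewrite !tri; move: (i * i.-1)%N (l * l.-1)%N le => a b le; lia.
Qed.

Lemma half_triangular k : (2 * (k * k.+1)./2 = k * k.+1)%N.
Proof. by rewrite mul2n halfK oddM /= andbN subn0. Qed.

(** The first two exponents are the contributions of i to b_l and a_l; the last factor u comes from
    the substitution of X^A T for T. *)
Lemma xmonoE i : xmono i =
  u ^+ (l.-1 - i) * (h ^+ 2) ^+ ((l * l.+1)./2 - (i * i.+1)./2) * u.
Proof.
have il := ltn_ord i.
rewrite /xmono hpowA -exprM mulnBr !half_triangular triangular_gap ?(ltnW il) //.
rewrite [_ ^+ (l.-1 - i)]exprnP exprz_exp !(exprnP h) -!expfzDr //; congr (h ^ _).
rewrite /xe; have -> : (l - i = (l.-1 - i).+1)%N by lia.
by move: (l.-1 - i)%N (l * l.-1 - i * i.-1)%N => a b; lia.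
Qed.

Lemma prod_xmono (J : {set 'I_l}) : \prod_(i in J) xmono i =
  u ^+ bexp J * (h ^+ 2) ^+ aexp J * u ^+ #|J|.
Proof.
under eq_bigr do rewrite xmonoE.
by rewrite !big_split /= !prodrXr prodr_const.
Qed.

Lemma Upoly_comp (J : {set 'I_l}) :
  (Upoly J (h ^+ 2) u \Po (u *: 'X)) * (u *: 'X) ^+ #|J| =
  \sum_(I0 : {set 'I_l} | I0 \subset J :&: @posI l)
    \sum_(I1 : {set 'I_l} | I1 \subset @posI l :\: J)
      (wpoly (I0 :|: I1) (h ^+ 2)^-1 *
        ((\prod_(i in J) xmono i) * (\prod_(i in I1) xmono i) ^+ 2)) *:
        'X^(#|J| + 2 * #|I1|).
Proof.
rewrite /Upoly comp_polyZ raddf_sum /= -scalerAl mulr_suml scaler_sumr; apply: eq_bigr => I0 _.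
rewrite raddf_sum /= mulr_suml scaler_sumr; apply: eq_bigr => I1 _.
rewrite [(_ *: 'X^_) ^+ 2]exprZn -['X^_ ^+ 2]exprM !comp_polyZ comp_Xn_poly ![(u *: 'X) ^+ _]exprZn.
rewrite -!scalerAl -scalerAr !scalerA -['X^_ * 'X^_]exprD; congr (_ *: 'X^_); last by rewrite addnC mulnC.
rewrite !prod_xmono [u ^+ (_ * 2)]exprM.
move: (wpoly _ _) (u ^+ bexp J) (u ^+ bexp I1) (u ^+ #|J|) (u ^+ #|I1|) => c1 c2 c3 c4 c5.
by move: (h ^+ 2 ^+ aexp J) (h ^+ 2 ^+ aexp I1) => c6 c7; ring.
Qed.

Definition bcoef (B : rat) (J : {set 'I_l}) : K := hpow h (B * (bracket J)%:~R).
Local Notation wq := (fun J : {set 'I_l} => wpoly J (h ^+ 2)^-1).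

Lemma Uparity_comp (b : bool) (B : rat) (e : bool -> nat) :
  (Uparity l b B h u \Po (u *: 'X)) * 'X^(e b) =
  \sum_(J : {set 'I_l} | odd #|J| == b) bcoef B J *:
    \sum_(I0 : {set 'I_l} | I0 \subset J :&: @posI l)
    \sum_(I1 : {set 'I_l} | I1 \subset @posI l :\: J)
      (wq (I0 :|: I1) * ((\prod_(i in J) xmono i) * (\prod_(i in I1) xmono i) ^+ 2)) *:
        'X^(#|J| + 2 * #|I1| + e (odd #|J|)).
Proof.
rewrite /Uparity raddf_sum /= mulr_suml; apply: eq_bigr => J /eqP Jb.
rewrite comp_polyM comp_polyZ comp_Xn_poly -!scalerAl Upoly_comp Jb; congr (_ *: _).
rewrite mulr_suml; apply: eq_bigr => I0 _; rewrite mulr_suml; apply: eq_bigr => I1 _.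
by rewrite -scalerAl -exprD.
Qed.

Lemma Wgen_split (B : rat) (eps : bool) : Wgen xmono wq (bcoef B) eps =
  (Uparity l false B h u \Po (u *: 'X)) * 'X^eps + (Uparity l true B h u \Po (u *: 'X)) * 'X^(~~ eps).
Proof.
rewrite /Wgen (bigID (fun J : {set 'I_l} => odd #|J| == false)) /=.
congr (_ + _).
  by rewrite (Uparity_comp false B (fun b => b (+) eps)).
have := Uparity_comp true B (fun b => b (+) eps); rewrite /= => ->.
by apply: eq_bigl => J; case: odd.
Qed.

Lemma W0E : W0 l Aexp Bexp h = Wgen xmono wq (bcoef Bexp) false.
Proof. by rewrite Wgen_split /W0 /Ueven /Uodd /= expr0 expr1 mulr1. Qed.

Lemma W1E : W1 l Aexp Bexp h = Wgen xmono wq (bcoef (- Bexp)) true.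
Proof. by rewrite Wgen_split /W1 /Ueven /Uodd /= expr0 expr1 mulr1. Qed.

Lemma xextE (i : 'I_l.+1) : xext xmono i = h ^+ xe i.
Proof.
rewrite /xext; case: unliftP => [j ->|->]; last by rewrite /xe /= !subnn muln0.
by rewrite /xmono /= /bump leqNgt ltn_ord.
Qed.

(** With A = n0 / 2 - 1 both values are r (n0 + 2 l - r - 1), so the r-th factor of the denominator
    is 1 - x_i^2 T^2 for i = l - r. As l > 0, the predecessor of 2 l - r is not truncated. *)
Lemma cexpE (r : 'I_l.+1) : (0 < l)%N ->
  cexp l Aexp r = (r * (n0 + (2 * l - r).-1))%:R /\ xe (rev_ord r) = (r * (n0 + (2 * l - r).-1))%N.
Proof.
move=> l_gt0; have rl : (r <= l)%N by rewrite -ltnS ltn_ord.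
split.
  have [e eE] : exists e, (2 * l - r = e.+1)%N by exists (2 * l - r).-1; lia.
  have lE : l%:R = (e%:R + 1 + r%:R) / 2%:R :> rat.
    have -> : e%:R + 1 + r%:R = (2 * l)%:R :> rat by rewrite natr1 -natrD; congr (_%:R); lia.
    by rewrite natrM; field.
  by rewrite eE /= natrM natrD /cexp lE /Aexp; field.
have key t k : ((t + k) * (t + k).-1 - t * t.-1 = k * (2 * (t + k) - k).-1)%N.
  have e : ((2 * (t + k) - k).-1 = (2 * t + k).-1)%N by congr (_.-1); lia.
  rewrite e; case: t {e} => [|t]; first by rewrite /= !(muln0, add0n, mul0n, subn0).
  have e' : ((t.+1 + k) * (t.+1 + k).-1 = t.+1 * t + k * (2 * t.+1 + k).-1)%N.
    have -> : ((2 * t.+1 + k).-1 = 2 * t + 1 + k)%N by lia.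
    by rewrite addSn /=; lia.
  by rewrite e' /= addKn.
rewrite /xe /= subSS; have -> : (l - (l - r) = r)%N by lia.
rewrite mulnDr [(r * n0)%N]mulnC; congr (_ + _)%N.
by have := key (l - r)%N r; rewrite subnK.
Qed.

Lemma hpow_cexp (r : 'I_l.+1) : (0 < l)%N ->
  hpow h (cexp l Aexp r) = (h ^+ 2) ^+ (r * (n0 + (2 * l - r).-1)) /\
  hpow h (cexp l Aexp r) = xext xmono (rev_ord r) ^+ 2.
Proof.
move=> l_gt0; have [cE xE] := cexpE r l_gt0.
have E : hpow h (cexp l Aexp r) = (h ^+ 2) ^+ (r * (n0 + (2 * l - r).-1)).
  rewrite cE -exprM; apply: (@hpowE _ (2 * (r * (n0 + (2 * l - r).-1)))%N%:Z).
  by rewrite -pmulrn [RHS]natrM.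
by split=> //; rewrite E xextE xE -!exprM mulnC.
Qed.

End Monomials.

Section LevelIdentity.
Variables (p : nat) (p_pr : prime p) (V : vectType (padic p_pr)) (beta : {symmetric V}).
Local Notation l := (witt_index beta).
Local Notation n0 := (\dim {:V} - 2 * witt_index beta)%N.
Variables (K : numFieldType) (h : K) (d : nat).
Hypotheses (h2 : h ^+ 2 = p%:R) (l_gt0 : (0 < l)%N) (dn : (d <= n0)%N).

Let p_gt1 : (1 < p)%N := prime_gt1 p_pr.
Let h0 : h != 0.
Proof. by apply/eqP => h0; move: h2; rewrite h0 expr0n /= => /esym/eqP; rewrite pnatr_eq0; case: (p) p_gt1. Qed.

(** For odd a_i the first layer a_i - m has the parity of m - 1, so the sign of B depends on m
    alone; even a_i contribute no deviation. *)
Definition level_sign (m : nat) : rat := if odd m then - Bexp n0 d else Bexp n0 d.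

(** The identity holds term by term: [total_count] gives the powers of h, [bracketE] the exponent of
    B, and [nle_head] matches the blocks of the type with the support of the differences. *)
Lemma type_identity m (e : {ffun 'I_l.+1 -> 'I_m.+1}) : (\sum_j e j)%N = m ->
  (#|Lat p m.+1 (fun i : 'I_l => asum e i)| *
   ((\prod_(i < l) p ^ layer_sum beta d ((asum e i)%:Z - m%:Z) (asum e i)) *
    \prod_(ij : 'I_l * 'I_l) (if (ij.2 < ij.1)%N then p ^ (asum e ij.2) else 1)))%N%:R =
  (\prod_(j < l) xmono h n0 j ^+ e (lift ord_max j)) * bcoef h (level_sign m) (dodd e) *
    \sum_(H : {set 'I_l} | H \subset @posI l :&: dpos e) wpoly H (h ^+ 2)^-1 :> K.
Proof.
move=> em; have hom := @asum_type_homo _ _ e.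
have lt (i : 'I_l) : (asum e i < m.+1)%N.
  by rewrite ltnS -[X in (_ <= X)%N]em -asum_max asum_homo // ltnW.
pose z : int := if odd m then (2 * d)%:Z - n0%:Z else n0%:Z - (2 * d)%:Z.
rewrite (@total_count K h p p_gt1 h2 l n0 z (fun i : 'I_l => asum e i) _
  (fun a => layer_sum beta d (a%:Z - m%:Z) a) hom (card_Lat p_pr (ltn0Sn m) hom lt)); last first.
  move=> i; rewrite layer_sum_double //; congr (_ + _).
  have := odd_abszD ((asum e i)%:Z - m%:Z)%R m; rewrite subrK /=.
  by case: (odd (asum e i)); rewrite ?mul0r // /z; case: (odd m); case: (odd `|_|%N).
rewrite -(prod_diff_pow p_gt1 h2); congr (_ * _ * _).
  have zE : 2%:R * level_sign m = z%:~R.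
    by rewrite /level_sign /z /Bexp; case: (odd m); rewrite rmorphB /= -!pmulrn natrM; lra.
  rewrite /bcoef (@hpowE _ _ _ (bracket (dodd e) * z)); last by rewrite mulrA zE rmorphM /= mulrC.
  rewrite bracketE mulr_suml; congr (h ^ _); apply: eq_bigr => k _.
  by rewrite odd_asum.
have -> : \sum_(H : {set 'I_l} | H \subset @posI l :&: dpos e) wpoly H (h ^+ 2)^-1 =
    phi_set (@posI l :&: dpos e) (h ^+ 2)^-1.
  exact: (moebius_subsets (fun J => phi_set J (h ^+ 2)^-1)).
rewrite (@phi_setE _ _ _ _ (nle (fun i : 'I_l => asum e i))) ?h2 // => [i|k].
  by rewrite !inE => /andP[].
exact: nle_head.
Qed.

Lemma level_sum_coef m : (\sum_(a : {ffun 'I_l -> 'I_m.+1} | sortedb a)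
     #|Lat p m.+1 (fun i => a i : nat)| *
     ((\prod_i p ^ layer_sum beta d ((a i)%:Z - m%:Z) (a i)) *
      \prod_(ij : 'I_l * 'I_l) (if (ij.2 < ij.1)%N then p ^ (a ij.2) else 1)))%N%:R =
  \sum_(e : {ffun 'I_l.+1 -> 'I_m.+1} | \sum_i (e i : nat) == m)
    (\prod_(j < l) xmono h n0 j ^+ e (lift ord_max j)) * bcoef h (level_sign m) (dodd e) *
    \sum_(H : {set 'I_l} | H \subset @posI l :&: dpos e) wpoly H (h ^+ 2)^-1 :> K.
Proof.
rewrite natr_sum sum_types; apply: eq_bigr => e /eqP em.
rewrite -(type_identity em).
have aE : (fun i => type_of_diff e i : nat) = (fun i : 'I_l => asum e i).
  by apply/funext => i; apply: type_of_diff_val.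
have aE' i : type_of_diff e i = asum e i :> nat by apply: type_of_diff_val.
rewrite aE; congr ((_ * (_ * _))%N%:R).
  by apply: eq_bigr => i _; rewrite aE'.
by apply: eq_bigr => i _; rewrite aE'.
Qed.

Definition denominators : nat -> K := fps_prod (fun r : 'I_l.+1 =>
  fps_inv (fps_poly (1 - hpow h (cexp l (Aexp n0) r) *: 'X^2))).

Lemma coef_W0 m : fps_mul denominators (fps_poly (W0 l (Aexp n0) (Bexp n0 d) h)) m =
  if odd m then 0 else (\sum_(a : {ffun 'I_l -> 'I_m.+1} | sortedb a)
     #|Lat p m.+1 (fun i => a i : nat)| *
     ((\prod_i p ^ layer_sum beta d ((a i)%:Z - m%:Z) (a i)) *
      \prod_(ij : 'I_l * 'I_l) (if (ij.2 < ij.1)%N then p ^ (a ij.2) else 1)))%N%:R.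
Proof.
rewrite (W0E _ _ _ h0) /denominators coef_Wgen; last by move=> r; case: (hpow_cexp n0 h0 r l_gt0).
by rewrite level_sum_coef /level_sign; case: (odd m).
Qed.

Lemma coef_W1 m : fps_mul denominators (fps_poly (W1 l (Aexp n0) (Bexp n0 d) h)) m =
  if odd m then (\sum_(a : {ffun 'I_l -> 'I_m.+1} | sortedb a)
     #|Lat p m.+1 (fun i => a i : nat)| *
     ((\prod_i p ^ layer_sum beta d ((a i)%:Z - m%:Z) (a i)) *
      \prod_(ij : 'I_l * 'I_l) (if (ij.2 < ij.1)%N then p ^ (a ij.2) else 1)))%N%:R else 0.
Proof.
rewrite (W1E _ _ _ h0) /denominators coef_Wgen; last by move=> r; case: (hpow_cexp n0 h0 r l_gt0).
by rewrite level_sum_coef /level_sign; case: (odd m).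
Qed.

End LevelIdentity.

Local Open Scope classical_set_scope.

Lemma ncard_subtype (U : choiceType) (A B : set U) : A `<=` B -> finite_set A ->
  finite_set [set t : set_type B | A (val t)] /\ ncard [set t : set_type B | A (val t)] = ncard A.
Proof.
move=> AB finA; pose S := fset_set A.
have SA (x : S) : A (val x) by apply: set_mem; rewrite -in_fset_set //; exact: valP.
have SB (x : S) : val x \in B by apply: mem_set; apply: AB.
pose f (x : S) : set_type B := exist (fun y => y \in B) (val x) (SB x).
have finj : injective f by move=> x y [] /val_inj.
rewrite [ncard A]/ncard cardfE; apply: (ncard_inj finj).
apply/seteqP; split=> [t At|_ [x _ <-]]; last exact: SA.
have tS : val t \in S by rewrite in_fset_set //; apply: mem_set.
by exists [` tS]%fset => //; apply: val_inj.
Qed.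

Lemma fps_mulX (K : fieldType) (a : nat -> K) n :
  fps_mul a (fps_poly 'X) n = if n is k.+1 then a k else 0.
Proof.
rewrite /fps_mul /fps_poly; case: n => [|n]; first by rewrite big_ord1 subn0 coefX mulr0.
rewrite big_ord_recr /= subnn coefX mulr0 addr0 big_ord_recr /= subSnn coefX mulr1.
rewrite big1 ?add0r // => i _; rewrite coefX (_ : (n.+1 - i == 1)%N = false) ?mulr0 //.
by apply/negbTE; rewrite subSn ?(ltnW (ltn_ord i)) // eqSS subn_eq0 -ltnNge.
Qed.

(** * Maximal sublattices sorted by norm *)

Section LevelsOfMaximalLattice.
Variables (p : nat) (p_pr : prime p).
Local Notation F := (padic p_pr).
Local Notation pi := (p%:R : F).
Variables (V : vectType F) (beta : {symmetric V}).
Local Notation l := (witt_index beta).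
Hypothesis nondeg : nondegenerate beta.
Hypothesis l_gt0 : (0 < l)%N.
Variables (L : set V).
Hypothesis Lmax : maximal_lattice beta L.

Lemma scaled_normE k m : lattice_norm beta L = pideal k -> scaled_norm beta m L = pideal (k + m%:Z).
Proof.
move=> Ln; rewrite /scaled_norm Ln; apply/seteqP; split=> [_ [x kx <-]|x kx].
  by rewrite addrC exprnP; apply/pideal_scale.
exists (pi ^ (- m%:Z) * x); last by rewrite exprnP mulrA -expz_pD subrr mul1r.
by rewrite (_ : k = - m%:Z + (k + m%:Z)); [apply/pideal_scale|lia].
Qed.

(** A value chosen by [xget] comes with a Witt decomposition, which becomes the frame of the whole
    count. The second branch shows that such values exist, so the default case does not arise. *)
Lemma witt_partialP : exists k (v u : 'I_l -> V),
  [/\ lattice_norm beta L = pideal k, hyperbolic k v u, L = hlattice k v u &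
      has_index (layer k v u 0) (layer k v u 1) (p ^ witt_partial beta L)].
Proof.
have [k [x [y [Ln hxy LE]]]] := maximal_structure nondeg l_gt0 Lmax.
have L0E (v v' : 'I_l -> V) : witt_L0 L v v' = layer k v (fun i => pi ^ k *: v' i) 0.
  by rewrite /witt_L0 /layer complement_scale Ln addr0.
have L1E (v v' : 'I_l -> V) : witt_L0p1 L v v' = layer k v (fun i => pi ^ k *: v' i) 1.
  by rewrite /witt_L0p1 /layer complement_scale (scaled_normE 1 Ln).
rewrite /witt_partial; case: xgetP => [d -> [v [v' [dec dim]]]|/(_ _)].
  have [hvu LE'] := decomposition_hlattice Ln dec.
  exists k, v, (fun i => pi ^ k *: v' i); split=> //.
  by apply: Fp_quotient_dim_index => //; rewrite -L0E -L1E.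
move=> none; have dec := hlattice_decomposition Ln hxy LE.
have [d dim] := Fp_quotient_dim_ex nondeg hxy.
case: (none d); exists x, (fun i => pi ^ (- k) *: y i); split=> //.
rewrite L0E L1E (_ : (fun i => _) = y) //; apply/funext => i.
by rewrite scalerA -expz_pD subrr scale1r.
Qed.

Section Frame.
Variables (k : int) (v u : 'I_l -> V).
Hypotheses (Ln : lattice_norm beta L = pideal k) (hvu : hyperbolic k v u).
Hypothesis LE : L = hlattice k v u.

Lemma sublattices_normE m :
  maximal_sublattices_norm beta L m = sublattices_level k v u m.
Proof.
rewrite /maximal_sublattices_norm /maximal_sublattices (scaled_normE m Ln) /sublattices_level -LE.
by apply/seteqP; split=> M; [move=> [[? ?] ?]|move=> [? ? ?]]; split.
Qed.

Lemma sublattice_level M : maximal_sublattices beta L M -> exists m, sublattices_level k v u m M.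
Proof.
move=> [Mmax ML]; have [k' Mn] := lattice_norm_ex nondeg l_gt0 Mmax.1.
have kk' : k <= k'.
  apply/(pideal_expzE p_pr); rewrite -Ln.
  have : lattice_norm beta M (pi ^ k') by rewrite Mn; apply: pideal_expz.
  apply: Ospan_sub; first exact: Ospan_submod.
  by move=> _ [x Mx <-]; apply: sub_Ospan; exists x => //; apply: ML.
exists `|k' - k|%N; split=> //; first by rewrite -LE.
by rewrite Mn; congr pideal; lia.
Qed.

Lemma sublattice_level_uniq M m m' :
  sublattices_level k v u m M -> sublattices_level k v u m' M -> m = m'.
Proof.
move=> [_ _ Mn] [_ _ Mn']; have E : pideal (k + m%:Z) = pideal (k + m'%:Z) :> set F by rewrite -Mn Mn'.
have h1 : pideal (k + m%:Z) (pi ^ (k + m'%:Z)) by rewrite E; apply: pideal_expz.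
have h2 : pideal (k + m'%:Z) (pi ^ (k + m%:Z)) by rewrite -E; apply: pideal_expz.
move/(pideal_expzE p_pr): h1 => h1; move/(pideal_expzE p_pr): h2 => h2.
by clear - h1 h2; lia.
Qed.

End Frame.
End LevelsOfMaximalLattice.

Theorem theorem2p30 (R : realType) (p : nat) (p_pr : prime p)
    (V : vectType (padic p_pr)) (beta : {symmetric V}) (n l n0 : nat)
    (L : set V) (A B : rat) (h : R[i])
    (beta_nondegenerate : nondegenerate beta)
    (dimV : \dim {:V} = n) (wittV : witt_index beta = l) (l_ge1 : (1 <= l)%N)
    (n0E : n0 = (n - 2 * l)%N)
    (f_eq2 : similitude_index beta 2)
    (L_maximal : maximal_lattice beta L)
    (AE : A = n0%:R / 2%:R - 1)
    (BE : B = - (witt_partial beta L)%:R + n0%:R / 2%:R)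
    (hE : h = ((Num.sqrt p%:R)%:C)%C) :
  let denominators := fps_prod (fun r : 'I_l.+1 =>
        fps_inv (fps_poly (1 - hpow h (cexp l A r) *: 'X^2))) in
  [/\ fps_compX2 (zeta0 beta L R[i]) =
        fps_mul denominators (fps_poly (W0 l A B h)),
      fps_mul (fps_compX2 (zeta1 beta L R[i])) (fps_poly 'X) =
        fps_mul denominators (fps_poly (W1 l A B h)) &
      forall s : R[i],
        (forall r : 'I_l.+1, ratr (cexp l A r) < n%:R * complex.Re s) ->
        partial_sum (fun M : set_type (maximal_sublattices beta L) =>
            cpow (lattice_index L (val M))%:R (- s) : R[i]^o) @ totally -->
          (\prod_(r < l.+1)
             (1 - hpow h (cexp l A r) * cpow p%:R (- (n%:R * s)))^-1 *
           Wtotal l A B h (cpow p%:R (- s / 2%:R)) : R[i]^o)].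
Proof.
move=> denominators; move: wittV dimV n0E => wittV dimV n0E; subst l n n0.
set n0 := (\dim {:V} - 2 * witt_index beta)%N in AE BE.
have [k [v [u [Ln hvu LE lay01]]]] := witt_partialP beta_nondegenerate l_ge1 L_maximal.
move: BE lay01; set d := witt_partial beta L => BE lay01.
have [dn _] := layer_index1 beta_nondegenerate hvu lay01; rewrite -/n0 in dn.
have [dim2 _] := complement_basis hvu.
have {}AE : A = Aexp n0 by rewrite AE.
have {}BE : B = Bexp n0 d by rewrite BE.
subst A B.
have p_gt1 := prime_gt1 p_pr.
have p0 : 0 < p%:R :> R by rewrite ltr0n ltnW.
have h2 : h ^+ 2 = p%:R by rewrite hE -rmorphXn sqr_sqrtr ?(ltW p0) // rmorph_nat.
have h0 : h != 0.
  by apply/eqP => h0; move: h2; rewrite h0 expr0n /= => /esym/eqP; rewrite pnatr_eq0 -leqn0 leqNgt ltnW.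
pose N m := ncard (maximal_sublattices_norm beta L m).
have finN m := card_level beta_nondegenerate l_ge1 hvu lay01 m.
have normE m : maximal_sublattices_norm beta L m = sublattices_level k v u m.
  exact: sublattices_normE.
have c0 m : fps_mul denominators (fps_poly (W0 (witt_index beta) (Aexp n0) (Bexp n0 d) h)) m =
    if odd m then 0 else (N m)%:R.
  by rewrite (coef_W0 h2 l_ge1 dn) /N normE (finN m).2.
have c1 m : fps_mul denominators (fps_poly (W1 (witt_index beta) (Aexp n0) (Bexp n0 d) h)) m =
    if odd m then (N m)%:R else 0.
  by rewrite (coef_W1 h2 l_ge1 dn) /N normE (finN m).2.
split.
- apply/funext => m; rewrite c0 /fps_compX2 /zeta0; case: ifP => // om.
  by rewrite halfK om subn0.
- apply/funext => m; rewrite c1 fps_mulX; case: m => [|m] //=.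
  by rewrite /fps_compX2 /zeta1; case: ifP => //= om; rewrite halfK om subn0.
move=> s hs.
(* Y = p^(-s/2) is the argument of W^total; z = Y^n is the value given to T, with z^2 = p^(-ns), and
   kappa = Y^(-2B) weights the odd levels. *)
pose Y := cpow p%:R (- s / 2%:R); pose z := Y ^+ \dim {:V}.
pose kappa := Y ^ ((2 * d)%:Z - n0%:Z).
have Y0 : Y != 0 by rewrite -normr_gt0 norm_cpow // ltcR powR_gt0.
have Y2 : cpow p%:R (- s) = Y ^+ 2.
  by rewrite -cpowMn // mulrC divfK // pnatr_eq0.
pose c (r : 'I_(witt_index beta).+1) := hpow h (cexp (witt_index beta) (Aexp n0) r).
have z2 : z ^+ 2 = cpow p%:R (- s) ^+ \dim {:V} by rewrite Y2 /z -!exprM mulnC.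
have cz r : `|c r * z ^+ 2| < 1.
  have [cE _] := cexpE n0 h0 r l_ge1; have [hc _] := hpow_cexp n0 h0 r l_ge1.
  rewrite z2 /c hc h2; apply: norm_expn_cpow => //.
  by have := hs r; rewrite cE ratr_nat.
pose b0 := fps_mul denominators (fps_poly (W0 (witt_index beta) (Aexp n0) (Bexp n0 d) h)).
pose b1 := fps_mul denominators (fps_poly (W1 (witt_index beta) (Aexp n0) (Bexp n0 d) h)).
pose P w := \prod_r (1 - c r * w ^+ 2)^-1.
(* General in w and kap because it is used twice: at (z, kappa) and, for absolute convergence, at
   their absolute values. *)
have conv w kap : (forall r, `|c r * w ^+ 2| < 1) ->
    tends (fun M => \sum_(0 <= m < M) (N m)%:R * (w ^+ m * (if odd m then kap else 1)))
      (P w * (W0 (witt_index beta) (Aexp n0) (Bexp n0 d) h).[w] +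
       kap * (P w * (W1 (witt_index beta) (Aexp n0) (Bexp n0 d) h).[w])).
  move=> cw; have arch := @complex_archimedean R.
  have t0 := tends_fps_prod arch (tends_poly w (W0 (witt_index beta) (Aexp n0) (Bexp n0 d) h)) cw.
  have t1 := tends_fps_prod arch (tends_poly w (W1 (witt_index beta) (Aexp n0) (Bexp n0 d) h)) cw.
  have := tendsD t0 (tendsZ kap t1); congr tends; apply/funext => M.
  rewrite /psum mulr_sumr -big_split /=; apply: eq_bigr => m _.
  rewrite -/denominators c0 c1; case: (odd m); last by rewrite mul0r mulr0 addr0 mulr1.
  by rewrite mul0r add0r [LHS]mulrC -mulrA.
(* p^(eM m) is the index of a lattice of level m. As 2 eM m is n m, plus 2 d - n0 when m is odd, its
   power of exponent -s is z^m, times kappa when m is odd. *)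
pose eM m := (witt_index beta * m + layer_sum beta d 0 m)%N.
pose g m : R[i] := cpow (p ^ eM m)%:R (- s).
have gE m : g m = z ^+ m * (if odd m then kappa else 1).
  rewrite /g natrX cpow_base // Y2 -exprM.
  have eE : (2 * eM m)%:Z = (\dim {:V} * m)%:Z + (odd m : nat)%:Z * ((2 * d)%:Z - n0%:Z).
    have := layer_sum_double 0 m dn; rewrite -/n0 /= => ld.
    by rewrite /eM mulnDr PoszD ld addrA -PoszD mulnA -mulnDl subnKC.
  rewrite exprnP eE expfzDr // -exprnP exprM; congr (_ * _).
  by rewrite /kappa; case: (odd m); rewrite ?mul1r ?mul0r.
have lvl (t : set_type (maximal_sublattices beta L)) : exists m, sublattices_level k v u m (val t).
  have tL : maximal_sublattices beta L (val t) := set_mem (valP t).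
  by apply: sublattice_level tL => //.
have [lev levP] := choice lvl.
have levN m : finite_set [set t | lev t = m] /\ ncard [set t | lev t = m] = N m.
  have -> : [set t | lev t = m] =
      [set t : set_type (maximal_sublattices beta L) | sublattices_level k v u m (val t)].
    apply/seteqP; split=> t /=; first by move=> <-; apply: levP.
    exact: (sublattice_level_uniq (levP t)).
  rewrite /N normE; apply: ncard_subtype; last exact: (finN m).1.
  by move=> M; rewrite -normE => -[].
have limE : P z * (W0 (witt_index beta) (Aexp n0) (Bexp n0 d) h).[z] +
       kappa * (P z * (W1 (witt_index beta) (Aexp n0) (Bexp n0 d) h).[z]) =
    \prod_(r < (witt_index beta).+1)
       (1 - hpow h (cexp (witt_index beta) (Aexp n0) r) * cpow p%:R (- ((\dim {:V})%:R * s)))^-1 *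
     Wtotal (witt_index beta) (Aexp n0) (Bexp n0 d) h (cpow p%:R (- s / 2%:R)).
  have -> : cpow p%:R (- ((\dim {:V})%:R * s)) = z ^+ 2.
    by rewrite -mulrN cpowMn // z2.
  rewrite /Wtotal -/(P z) -/Y.
  have -> : 2%:R * ((witt_index beta)%:R + Aexp n0 + 1) = (\dim {:V})%:Z%:~R :> rat.
    by rewrite -pmulrn -(subnKC dim2) natrD natrM -/n0 /Aexp; lra.
  have -> : - 2%:R * Bexp n0 d = ((2 * d)%:Z - n0%:Z)%:~R :> rat.
    by rewrite rmorphB /= -!pmulrn natrM /Bexp; lra.
  by rewrite !numq_int -exprnP -/z -/kappa mulrDr; congr (_ + _); rewrite mulrC mulrA.
rewrite -limE.
apply: (partial_sum_levels levN (g := g)).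
- move=> t; rewrite /g; congr (cpow _%:R _).
  have := level_index beta_nondegenerate l_ge1 hvu lay01 (levP t); rewrite -LE => idx.
  apply: ncard_cosets idx; apply: submod_subgroup.
  by have [Mmax _ _] := levP t; exact: (maximal_submod Mmax).
- by have := conv z kappa cz; congr tends; apply/funext => M; apply: eq_bigr => m _; rewrite gE.
(* The bounds on c_r z^2 only involve absolute values, so the same limit exists at |z| and gives
   absolute convergence. *)
have cz' r : `|c r * `|z| ^+ 2| < 1 by have := cz r; rewrite !normrM !normrX normr_id.
have := conv _ `|kappa| cz'; congr tends; apply/funext => M; apply: eq_bigr => m _.
by rewrite gE normrM [ `|z ^+ m| ]normrX; case: (odd m); rewrite ?normr1.
Qed.
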